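(* Let $\sigma\colon X\to X$ be a topologically mixing one-sided subshift of finite type with a Gibbs measure $\mu$ of a H\''older potential, $0<\theta<1$, and let $f^+\colon X\to\mathbb R$ be Lipschitz (w.r.t. $d^+_\theta$) with $\int f^+d\mu=0$ and with the collapsed accessibility property. Let $F^+(x,r)=(\sigma x,r+f^+(x))$ on $X\times\mathbb R$ and $\nu=\mu\times\mathrm{Leb}$. Then for every $\psi\in\mathscr L^+$, every $\Phi\in\mathscr G^+$, every $k\in\mathbb N$ and every $\varepsilon>0$ there is $C=C(\Phi,\psi,k,\varepsilon)>0$ such that for all $n\ge1$, $$|\mathrm{cov}(\Phi\circ(F^+)^n,\psi)|\le C\Big(\mathrm{LF}\big(\Phi,n^{-\frac12+\varepsilon}\big)+n^{-k}\Big).$$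
   Context: $d^+_\theta(x,y)=\theta^{\max\{j:\ x_i=y_i\ \forall\,0\le i<j\}}$; Lipschitz means w.r.t. $d^+_\theta$, $|w|_\theta=\sup_{x\ne y}|w(x)-w(y)|/d^+_\theta(x,y)$. Birkhoff sums $f_n=\sum_{i<n}f^+\circ\sigma^i$. Collapsed accessibility: there are constants $C,N$ such that for any $x\in X$, $t\in[0,1]$ and integer $n\ge2N$ there are points $x_1,y_1,x_2,y_2,\dots,y_m,x_{m+1}$ with $m\le N$, $x_1=x_{m+1}=x$, $\sigma^nx_i=\sigma^ny_i$, $d^+_\theta(y_i,x_{i+1})\le C\theta^n$, and $t=\sum_{k=1}^m\big(f_n(x_k)-f_n(y_k)\big)$. $\mathscr S$ denotes Schwartz functions on $\mathbb R$. $\mathscr L^+$ is the space of maps $\psi\colon X\to\mathscr S$ such that for every $\ell\in\mathbb N$ the map $x\mapsto\partial^\ell\psi(x)$ from $X$ to $L^1(\mathbb R)$ is Lipschitz. $\mathscr A$ is the set of Fourier–Stieltjes transforms $\widehat\eta(r)=\int e^{-ir\xi}d\eta(\xi)$ of complex measures $\eta$ of finite total variation; $\mathscr G^+$ is the space of (measurable) maps $\Phi\colon X\to\mathscr A$, $\Phi(x)=\widehat{\eta_x}$, with $\sup_x\|\eta_x\|_{TV}<\infty$. Functions are identified via $\Phi(x,r)=[\Phi(x)](r)$. For $\Phi\in\mathscr G^+$, $\nu_{\mathrm{av}}(\Phi)=\lim_{R\to\infty}\frac1{2R}\int_{X\times[-R,R]}\Phi\,d\nu$ (this limit exists), and $\mathrm{cov}(\Phi\circ(F^+)^n,\psi)=\int_{X\times\mathbb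 R}(\Phi\circ(F^+)^n)\overline\psi\,d\nu-\nu_{\mathrm{av}}(\Phi)\int\psi\,d\nu$. $\mathrm{LF}(\Phi,r)=\int_X|\eta_x|((-r,r)\setminus\{0\})\,d\mu(x)$.
   Formalization: In cov the subtracted term is ν_av(Φ) times the integral of the complex conjugate of ψ, not of ψ; for complex ψ the formula as written fails (Φ=1 gives LF=0 but cov=−2i Im∫ψ dν), and for real ψ the two agree. *)

(* Defs.v *)
From HB Require Import structures.
From mathcomp Require Import all_boot all_order all_algebra.
From mathcomp Require Import all_classical all_reals all_analysis.
Set Implicit Arguments. Unset Strict Implicit. Unset Printing Implicit Defensive.
Import Order.TTheory GRing.Theory Num.Theory.
Import numFieldNormedType.Exports.
Local Open Scope classical_set_scope.
Local Open Scope ring_scope.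

Definition seqT (k : nat) := nat -> 'I_k.+1.
HB.instance Definition _ (k : nat) := Choice.on (seqT k).
HB.instance Definition _ (k : nat) := isPointed.Build (seqT k) (fun=> ord0).

Definition sshift {k : nat} (x : seqT k) : seqT k := fun i => x i.+1.

Definition cyl {k : nat} (x : seqT k) (n : nat) : set (seqT k) :=
  [set y | forall i, (i < n)%N -> y i = x i].

Definition cylinders (k : nat) : set (set (seqT k)) :=
  [set C | exists x n, C = cyl x n].

(** the sequence space with the (Borel = cylinder) sigma-algebra *)
Definition Sigma (k : nat) := g_sigma_algebraType (@cylinders k).

Definition SFT {k : nat} (M : rel 'I_k.+1) : set (Sigma k) :=
  [set x | forall i, M (x i) (x i.+1)].

(** topological mixing of sigma on X (tested on the basis of cylinder
    neighbourhoods of points of X) *)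
Definition topologically_mixing {k : nat} (X : set (Sigma k)) : Prop :=
  forall x y, X x -> X y -> forall m : nat, exists N : nat, forall n, (N <= n)%N ->
    exists z, X z /\ (forall i, (i < m)%N -> z i = x i)
              /\ (forall i, (i < m)%N -> iter n sshift z i = y i).

Definition dtheta {R : realType} {k : nat} (th : R) (x y : Sigma k) : R :=
  match pselect (exists i, x i != y i) with
  | left h => th ^+ (ex_minn h)
  | right _ => 0
  end.

Definition lip_theta {R : realType} {k : nat} (th : R) (X : set (Sigma k))
  (w : Sigma k -> R) : Prop :=
  exists L : R, forall x y, X x -> X y -> `|w x - w y| <= L * dtheta th x y.

Definition birkhoff {R : realType} {k : nat} (f : Sigma k -> R) (n : nat)
  (x : Sigma k) : R := \sum_(i < n) f (iter i sshift x).

(** Gibbs measure (in the sense of Bowen) of a Hoelder potential on X *)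
Definition gibbs_measure {R : realType} {k : nat} (X : set (Sigma k))
  (mu : probability (Sigma k) R) : Prop :=
  mu X = 1%E /\
  (forall A : set (Sigma k), measurable A -> mu (sshift @^-1` A) = mu A) /\
  exists (phi : Sigma k -> R) (beta : R), 0 < beta < 1 /\ lip_theta beta X phi /\
  exists P K : R, 0 < K /\ forall x, X x -> forall n : nat, (0 < n)%N ->
     ((K^-1 * expR (birkhoff phi n x - n%:R * P))%:E <= mu (cyl x n))%E /\
     (mu (cyl x n) <= (K * expR (birkhoff phi n x - n%:R * P))%:E)%E.

Definition collapsed_accessible {R : realType} {k : nat} (th : R)
  (X : set (Sigma k)) (f : Sigma k -> R) : Prop :=
  exists (C : R) (N : nat), forall x, X x -> forall t : R, 0 <= t <= 1 ->
  forall n : nat, (2 * N <= n)%N ->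
  exists (m : nat) (xs ys : nat -> Sigma k),
    (m <= N)%N /\ xs 0%N = x /\ xs m = x /\ X (xs m) /\
    (forall i, (i < m)%N ->
       X (xs i) /\ X (ys i) /\ iter n sshift (xs i) = iter n sshift (ys i) /\
       dtheta th (ys i) (xs i.+1) <= C * th ^+ n) /\
    t = \sum_(i < m) (birkhoff f n (xs i) - birkhoff f n (ys i)).

(** * Schwartz functions (complex valued functions = pairs (Re, Im)) *)
Definition schwartz_real {R : realType} (g : R -> R) : Prop :=
  (forall (n : nat) (r : R), derivable (derive1n n g) r 1) /\
  forall a b : nat, exists M : R, forall r : R, `|r| ^+ a * `|derive1n b g r| <= M.

Definition schwartz {R : realType} (gre gim : R -> R) : Prop :=
  schwartz_real gre /\ schwartz_real gim.

Definition L_plus {R : realType} {k : nat} (th : R) (X : set (Sigma k))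
  (psi_re psi_im : Sigma k -> R -> R) : Prop :=
  (forall x, X x -> schwartz (psi_re x) (psi_im x)) /\
  forall l : nat, exists L : R, forall x y, X x -> X y ->
    (\int[lebesgue_measure]_r
       (Num.sqrt ((derive1n l (psi_re x) r - derive1n l (psi_re y) r) ^+ 2 +
                  (derive1n l (psi_im x) r - derive1n l (psi_im y) r) ^+ 2))%:E
     <= (L * dtheta th x y)%:E)%E.

(** * Complex measures on R, given as (m1 - m2) + i (m3 - m4) with m_j finite
    (Borel) measures; every complex measure has such a (Jordan) representation *)
Record cmeasure (R : realType) := CMeasure {
  cm1 : {finite_measure set R -> \bar R};
  cm2 : {finite_measure set R -> \bar R};
  cm3 : {finite_measure set R -> \bar R};
  cm4 : {finite_measure set R -> \bar R} }.

Definition cm_re {R : realType} (eta : cmeasure R) (A : set R) : R :=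
  fine (cm1 eta A) - fine (cm2 eta A).
Definition cm_im {R : realType} (eta : cmeasure R) (A : set R) : R :=
  fine (cm3 eta A) - fine (cm4 eta A).

Definition cm_tv {R : realType} (eta : cmeasure R) (E : set R) : \bar R :=
  ereal_sup [set v : \bar R | exists (m : nat) (F : nat -> set R),
    (forall j, (j < m)%N -> measurable (F j) /\ F j `<=` E) /\
    trivIset [set j | (j < m)%N] F /\
    v = (\sum_(j < m) Num.sqrt (cm_re eta (F j) ^+ 2 + cm_im eta (F j) ^+ 2))%:E].

(** Fourier-Stieltjes transform  hat eta (r) = int e^{-i r xi} d eta(xi) *)
Definition FS_re {R : realType} (eta : cmeasure R) (r : R) : R :=
  (\int[cm1 eta]_(xi in setT) cos (r * xi)) - (\int[cm2 eta]_(xi in setT) cos (r * xi))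
  + (\int[cm3 eta]_(xi in setT) sin (r * xi)) - (\int[cm4 eta]_(xi in setT) sin (r * xi)).
Definition FS_im {R : realType} (eta : cmeasure R) (r : R) : R :=
  (\int[cm3 eta]_(xi in setT) cos (r * xi)) - (\int[cm4 eta]_(xi in setT) cos (r * xi))
  - (\int[cm1 eta]_(xi in setT) sin (r * xi)) + (\int[cm2 eta]_(xi in setT) sin (r * xi)).

(** Phi in G^+ : Phi(x) = hat (eta x), x in X *)
Definition G_plus {R : realType} {k : nat} (X : set (Sigma k))
  (eta : Sigma k -> cmeasure R) : Prop :=
  (exists M : R, forall x, X x -> (cm_tv (eta x) setT <= M%:E)%E) /\
  forall E : set R, measurable E ->
    measurable_fun X (fun x => cm_re (eta x) E) /\
    measurable_fun X (fun x => cm_im (eta x) E).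

Section skew.
Context {R : realType} {k : nat} (mu : probability (Sigma k) R)
  (X : set (Sigma k)).

Definition nu_prod := (mu \x (@lebesgue_measure R))%E.

Definition Fn (f : Sigma k -> R) (n : nat) (z : Sigma k * R) : Sigma k * R :=
  (iter n sshift z.1, z.2 + birkhoff f n z.1).

Definition Phi_re (eta : Sigma k -> cmeasure R) (z : Sigma k * R) : R :=
  FS_re (eta z.1) z.2.
Definition Phi_im (eta : Sigma k -> cmeasure R) (z : Sigma k * R) : R :=
  FS_im (eta z.1) z.2.

Definition nu_av_re (eta : Sigma k -> cmeasure R) : R :=
  lim ((fun T : R => (2 * T)^-1 *
          \int[nu_prod]_(z in X `*` [set r | - T <= r <= T]) Phi_re eta z) @ +oo).
Definition nu_av_im (eta : Sigma k -> cmeasure R) : R :=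
  lim ((fun T : R => (2 * T)^-1 *
          \int[nu_prod]_(z in X `*` [set r | - T <= r <= T]) Phi_im eta z) @ +oo).

(** cov(Phi o (F^+)^n, psi)
     = int (Phi o F^n) conj(psi) dnu - nu_av(Phi) * conj(int psi dnu) *)
Definition cov_re (eta : Sigma k -> cmeasure R) (f : Sigma k -> R) (n : nat)
  (psi_re psi_im : Sigma k -> R -> R) : R :=
  \int[nu_prod]_(z in X `*` setT)
     (Phi_re eta (Fn f n z) * psi_re z.1 z.2 + Phi_im eta (Fn f n z) * psi_im z.1 z.2)
  - (nu_av_re eta * \int[nu_prod]_(z in X `*` setT) psi_re z.1 z.2
     + nu_av_im eta * \int[nu_prod]_(z in X `*` setT) psi_im z.1 z.2).
Definition cov_im (eta : Sigma k -> cmeasure R) (f : Sigma k -> R) (n : nat)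
  (psi_re psi_im : Sigma k -> R -> R) : R :=
  \int[nu_prod]_(z in X `*` setT)
     (Phi_im eta (Fn f n z) * psi_re z.1 z.2 - Phi_re eta (Fn f n z) * psi_im z.1 z.2)
  - (nu_av_im eta * \int[nu_prod]_(z in X `*` setT) psi_re z.1 z.2
     - nu_av_re eta * \int[nu_prod]_(z in X `*` setT) psi_im z.1 z.2).

Definition cov_abs eta f n psi_re psi_im : R :=
  Num.sqrt (cov_re eta f n psi_re psi_im ^+ 2 + cov_im eta f n psi_re psi_im ^+ 2).

Definition LF (eta : Sigma k -> cmeasure R) (r : R) : \bar R :=
  (\int[mu]_(x in X) cm_tv (eta x) ([set s : R | (- r < s < r)%R] `\` [set 0%R]))%E.

End skew.

(* Main.v *)
(* A Fourier transform of psi in the real variable turns the correlation into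
   int_X int (L_xi^n psi_xi)(x) d eta_x(xi) d mu(x), with L the transfer operator
   of mu for a weight normalized to L 1 = 1 and L_xi w = L (e^{-i xi f} w).
   The atom of eta_x at 0 produces the product of averages, because L^n w
   converges exponentially fast to the mean of w. For 0 < |xi| < n^{-1/2+eps} the
   trivial bound gives the term LF. For larger |xi|, collapsed accessibility
   gives a loop along which the phases e^{-i xi f_n} accumulate a mismatch of
   order d = min(1, |xi|), so that after O(1 + log |xi|) steps L_xi^n contracts by
   1 - c d^2 |xi|^{-a} on the cone of functions whose Lipschitz constant is
   controlled by |xi| times their supremum. Since psi_xi decays faster than any
   power of xi, this makes L_xi^n psi_xi smaller than any power of n. *)
Require Import Defs.
From HB Require Import structures.
From mathcomp Require Import all_boot all_order all_algebra.
From mathcomp Require Import all_classical all_reals all_analysis.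
From mathcomp Require Import measurable_realfun.
From mathcomp Require Import ring lra zify.
Set Implicit Arguments. Unset Strict Implicit. Unset Printing Implicit Defensive.
Import Order.TTheory GRing.Theory Num.Theory.
Import numFieldNormedType.Exports HBNNSimple.
Local Open Scope classical_set_scope.
Local Open Scope ring_scope.

(** * The one-sided shift and its transfer operators *)

Definition agree {k : nat} (n : nat) (x y : Sigma k) : Prop :=
  forall i, (i < n)%N -> x i = y i.

Definition scons {k : nat} (a : 'I_k.+1) (x : Sigma k) : Sigma k :=
  fun i => if i is j.+1 then x j else a.

Definition splice {k : nat} (n : nat) (z y : Sigma k) : Sigma k :=
  fun i => if (i < n)%N then z i else y (i - n)%N.

Section shift.
Context {k : nat}.
Implicit Types (x y z : Sigma k) (a : 'I_k.+1).

Lemma iter_sshiftE n x i : iter n sshift x i = x (n + i)%N.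
Proof.
elim: n i => [//|n IH] i; rewrite iterS.
by rewrite /sshift IH addnS addSn.
Qed.

Lemma sshift_scons a x : sshift (scons a x) = x.
Proof. by []. Qed.

Lemma scons_sshift x : scons (x 0%N) (sshift x) = x.
Proof. by apply/funext => -[]. Qed.

Lemma agree_sym n x y : agree n x y -> agree n y x.
Proof. by move=> h i /h. Qed.

Lemma agree_trans n x y z : agree n x y -> agree n y z -> agree n x z.
Proof. by move=> h h' i ni; rewrite h ?h'. Qed.

Lemma agree_le n m x y : (m <= n)%N -> agree n x y -> agree m x y.
Proof. by move=> mn h i im; apply: h; apply: leq_trans im mn. Qed.

Lemma agree_scons n a x y : agree n x y -> agree n.+1 (scons a x) (scons a y).
Proof. by move=> h [//|i] /= ni; apply: h. Qed.

Lemma agree_sshift n x y : agree n.+1 x y -> agree n (sshift x) (sshift y).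
Proof. by move=> h i ni; apply: h. Qed.

Lemma agree_iter n m x y :
  agree (n + m) x y -> agree m (iter n sshift x) (iter n sshift y).
Proof. by move=> h i im; rewrite !iter_sshiftE; apply: h; rewrite ltn_add2l. Qed.

Lemma agree_splice n z y : agree n (splice n z y) z.
Proof. by move=> i ni; rewrite /splice ni. Qed.

Lemma iter_splice n z y : iter n sshift (splice n z y) = y.
Proof.
apply/funext => i; rewrite iter_sshiftE /splice.
by rewrite ltnNge leq_addr /= addKn.
Qed.

Lemma agree_splice_add n m z y :
  agree m (iter n sshift z) y -> agree (n + m) (splice n z y) z.
Proof.
move=> h i inm; rewrite /splice; case: ltnP => // ni.
by rewrite -h ?ltn_subLR// iter_sshiftE subnKC.
Qed.

End shift.

Section SFT.
Context {k : nat} (M : rel 'I_k.+1).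
Local Notation X := (SFT M).

Lemma SFT_sshift x : X x -> X (sshift x).
Proof. by move=> h i; apply: h. Qed.

Lemma SFT_iter n x : X x -> X (iter n sshift x).
Proof. by move=> Xx; elim: n => // n; rewrite iterS; exact: SFT_sshift. Qed.

Lemma SFT_scons a x : X x -> M a (x 0%N) -> X (scons a x).
Proof. by move=> h aM [|i] //=; apply: h. Qed.

Lemma SFT_splice n z y : X z -> X y -> z n = y 0%N -> X (splice n z y).
Proof.
move=> Xz Xy zy i; rewrite /splice.
case: (ltnP i.+1 n) => [i1n|ni1].
  by rewrite (ltnW i1n); apply: Xz.
move: ni1; rewrite leq_eqVlt => /predU1P[i1n|ni].
  by rewrite i1n ltnSn subnn -zy i1n; apply: Xz.
by rewrite ltnNge -ltnS ni /= subSn//; apply: Xy.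
Qed.

Hypothesis mix : topologically_mixing X.

Lemma mixing_connect : exists N0, forall z y, X z -> X y ->
  exists x, [/\ X x, x 0%N = z 0%N & iter N0 sshift x = y].
Proof.
have sym (ab : 'I_k.+1 * 'I_k.+1) : exists N, forall n, (N <= n)%N ->
    forall x y, X x -> X y -> x 0%N = ab.1 -> y 0%N = ab.2 ->
    exists z, [/\ X z, z 0%N = ab.1 & z n = ab.2].
  case: (pselect (exists xy : Sigma k * Sigma k,
      [/\ X xy.1, X xy.2, xy.1 0%N = ab.1 & xy.2 0%N = ab.2])).
    move=> [[x y] /= [Xx Xy xa yb]]; have [N hN] := mix Xx Xy 1%N.
    exists N => n /hN [z [Xz [zx zy]]] _ _ _ _ _ _; exists z; split => //.
      by rewrite zx.
    by have := zy 0%N isT; rewrite iter_sshiftE addn0 yb.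
  by move=> no; exists 0%N => n _ x y Xx Xy xa yb; case: no; exists (x, y).
have /choice[N hN] := sym.
exists (\max_ab N ab)%N => z y Xz Xy.
have [u [Xu uz uy]] := hN (z 0%N, y 0%N) _ (leq_bigmax (z 0%N, y 0%N)) z y Xz Xy erefl erefl.
exists (splice (\max_ab N ab)%N u y); split.
- exact: SFT_splice.
- rewrite /splice; case: ltnP => //; rewrite leqn0 => /eqP N0.
  by move: uy; rewrite N0 sub0n uz /= => <-.
- exact: iter_splice.
Qed.

Lemma mixing_reach : exists N0, forall p z y, X z -> X y ->
  exists x, [/\ X x, agree p x z & iter (p + N0) sshift x = y].
Proof.
have [N0 h] := mixing_connect; exists N0 => p z y Xz Xy.
have [u [Xu uz uy]] := h (iter p sshift z) y (SFT_iter p Xz) Xy.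
exists (splice p z u); split.
- by apply: SFT_splice => //; rewrite uz iter_sshiftE addn0.
- exact: agree_splice.
- by rewrite addnC iterD iter_splice.
Qed.

End SFT.

Definition ruelle {R : realType} {k : nat} (M : rel 'I_k.+1)
  (G : Sigma k -> R) (w : Sigma k -> R) (y : Sigma k) : R :=
  \sum_(a | M a (y 0%N)) G (scons a y) * w (scons a y).

Section ruelle.
Context {R : realType} {k : nat} (M : rel 'I_k.+1).
Local Notation X := (SFT M).
Implicit Types (G w u v : Sigma k -> R) (x y z : Sigma k).

Lemma ruelle_iter_eq G n w v y : X y ->
  (forall x, X x -> iter n sshift x = y -> w x = v x) ->
  iter n (ruelle M G) w y = iter n (ruelle M G) v y.
Proof.
elim: n w v y => [|n IH] w v y Xy h; first exact: h.
rewrite !iterS /ruelle; apply: eq_bigr => a Ma; congr (_ * _).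
apply: IH => [|x Xx nx]; first exact: SFT_scons.
by apply: h => //; rewrite iterS nx.
Qed.

Lemma ruelle_iter_le G n w v y : X y -> (forall x, X x -> 0 <= G x) ->
  (forall x, X x -> iter n sshift x = y -> w x <= v x) ->
  iter n (ruelle M G) w y <= iter n (ruelle M G) v y.
Proof.
move=> Xy G0; elim: n w v y Xy => [|n IH] w v y Xy h; first exact: h.
rewrite !iterS /ruelle; apply: ler_sum => a Ma.
have Xa : X (scons a y) by exact: SFT_scons.
apply: ler_wpM2l; first exact: G0.
apply: IH => // x Xx nx.
by apply: h => //; rewrite iterS nx.
Qed.

Lemma ruelle_iterD G n w v y :
  iter n (ruelle M G) (fun x => w x + v x) y =
  iter n (ruelle M G) w y + iter n (ruelle M G) v y.
Proof.
elim: n y => [//|n IH] y; rewrite !iterS /ruelle -big_split /=.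
by apply: eq_bigr => a _; rewrite IH mulrDr.
Qed.

Lemma ruelle_iter_pull G n (F : Sigma k -> R) w y :
  iter n (ruelle M G) (fun x => F (iter n sshift x) * w x) y =
  F y * iter n (ruelle M G) w y.
Proof.
elim: n F y => [//|n IH] F y.
rewrite !iterS /ruelle big_distrr /=; apply: eq_bigr => a _.
by rewrite (IH (fun z => F (sshift z))) sshift_scons mulrCA.
Qed.

Lemma ruelle_iterZ G n c w y :
  iter n (ruelle M G) (fun x => c * w x) y = c * iter n (ruelle M G) w y.
Proof. exact: (ruelle_iter_pull G n (fun=> c)). Qed.

Lemma ruelle_iterB G n w v y :
  iter n (ruelle M G) (fun x => w x - v x) y =
  iter n (ruelle M G) w y - iter n (ruelle M G) v y.
Proof.
rewrite -mulN1r -ruelle_iterZ -ruelle_iterD.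
by under [in RHS]eq_fun do rewrite mulN1r.
Qed.

Lemma ruelle_iter_weight G n w y : iter n (ruelle M G) w y =
  iter n (ruelle M (fun=> 1)) (fun x => (\prod_(i < n) G (iter i sshift x)) * w x) y.
Proof.
elim: n w y => [|n IH] w y.
  by rewrite /= big_ord0 mul1r.
rewrite !iterSr IH; congr (iter n _ _ y); apply/funext => x.
rewrite /ruelle big_distrr /=; apply: eq_bigr => a _.
rewrite big_ord_recl /= mul1r mulrCA mulrA; congr (_ * _ * _).
by apply: eq_bigr => i _; rewrite -iterS iterSr.
Qed.

End ruelle.

(** * Normalized weights *)

Definition lipX {R : realType} {k : nat} (X : set (Sigma k)) (th V : R)
    (w : Sigma k -> R) :=
  forall n x y, X x -> X y -> agree n x y -> `|w x - w y| <= V * th ^+ n.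

Definition lip1X {R : realType} {k : nat} (X : set (Sigma k)) (th V : R)
    (w : Sigma k -> R) :=
  forall n x y, (0 < n)%N -> X x -> X y -> agree n x y ->
  `|w x - w y| <= V * th ^+ n.

Definition oscX {R : realType} {k : nat} (X : set (Sigma k)) (D : R)
    (w : Sigma k -> R) :=
  forall x y, X x -> X y -> w x - w y <= D.

Lemma exp_small {R : realType} (q e : R) : 0 <= q < 1 -> 0 < e ->
  exists n : nat, q ^+ n <= e.
Proof.
move=> /andP[q0 q1] e0.
have : (fun n => q ^+ n) @ \oo --> (0 : R).
  by apply: cvg_expr; rewrite ger0_norm.
move=> /cvgrPdist_le /(_ e e0) [N _ /(_ N (leqnn N))] /=.
by rewrite sub0r normrN ger0_norm ?exprn_ge0// => h; exists N.
Qed.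

Lemma lipX_osc {R : realType} {k : nat} (X : set (Sigma k)) (th V : R) w :
  lipX X th V w -> oscX X V w.
Proof.
move=> h x y Xx Xy; have := h 0%N x y Xx Xy.
by rewrite expr0 mulr1 => hh; apply: le_trans (hh _) => //; exact: ler_norm.
Qed.

Lemma oscX_norm {R : realType} {k : nat} (X : set (Sigma k)) (D : R) w x y :
  oscX X D w -> X x -> X y -> `|w x - w y| <= D.
Proof. by move=> h Xx Xy; rewrite ler_norml lerNl opprB !h. Qed.

Record normalized_weight {R : realType} {k : nat} (M : rel 'I_k.+1)
    (g : Sigma k -> R) (q th A : R) : Prop := NormalizedWeight {
  nw_mixing : topologically_mixing (SFT M);
  nw_sum : forall y, SFT M y -> \sum_(a | M a (y 0%N)) g (scons a y) = 1;
  nw_q : 0 < q <= 1;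
  nw_ge : forall x, SFT M x -> q <= g x;
  nw_th : 0 < th < 1;
  nw_var : forall n x y, (0 < n)%N -> SFT M x -> SFT M y -> agree n x y ->
    \sum_(a | M a (x 0%N)) `|g (scons a x) - g (scons a y)| <= A * th ^+ n;
  nw_A : 0 <= A }.

Section normalized.
Context {R : realType} {k : nat} (M : rel 'I_k.+1).
Local Notation X := (SFT M).
Context (g : Sigma k -> R) (q th A : R).
Hypothesis NW : normalized_weight M g q th A.
Local Notation L := (ruelle M g).
Implicit Types (w : Sigma k -> R) (x y z : Sigma k) (V D H c : R).

Let mix := nw_mixing NW.
Let g_sum := nw_sum NW.
Let q_gt0 : 0 < q. Proof. by case/andP: (nw_q NW). Qed.
Let q_le1 : q <= 1. Proof. by case/andP: (nw_q NW). Qed.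
Let g_ge := nw_ge NW.
Let th01 := nw_th NW.
Let g_var := nw_var NW.
Let A_ge0 := nw_A NW.

Let g_ge0 x : X x -> 0 <= g x.
Proof. by move=> /g_ge; exact: le_trans (ltW q_gt0). Qed.

Lemma normalized_cst n c y : X y -> iter n L (fun=> c) y = c.
Proof.
elim: n y => [//|n IH] y Xy; rewrite iterS /ruelle.
transitivity (\sum_(a | M a (y 0%N)) g (scons a y) * c).
  by apply: eq_bigr => a Ma; rewrite IH//; exact: SFT_scons.
by rewrite -big_distrl /= g_sum// mul1r.
Qed.

Lemma normalized_le n w c y : X y ->
  (forall x, X x -> iter n sshift x = y -> w x <= c) -> iter n L w y <= c.
Proof.
move=> Xy h; rewrite -[leRHS](normalized_cst n _ Xy).
exact: ruelle_iter_le.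
Qed.

Lemma normalized_norm n w c H y : X y ->
  (forall x, X x -> iter n sshift x = y -> `|w x - c| <= H) ->
  `|iter n L w y - c| <= H.
Proof.
move=> Xy h; rewrite -[X in _ - X](normalized_cst n _ Xy) -ruelle_iterB.
rewrite ler_norml; apply/andP; split.
  rewrite lerNl -mulN1r -ruelle_iterZ; apply: normalized_le => // x Xx nx.
  by have := h x Xx nx; rewrite ler_norml mulN1r lerNl => /andP[].
apply: normalized_le => // x Xx nx.
by have := h x Xx nx; rewrite ler_norml => /andP[].
Qed.

Lemma normalized_bound n w H y : X y ->
  (forall x, X x -> `|w x| <= H) -> `|iter n L w y| <= H.
Proof.
move=> Xy h; rewrite -[iter _ _ _ _]subr0; apply: normalized_norm => // x Xx _.
by rewrite subr0 h.
Qed.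

Lemma normalized_one_preimage n w H x y : X y -> X x -> iter n sshift x = y ->
  (forall z, X z -> w z <= H) -> iter n L w y <= H - q ^+ n * (H - w x).
Proof.
elim: n w H x y => [|n IH] w H x y Xy Xx nx h.
  by rewrite /= in nx *; rewrite nx expr0 mul1r opprB addrC subrK.
pose x' := iter n sshift x.
have Xx' : X x' by exact: SFT_iter.
have nx' : sshift x' = y by [].
have xE : x' = scons (x' 0%N) y by rewrite -nx' scons_sshift.
have Mx' : M (x' 0%N) (y 0%N) by rewrite -nx'; exact: Xx'.
rewrite iterS /ruelle.
have -> : H - q ^+ n.+1 * (H - w x) =
    \sum_(a | M a (y 0%N)) g (scons a y) * H - q ^+ n.+1 * (H - w x).
  by rewrite -big_distrl /= g_sum// mul1r.
rewrite (bigD1 (x' 0%N))//= [in leRHS](bigD1 (x' 0%N))//= addrAC lerD//.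
  rewrite -xE; have /= hle := IH w H x x' Xx' Xx erefl h.
  have : g x' * iter n L w x' <= g x' * (H - q ^+ n * (H - w x)).
    by rewrite ler_wpM2l// g_ge0.
  move/le_trans; apply; rewrite mulrBr lerD2l lerN2 exprS mulrA.
  rewrite ler_wpM2r ?subr_ge0 ?h// ler_wpM2r ?exprn_ge0 ?(ltW q_gt0)//.
  exact: g_ge.
apply: ler_sum => a /andP[Ma _]; have Xa : X (scons a y) by exact: SFT_scons.
rewrite ler_wpM2l ?g_ge0//; apply: normalized_le => // z Xz _; exact: h.
Qed.

Lemma normalized_osc n D w : oscX X D w -> oscX X D (iter n L w).
Proof.
move=> h y y' Xy Xy'.
rewrite lerBlDr; apply: normalized_le => // x Xx _.
rewrite -lerBlDl -[leLHS](normalized_cst n _ Xy').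
apply: ruelle_iter_le => // z Xz _; rewrite lerBlDl -lerBlDr; exact: h.
Qed.

Lemma ruelle_lip1 D V w : 0 <= V -> oscX X D w -> lip1X X th V w ->
  lip1X X th (th * V + A * D) (L w).
Proof.
have [th0 th1] := andP th01.
move=> V0 hD hV n x y n0 Xx Xy xy; rewrite /ruelle.
have xy0 : x 0%N = y 0%N by exact: xy.
have Xa a : M a (x 0%N) -> X (scons a x) by move=> ?; exact: SFT_scons.
have Ya a : M a (x 0%N) -> X (scons a y) by move=> ?; apply: SFT_scons; rewrite // -xy0.
have G0 a : M a (x 0%N) -> 0 <= g (scons a x) by move=> /Xa /g_ge0.
have -> : \sum_(a | M a (x 0%N)) g (scons a x) * w (scons a x) -
    \sum_(a | M a (y 0%N)) g (scons a y) * w (scons a y) =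
    \sum_(a | M a (x 0%N)) (g (scons a x) * (w (scons a x) - w (scons a y)) +
      (g (scons a x) - g (scons a y)) * (w (scons a y) - w x)).
  have E0 : \sum_(a | M a (x 0%N)) (g (scons a x) - g (scons a y)) * w x = 0.
    by rewrite -big_distrl /= sumrB g_sum// xy0 g_sum// subrr mul0r.
  rewrite -[RHS]addr0 -[X in _ = _ + X]E0 -big_split /= -xy0 -sumrB.
  by apply: eq_bigr => a _; ring.
rewrite big_split /=; apply: le_trans (ler_normD _ _) _.
rewrite mulrDl lerD//.
  apply: le_trans (ler_norm_sum _ _ _) _.
  rewrite -[leRHS]mul1r -(g_sum Xx) big_distrl /=.
  apply: ler_sum => a Ma; rewrite normrM ger0_norm ?G0//.
  rewrite ler_wpM2l ?G0//.
  rewrite [th * V]mulrC -mulrA -exprS.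
  by apply: hV => //; [exact: Xa | exact: Ya | exact: agree_scons].
apply: le_trans (ler_norm_sum _ _ _) _.
rewrite mulrAC; apply: le_trans (_ : \sum_(a | M a (x 0%N))
   `|g (scons a x) - g (scons a y)| * D <= _).
  apply: ler_sum => a Ma; rewrite normrM ler_wpM2l//.
  exact: (oscX_norm hD (Ya a Ma) Xx).
rewrite -big_distrl /= ler_wpM2r//; last exact: g_var.
by have := hD x x Xx Xx; rewrite subrr.
Qed.

Lemma ruelle_iter_lip1 n D V w : 0 <= V -> 0 <= D -> oscX X D w -> lip1X X th V w ->
  lip1X X th (th ^+ n * V + A / (1 - th) * D) (iter n L w).
Proof.
have [th0 th1] := andP th01.
have th10 : 0 < 1 - th by rewrite subr_gt0.
move=> V0 D0 hD hV; elim: n => [|n IH].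
  rewrite expr0 mul1r /= => n x y n0 Xx Xy xy.
  apply: le_trans (hV _ _ _ n0 Xx Xy xy) _.
  rewrite ler_wpM2r ?exprn_ge0 ?(ltW th0)// lerDl mulr_ge0//.
  by rewrite divr_ge0// ltW.
rewrite iterS.
have -> : th ^+ n.+1 * V + A / (1 - th) * D =
    th * (th ^+ n * V + A / (1 - th) * D) + A * D.
  rewrite exprS; have : 1 - th != 0 by rewrite gt_eqF.
  by move=> ?; field.
apply: ruelle_lip1 => //; last exact: normalized_osc.
by rewrite addr_ge0// mulr_ge0// ?exprn_ge0 ?(ltW th0)// divr_ge0// ltW.
Qed.

Lemma normalized_doeblin : exists N0, forall p D V w,
  oscX X D w -> lip1X X th V w -> (0 < p)%N -> 0 <= V ->
  oscX X ((1 - q ^+ (2 * (p + N0))) * D + q ^+ (2 * (p + N0)) * (V * th ^+ p))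
    (iter (p + N0) L w).
Proof.
have [N0 reach] := mixing_reach mix; exists N0 => p D V w hD hV p0 V0 y1 y2 X1 X2.
have [x1 [Xx1 a1 e1]] := reach p y1 y1 X1 X1.
have [x2 [Xx2 a2 e2]] := reach p y1 y2 X1 X2.
have D0 : 0 <= D by have := hD y1 y1 X1 X1; rewrite subrr.
set m := (p + N0)%N in e1 e2 *.
have Q0 : 0 <= q ^+ m by rewrite exprn_ge0// ltW.
have H1 x0 : X x0 -> iter m L w y1 - w x0 <= D - q ^+ m * (D - (w x1 - w x0)).
  move=> Xx0; rewrite -[w x0 in leLHS](normalized_cst m _ X1) -ruelle_iterB.
  by apply: normalized_one_preimage => // z Xz; exact: hD.
have H2 : w x1 - iter m L w y2 <= D - q ^+ m * (D - (w x1 - w x2)).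
  rewrite -[w x1 in leLHS](normalized_cst m _ X2) -ruelle_iterB.
  by apply: (normalized_one_preimage (w := fun x => w x1 - w x)) => // z Xz; exact: hD.
have H12 : w x1 - w x2 <= V * th ^+ p.
  apply: le_trans (ler_norm _) _; apply: hV => //.
  by apply: agree_trans a1 _; exact: agree_sym.
have H3 : iter m L w y1 - iter m L w y2 <=
    D - q ^+ m * (D - (w x1 - iter m L w y2)).
  suff : iter m L (fun x => iter m L w y1 - w x - q ^+ m * (w x1 - w x)) y2 <=
      D - q ^+ m * D.
    rewrite ruelle_iterB ruelle_iterZ !ruelle_iterB !normalized_cst//.
    lra.
  apply: normalized_le => // x Xx _; have := H1 x Xx; lra.
have : q ^+ m * (w x1 - iter m L w y2) <=
    q ^+ m * (D - q ^+ m * (D - V * th ^+ p)).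
  rewrite ler_wpM2l//; apply: le_trans H2 _.
  by rewrite lerB// ler_wpM2l// lerB.
rewrite mul2n -addnn exprD; lra.
Qed.

Lemma normalized_gap : exists n0, (0 < n0)%N /\ forall V w, 0 <= V ->
  lipX X th V w -> lipX X th (V / 2) (iter n0 L w).
Proof.
have [th0 th1] := andP th01.
have [N0 hN0] := normalized_doeblin.
pose A' := A / (1 - th) + 1.
have A'1 : 1 <= A' by rewrite lerDr divr_ge0// subr_ge0 ltW.
have [p hp] : exists p, th ^+ p <= (4 * A')^-1.
  by apply: exp_small; [rewrite (ltW th0) | rewrite invr_gt0; lra].
have {hp} hp : A' * th ^+ p.+1 <= 4^-1.
  rewrite exprS mulrCA; apply: le_trans (_ : A' * th ^+ p <= _).
    by rewrite ler_piMl ?(ltW th1)// mulr_ge0 ?exprn_ge0 ?(ltW th0)//; lra.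
  have -> : 4^-1 = A' * (4 * A')^-1 by field; lra.
  by rewrite ler_wpM2l//; lra.
pose m := (p.+1 + N0)%N.
have hpm : th ^+ m <= th ^+ p.+1.
  by rewrite ler_wiXn2l ?leq_addr// ltW.
pose Q := q ^+ (2 * m).
have Q0 : 0 < Q by rewrite exprn_gt0.
pose ka := Q / (2 * A').
have ka0 : 0 < ka by rewrite divr_gt0//; lra.
have QE : Q = 2 * (A' * ka) by rewrite /ka; field; lra.
pose rho := Num.max (1 - Q / 2) (3 / 4).
have rho0 : 0 <= rho by rewrite le_max; apply/orP; right; lra.
have rho1 : rho < 1 by rewrite gt_max; apply/andP; split; lra.
have step j D V w : 0 <= D -> 0 <= V -> oscX X D w -> lip1X X th V w ->
    exists D' V', [/\ 0 <= D', 0 <= V', oscX X D' (iter (j * m) L w),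
      lip1X X th V' (iter (j * m) L w) & D' + ka * V' <= rho ^+ j * (D + ka * V)].
  move=> D0 V0 hD hV; elim: j => [|j [D' [V' [D'0 V'0 hD' hV' le]]]].
    by exists D, V; split => //; rewrite expr0 mul1r.
  have Q1 : Q * D' <= D'.
    by rewrite ler_piMl// exprn_ile1 ?(ltW q_gt0).
  have QV : 0 <= Q * (V' * th ^+ p.+1) by rewrite mulr_ge0 ?(ltW Q0)// mulr_ge0// exprn_ge0// ltW.
  exists ((1 - Q) * D' + Q * (V' * th ^+ p.+1)), (th ^+ m * V' + A / (1 - th) * D').
  rewrite mulSn iterD; split.
  - lra.
  - by rewrite addr_ge0// mulr_ge0// ?exprn_ge0 ?(ltW th0)// divr_ge0// ltW// subr_gt0.
  - exact: hN0.
  - exact: ruelle_iter_lip1.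
  - apply: le_trans (_ : rho * (D' + ka * V') <= _); last first.
      by rewrite exprS -mulrA ler_wpM2l.
    apply: le_trans (_ : (1 - Q / 2) * D' + 3 / 4 * (ka * V') <= _); last first.
      rewrite mulrDr; apply: lerD; apply: ler_wpM2r => //.
      - by rewrite /rho le_max lexx.
      - exact: mulr_ge0 (ltW ka0) V'0.
      - by rewrite /rho le_max lexx orbT.
    have h1 : A / (1 - th) * D' <= A' * D' by rewrite ler_wpM2r// lerDl.
    have h2 : ka * (A / (1 - th) * D') <= Q / 2 * D'.
      have := ler_wpM2l (ltW ka0) h1; rewrite QE; lra.
    have h3 : A' * th ^+ p.+1 * (ka * V') <= 4^-1 * (ka * V').
      by rewrite ler_wpM2r// mulr_ge0// ltW.
    have h4 : th ^+ m * (ka * V') <= 4^-1 * (ka * V').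
      rewrite ler_wpM2r//; first exact: mulr_ge0 (ltW ka0) V'0.
      apply: le_trans hpm _; apply: le_trans hp.
      by rewrite ler_peMl// exprn_ge0// ltW.
    rewrite {2}QE; lra.
have [j [hj1 hj2]] : exists j, rho ^+ j.+1 * (1 + ka) <= 2^-1 /\
    rho ^+ j.+1 * (1 + ka) <= ka / 2.
  have [j hj] : exists j, rho ^+ j <= Num.min (2^-1) (ka / 2) / (1 + ka).
    apply: exp_small; first by rewrite rho0.
    by rewrite divr_gt0// ?lt_min; [apply/andP; split|]; lra.
  have {}hj : rho ^+ j.+1 <= Num.min (2^-1) (ka / 2) / (1 + ka).
    by apply: le_trans hj; rewrite exprS ler_piMl ?(ltW rho1)// exprn_ge0.
  move: hj; rewrite ler_pdivlMr; last by lra.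
  by rewrite le_min => /andP[? ?]; exists j.
exists (j.+1 * m)%N; split; first by rewrite muln_gt0.
move=> V w V0 hw.
have := step j.+1 V V w V0 V0 (lipX_osc hw) (fun n x y _ => @hw n x y).
move=> [D' [V' [D'0 V'0 hD' hV' le]]].
have leV : D' + ka * V' <= rho ^+ j.+1 * (1 + ka) * V.
  by apply: le_trans le _; rewrite -mulrA [(1 + _) * _]mulrDl mul1r.
have D'V : D' <= V / 2.
  have kV : 0 <= ka * V' by rewrite mulr_ge0// ltW.
  apply: le_trans (_ : rho ^+ j.+1 * (1 + ka) * V <= _); first by lra.
  by rewrite [leRHS]mulrC ler_wpM2r.
have V'V : V' <= V / 2.
  rewrite -(ler_pM2l ka0).
  apply: le_trans (_ : rho ^+ j.+1 * (1 + ka) * V <= _); first by lra.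
  by rewrite mulrA [leRHS]mulrAC ler_wpM2r.
move=> [|n] x y Xx Xy xy; last first.
  apply: le_trans (hV' n.+1 x y isT Xx Xy xy) _.
  by rewrite ler_wpM2r// exprn_ge0// ltW.
rewrite expr0 mulr1; apply: le_trans D'V.
exact: (oscX_norm hD' Xx Xy).
Qed.

End normalized.

(** * Twisted transfer operators *)

Section trig.
Context {R : realType}.
Implicit Types x y d : R.

Lemma ler_sqr_norm x y : (x ^+ 2 <= y ^+ 2) = (`|x| <= `|y|).
Proof. by rewrite -(real_normK (num_real x)) -(real_normK (num_real y)) ler_sqr ?nnegrE. Qed.

Lemma norm_sin_le1 x : `|sin x| <= 1.
Proof. by rewrite ler_norml sin_geN1 sin_le1. Qed.

Lemma norm_cos_le1 x : `|cos x| <= 1.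
Proof. by rewrite ler_norml cos_geN1 cos_le1. Qed.

Lemma lipschitz_of_deriv (F dF : R -> R) :
  (forall x, is_derive x 1 F (dF x)) -> (forall x, `|dF x| <= 1) ->
  forall x y, `|F x - F y| <= `|x - y|.
Proof.
move=> hF hdF x y; wlog xy : x y / y <= x.
  move=> h; case: (leP y x) => [/h//|/ltW /h].
  by rewrite distrC [leRHS]distrC.
have [|c _ ->] := @MVT_segment _ F dF y x xy (fun z _ => hF z).
  apply: continuous_subspaceT => z; apply: differentiable_continuous.
  by apply/derivable1_diffP; have [] := hF z.
by rewrite normrM ler_piMl.
Qed.

Lemma cos_lipschitz x y : `|cos x - cos y| <= `|x - y|.
Proof.
apply: (lipschitz_of_deriv (@is_derive_cos R)) => z.
by rewrite normrN norm_sin_le1.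
Qed.

Lemma sin_lipschitz x y : `|sin x - sin y| <= `|x - y|.
Proof. apply: (lipschitz_of_deriv (@is_derive_sin R)); exact: norm_cos_le1. Qed.

Lemma sin_ge d : 0 <= d <= 1 -> cos 1 * d <= sin d.
Proof.
move=> /andP[d0 d1].
have [|c /itvP cd] := @MVT_segment _ sin cos 0 d d0 (fun z _ => is_derive_sin z).
  exact/continuous_subspaceT/continuous_sin.
rewrite sin0 !subr0 => ->; rewrite ler_wpM2r//.
have pi1 : (1 : R) <= pi by have := @pi_ge2 R; lra.
have c0 : 0 <= c by rewrite cd.
have c1 : c <= d by rewrite cd.
move: c1; rewrite le_eqVlt => /predU1P[cd'|cd'].
  move: d1; rewrite -cd' le_eqVlt => /predU1P[->//|c1].
  by rewrite ltW// ltr_cos// in_itv /=; apply/andP; split; lra.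
by rewrite ltW// ltr_cos ?in_itv /=; [lra|apply/andP; split; lra|apply/andP; split; lra].
Qed.

End trig.

Section skew.
Context {R : realType} {k : nat} (M : rel 'I_k.+1).
Local Notation X := (SFT M).
Implicit Types (f : Sigma k -> R) (x y z : Sigma k).

Lemma birkhoffD f n m x :
  birkhoff f (n + m) x = birkhoff f n x + birkhoff f m (iter n sshift x).
Proof.
rewrite /birkhoff big_split_ord /=; congr (_ + _).
by apply: eq_bigr => i _; rewrite -iterD addnC.
Qed.

Lemma birkhoffS f n x : birkhoff f n.+1 x = f x + birkhoff f n (sshift x).
Proof. by rewrite -add1n birkhoffD /birkhoff big_ord_recl big_ord0 addr0. Qed.

Section birkhoff_lip.
Variables (th F : R) (f : Sigma k -> R).
Hypothesis th01 : 0 < th < 1.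
Hypothesis hf : lipX X th F f.
Hypothesis F0 : 0 <= F.

Lemma birkhoff_distortion n p x y : X x -> X y -> agree (n + p) x y ->
  `|birkhoff f n x - birkhoff f n y| <= F / (1 - th) * th ^+ p.
Proof.
have [th0 th1] := andP th01.
have h1 : 0 < 1 - th by rewrite subr_gt0.
move=> Xx Xy xy.
suff : `|birkhoff f n x - birkhoff f n y| <=
    F / (1 - th) * th ^+ p * (1 - th ^+ n).
  move/le_trans; apply; rewrite ler_piMr ?gerBl ?exprn_ge0 ?(ltW th0)//.
  by rewrite mulr_ge0 ?exprn_ge0 ?(ltW th0)// divr_ge0// ltW.
elim: n x y Xx Xy xy => [|n IH] x y Xx Xy xy.
  by rewrite /birkhoff !big_ord0 subrr normr0 expr0 subrr mulr0.
have -> : birkhoff f n.+1 x - birkhoff f n.+1 y =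
   (f x - f y) + (birkhoff f n (sshift x) - birkhoff f n (sshift y)).
  by rewrite !birkhoffS; ring.
apply: le_trans (ler_normD _ _) _.
have := IH _ _ (SFT_sshift Xx) (SFT_sshift Xy) (agree_sshift xy).
have := hf Xx Xy xy.
have : F * th ^+ (n.+1 + p) <= F * th ^+ (n + p).
  by rewrite ler_wpM2l// ler_wiXn2l// ltW.
have -> : F / (1 - th) * th ^+ p * (1 - th ^+ n.+1) =
   F / (1 - th) * th ^+ p * (1 - th ^+ n) + F * th ^+ (n + p).
  by rewrite exprS exprD; field; rewrite gt_eqF.
lra.
Qed.

Lemma lipX_iter_sshift i V w : 0 <= V -> lipX X th V w ->
  lipX X th (V / th ^+ i) (fun x => w (iter i sshift x)).
Proof.
have [th0 th1] := andP th01.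
move=> V0 hw p x y Xx Xy xy.
have [ltpi|ip] := ltnP p i.
  apply: le_trans (hw 0%N _ _ (SFT_iter _ Xx) (SFT_iter _ Xy) _) _ => //.
  rewrite expr0 -mulrA ler_wpM2l// mulrC ler_pdivlMr ?exprn_gt0// mul1r.
  by rewrite ler_wiXn2l ?(ltW th0) ?(ltW th1) ?(ltnW ltpi).
move: xy; rewrite -(subnKC ip) => /agree_iter xy.
apply: le_trans (hw _ _ _ (SFT_iter _ Xx) (SFT_iter _ Xy) xy) _.
by rewrite exprD mulrA divfK// expf_eq0 gt_eqF// andbF.
Qed.

Lemma lipX_birkhoff n : exists2 C, 0 <= C & lipX X th C (birkhoff f n).
Proof.
have [th0 th1] := andP th01.
exists (\sum_(i < n) F / th ^+ i).
  by rewrite sumr_ge0// => i _; rewrite divr_ge0// exprn_ge0// ltW.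
move=> p x y Xx Xy xy; rewrite /birkhoff -sumrB big_distrl /=.
apply: le_trans (ler_norm_sum _ _ _) _; apply: ler_sum => i _.
exact: lipX_iter_sshift xy.
Qed.

End birkhoff_lip.

(* A function [W : X -> R -> R] with [trigonometric W] is
   [W x om = Re (w x * e^{-i om})] for a complex function [w]; the twist below
   is then the action on [w] of the transfer operator with weight
   [g * e^{-i xi f}]. *)
Definition trigonometric (W : Sigma k -> R -> R) := forall x, X x ->
  forall om, W x om = W x 0 * cos om + W x (pi / 2) * sin om.

Definition twist (g f : Sigma k -> R) (xi : R) (n : nat)
    (W : Sigma k -> R -> R) (y : Sigma k) (om : R) : R :=
  iter n (ruelle M g) (fun x => W x (om + xi * birkhoff f n x)) y.

Lemma trigonometric_shift W x om s : trigonometric W -> X x ->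
  W x (om + s) = W x s * cos om + W x (pi / 2 + s) * sin om.
Proof.
move=> hW Xx; rewrite (hW x Xx (om + s)) (hW x Xx s) (hW x Xx (pi / 2 + s)).
by rewrite !cosD !sinD cos_pihalf sin_pihalf; ring.
Qed.

Lemma trigonometricN W x om : trigonometric W -> X x -> W x (om + pi) = - W x om.
Proof.
by move=> hW Xx; rewrite (hW x Xx (om + pi)) (hW x Xx om) cosDpi sinDpi; ring.
Qed.

Lemma trigonometric_lip W x H : trigonometric W -> X x ->
  (forall om, `|W x om| <= H) -> forall a b, `|W x a - W x b| <= 2 * H * `|a - b|.
Proof.
move=> hW Xx hH a b; rewrite (hW x Xx a) (hW x Xx b).
have H0 := hH 0; have H1 := hH (pi / 2).
have -> : W x 0 * cos a + W x (pi / 2) * sin a -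
   (W x 0 * cos b + W x (pi / 2) * sin b) =
   W x 0 * (cos a - cos b) + W x (pi / 2) * (sin a - sin b) by ring.
apply: le_trans (ler_normD _ _) _; rewrite !normrM.
have := ler_pM (normr_ge0 _) (normr_ge0 _) H0 (cos_lipschitz a b).
have := ler_pM (normr_ge0 _) (normr_ge0 _) H1 (sin_lipschitz a b).
lra.
Qed.

Lemma trigonometric_near_max W x H c a : trigonometric W -> X x -> 0 <= c ->
  (forall om, `|W x om| <= H) -> (1 - c ^+ 2 / 2) * H <= W x a ->
  forall om, `|W x om - H * cos (om - a)| <= c * H.
Proof.
move=> hW Xx c0 hH ha om.
have H0 : 0 <= H by exact: le_trans (normr_ge0 _) (hH 0).
pose al := W x a; pose be := W x (pi / 2 + a).
have E s : W x (s + a) = al * cos s + be * sin s by exact: trigonometric_shift.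
have ab : al ^+ 2 + be ^+ 2 <= H ^+ 2.
  pose rho := Num.sqrt (al ^+ 2 + be ^+ 2).
  have rho2 : rho ^+ 2 = al ^+ 2 + be ^+ 2.
    by rewrite sqr_sqrtr// addr_ge0// sqr_ge0.
  have [rho0|] := eqVneq rho 0.
    by rewrite -rho2 rho0 expr0n /= sqr_ge0.
  move=> rhon0; have rho0 : 0 < rho by rewrite lt0r rhon0 sqrtr_ge0.
  have al1 : `|al / rho| <= 1.
    rewrite normrM normfV (ger0_norm (ltW rho0)) ler_pdivrMr// mul1r.
    by rewrite -(ger0_norm (ltW rho0)) -ler_sqr_norm rho2 lerDl sqr_ge0.
  have al1' : -1 <= al / rho <= 1 by rewrite -ler_norml.
  have cs : cos (acos (al / rho)) = al / rho by rewrite acosK// in_itv.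
  have ss : sin (acos (al / rho)) = `|be| / rho.
    rewrite sin_acos// -[RHS]ger0_norm ?divr_ge0 ?(ltW rho0)// -sqrtr_sqr.
    congr Num.sqrt; rewrite !expr_div_n real_normK ?num_real// rho2; field.
    by rewrite -rho2 expf_eq0.
  suff : rho <= H by rewrite -rho2 => ?; rewrite ler_sqr// nnegrE// ltW.
  have rhoE : rho = al * (al / rho) + `|be| * (`|be| / rho).
    apply: (mulIf rhon0); rewrite mulrDl -!mulrA mulVf// !mulr1 -!expr2 rho2.
    by rewrite real_normK ?num_real.
  apply: le_trans (ler_norm _) _; rewrite rhoE -cs -ss.
  have [be0|be0] := leP 0 be.
    by rewrite (ger0_norm be0) -E.
  rewrite (ltr0_norm be0) mulNr -mulrN -sinN -(cosN (acos _)) -E; exact: hH.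
rewrite -[om in W x om](subrK a) E.
have -> : al * cos (om - a) + be * sin (om - a) - H * cos (om - a) =
  (al - H) * cos (om - a) + be * sin (om - a) by ring.
set C := cos _; set D := sin _.
have CD : C ^+ 2 + D ^+ 2 = 1 by exact: cos2Dsin2.
rewrite -[leRHS]ger0_norm ?mulr_ge0// -ler_sqr_norm.
have -> : ((al - H) * C + be * D) ^+ 2 =
  ((al - H) ^+ 2 + be ^+ 2) * (C ^+ 2 + D ^+ 2) - ((al - H) * D - be * C) ^+ 2 by ring.
rewrite CD mulr1.
apply: le_trans (_ : (al - H) ^+ 2 + be ^+ 2 <= _); first by rewrite gerBl sqr_ge0.
have -> : (al - H) ^+ 2 + be ^+ 2 = al ^+ 2 + be ^+ 2 + H ^+ 2 - 2 * (H * al) by ring.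
have : H * ((1 - c ^+ 2 / 2) * H) <= H * al by rewrite ler_wpM2l.
have -> : H * ((1 - c ^+ 2 / 2) * H) = H ^+ 2 - (c * H) ^+ 2 / 2 by field.
lra.
Qed.

End skew.

Definition accessible {R : realType} {k : nat} (X : set (Sigma k))
    (f : Sigma k -> R) (c0 N : nat) : Prop :=
  forall x, X x -> forall t : R, 0 <= t <= 1 ->
  forall n : nat, (2 * N <= n)%N ->
  exists (m : nat) (xs ys : nat -> Sigma k),
    [/\ (m <= N)%N, xs 0%N = x, xs m = x,
    forall i, (i < m)%N ->
       [/\ X (xs i), X (xs i.+1), X (ys i),
         iter n sshift (xs i) = iter n sshift (ys i) &
       agree (n - c0) (ys i) (xs i.+1)] &
    t = \sum_(i < m) (birkhoff f n (xs i) - birkhoff f n (ys i))].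

Section contraction.
Context {R : realType} {k : nat} (M : rel 'I_k.+1).
Local Notation X := (SFT M).
Context (g f : Sigma k -> R) (q th A F : R) (c0 N : nat).
Hypothesis NW : normalized_weight M g q th A.
Hypothesis hf : lipX X th F f.
Hypothesis F0 : 0 <= F.
Hypothesis acc : accessible X f c0 N.
Hypothesis X0 : exists x, X x.
Local Notation L := (ruelle M g).
Local Notation tw := (twist M g f).
Implicit Types (W : Sigma k -> R -> R) (x y z : Sigma k) (H V B d xi om : R).

Let th0 : 0 < th. Proof. by case/andP: (nw_th NW). Qed.
Let th1 : th < 1. Proof. by case/andP: (nw_th NW). Qed.
Let q0 : 0 < q. Proof. by case/andP: (nw_q NW). Qed.
Let thn n : 0 <= th ^+ n. Proof. by rewrite exprn_ge0// ltW. Qed.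
Let qn n : 0 <= q ^+ n. Proof. by rewrite exprn_ge0// ltW. Qed.

Lemma twistD xi n m W y om : X y ->
  tw xi (n + m) W y om = tw xi m (tw xi n W) y om.
Proof.
move=> Xy; rewrite /twist addnC iterD; apply: ruelle_iter_eq => // x Xx _.
apply: ruelle_iter_eq => // z Xz nz.
by rewrite addnC birkhoffD nz mulrDr addrA addrAC.
Qed.

Lemma twist_trig xi n W : trigonometric M W -> trigonometric M (tw xi n W).
Proof.
move=> hW y Xy om; rewrite /twist mulrC [X in _ = _ + X]mulrC -!ruelle_iterZ -ruelle_iterD.
apply: ruelle_iter_eq => // x Xx _.
rewrite (trigonometric_shift _ _ hW Xx) add0r; ring.
Qed.

Lemma twist_bound xi n W H : (forall x, X x -> forall om, `|W x om| <= H) ->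
  forall x, X x -> forall om, `|tw xi n W x om| <= H.
Proof. by move=> hH x Xx om; apply: (normalized_bound NW) => // z Xz; exact: hH. Qed.

Lemma twist_block : exists (n0 : nat) (C : R), [/\ (0 < n0)%N, 0 <= C &
  forall xi W H V, trigonometric M W -> 0 <= V ->
    (forall x, X x -> forall om, `|W x om| <= H) ->
    (forall om, lipX X th V (W^~ om)) ->
    forall om, lipX X th ((V + C * `|xi| * H) / 2) (tw xi n0 W ^~ om)].
Proof.
have [n0 [n00 gap]] := normalized_gap NW.
have [C C0 hC] := lipX_birkhoff (nw_th NW) hf F0 n0.
exists n0, (2 * C); split => //; first by rewrite mulr_ge0.
move=> xi W H V hW V0 hH hV om; rewrite /twist.
have [x0 Xx0] := X0.
have H0 : 0 <= H by apply: le_trans (normr_ge0 _) (hH x0 Xx0 0).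
apply: gap => [|n x y Xx Xy xy].
  by rewrite addr_ge0// !mulr_ge0.
set a := om + _ * _; set b := om + _ * _.
have ab : `|a - b| <= `|xi| * (C * th ^+ n).
  rewrite (_ : a - b = xi * (birkhoff f n0 x - birkhoff f n0 y)); last by rewrite /a/b; ring.
  by rewrite normrM ler_wpM2l// hC.
rewrite (_ : _ - _ = (W x a - W y a) + (W y a - W y b)); last by ring.
apply: le_trans (ler_normD _ _) _; rewrite mulrDl; apply: lerD; first exact: hV.
apply: le_trans (trigonometric_lip hW Xy (hH y Xy) a b) _.
apply: le_trans (ler_wpM2l _ ab) _; first by rewrite mulr_ge0.
by rewrite le_eqVlt; apply/orP; left; apply/eqP; ring.
Qed.

(* Fix a loop given by accessibility.  If [W] is not contracted near any of the
   points [iter n sshift (xs i)], then the phases of [W] at the two preimages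
   are tied together, and following them around the loop shows that the
   phase of [W] at the base point is shifted by [xi * t]. *)
Section loop.
Variables (B : R).
Hypothesis B0 : 0 <= B.
Variables (n1 p1 : nat) (c1 : R).
Let F' := F / (1 - th).
Hypothesis n1N : (2 * N <= n1)%N.
Hypothesis n1c0 : (c0 <= n1)%N.
Hypothesis p10 : (0 < p1)%N.
Hypothesis c10 : 0 <= c1.
Let E2 := 2 * c1 + (2 * B + 4 * F') * th ^+ p1 + B * th ^+ (n1 - c0).
Variables (j : nat) (xi H : R) (W : Sigma k -> R -> R).
Hypothesis xi0 : xi != 0.
Hypothesis xij : `|xi| * th ^+ j <= 1.
Hypothesis hW : trigonometric M W.
Hypothesis hH : forall x, X x -> forall om, `|W x om| <= H.
Hypothesis hV : forall om, lipX X th (B * `|xi| * H) (W^~ om).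
Let d := Num.min 1 `|xi|.
Let n := (n1 + j)%N.
Let p := (p1 + j)%N.
Let kap := (c1 * d) ^+ 2 / 2.

Let d0 : 0 < d.
Proof. by rewrite lt_min ltr01 normr_gt0. Qed.
Let d1 : d <= 1.
Proof. by rewrite ge_min lexx. Qed.
Let H0 : 0 <= H.
Proof. by have [x0 Xx0] := X0; apply: le_trans (normr_ge0 _) (hH Xx0 0). Qed.
Let F'0 : 0 <= F'.
Proof. by rewrite divr_ge0// subr_ge0 ltW. Qed.

Let xid l : `|xi| * th ^+ (l + j) <= d * th ^+ l.
Proof.
rewrite exprD mulrCA mulrC ler_wpM2r// le_min xij /= ler_piMr//.
by rewrite exprn_ile1// ltW.
Qed.

Lemma uncontracted_phase x y z om : X x -> X y -> X z ->
  iter n sshift x = iter n sshift y -> agree p z (iter n sshift x) ->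
  H - q ^+ n * (kap * H) < tw xi n W z om ->
  (exists a, forall s, `|W x s - H * cos (s - a)| <= d * H * (c1 + B * th ^+ p1)) /\
  forall s, `|W y s - W x (s + xi * (birkhoff f n x - birkhoff f n y))| <=
    d * H * (2 * c1 + (2 * B + 4 * F') * th ^+ p1).
Proof.
move=> Xx Xy Xz xy zx hz.
pose pull x := splice n x z.
pose a x := om + xi * birkhoff f n (pull x).
have key u : X u -> iter n sshift u = iter n sshift x ->
   [/\ X (pull u), agree (n + p) (pull u) u &
    forall s, `|W (pull u) s - H * cos (s - a u)| <= c1 * d * H].
  move=> Xu ux.
  have Xpu : X (pull u).
    apply: SFT_splice => //; rewrite (zx 0%N) ?addn_gt0 ?p10//.
    by rewrite -ux iter_sshiftE addn0.
  split => //; first by apply: agree_splice_add; rewrite ux; exact: agree_sym.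
  apply: (trigonometric_near_max hW) => //; first by rewrite mulr_ge0// ltW.
    by move=> s; exact: hH.
  rewrite leNgt; apply/negP => lt; move: hz; rewrite ltNge => /negP; apply.
  have iu : iter n sshift (pull u) = z by exact: iter_splice.
  apply: le_trans (normalized_one_preimage NW Xz Xpu iu (H := H) _) _.
    by move=> v Xv; apply: le_trans (ler_norm _) _; exact: hH.
  rewrite lerD2l lerN2 ler_wpM2l// -/(a u).
  by move: lt; rewrite /kap; lra.
have [Xpx apx hx] := key x Xx erefl.
have [Xpy apy hy] := key y Xy (esym xy).
have Wlip u s : X u -> X (pull u) -> agree (n + p) (pull u) u ->
    `|W (pull u) s - W u s| <= d * H * (B * th ^+ p1).
  move=> Xu Xpu apu; apply: le_trans (hV s Xpu Xu apu) _.
  have -> : B * `|xi| * H * th ^+ (n + p) = B * H * (`|xi| * th ^+ (n + p)) by ring.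
  have -> : d * H * (B * th ^+ p1) = B * H * (d * th ^+ p1) by ring.
  rewrite ler_wpM2l ?mulr_ge0//; apply: le_trans (xid p1).
  by rewrite ler_wpM2l// ler_wiXn2l ?(ltW th0) ?(ltW th1) ?leq_addl.
split.
  exists (a x) => s; have := Wlip x s Xx Xpx apx; have := hx s.
  have := ler_distD (W (pull x) s) (W x s) (H * cos (s - a x)).
  rewrite [`|W x s - W (pull x) s|]distrC; lra.
move=> s; set tau := birkhoff f n x - birkhoff f n y.
have key1 : `|W (pull x) (s + (a x - a y)) - W (pull x) (s + xi * tau)| <=
    d * H * (4 * F' * th ^+ p1).
  apply: le_trans (trigonometric_lip hW Xpx (hH Xpx) _ _) _.
  have -> : s + (a x - a y) - (s + xi * tau) =
     xi * ((birkhoff f n (pull x) - birkhoff f n x) -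
          (birkhoff f n (pull y) - birkhoff f n y)) by rewrite /a/tau; ring.
  rewrite normrM.
  have := birkhoff_distortion (nw_th NW) hf F0 Xpx Xx apx.
  have := birkhoff_distortion (nw_th NW) hf F0 Xpy Xy apy.
  move=> h1 h2; have := ler_normB (birkhoff f n (pull x) - birkhoff f n x)
    (birkhoff f n (pull y) - birkhoff f n y).
  rewrite -/F' in h1 h2 => h3.
  have {h1 h2} h4 := le_trans h3 (lerD h2 h1).
  apply: le_trans (ler_wpM2l (mulr_ge0 (ler0n R 2) H0) (ler_wpM2l (normr_ge0 xi) h4)) _.
  have -> : 2 * H * (`|xi| * (F' * th ^+ p + F' * th ^+ p)) = 4 * H * F' * (`|xi| * th ^+ p).
    by ring.
  have -> : d * H * (4 * F' * th ^+ p1) = 4 * H * F' * (d * th ^+ p1) by ring.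
  by apply: ler_wpM2l; [exact: (mulr_ge0 (mulr_ge0 (ler0n R 4) H0) F'0) | exact: xid].
have key2 := Wlip x (s + xi * tau) Xx Xpx apx.
have key3 := Wlip y s Xy Xpy apy.
have key4 := hy s.
have key5 := hx (s + (a x - a y)).
rewrite (_ : s + (a x - a y) - a x = s - a y) in key5; last by ring.
have t1 := ler_distD (W (pull y) s) (W y s) (W x (s + xi * tau)).
have t2 := ler_distD (H * cos (s - a y)) (W (pull y) s) (W x (s + xi * tau)).
have t3 := ler_distD (W (pull x) (s + (a x - a y))) (H * cos (s - a y)) (W x (s + xi * tau)).
have t4 := ler_distD (W (pull x) (s + xi * tau)) (W (pull x) (s + (a x - a y))) (W x (s + xi * tau)).
rewrite distrC in key3; rewrite distrC in key5.
lra.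
Qed.

Lemma contracted_point : 0 < H -> (N + 2)%:R * E2 < cos 1 -> 
  exists z, X z /\ forall z', X z' -> agree p z' z ->
    forall om, tw xi n W z' om <= H - q ^+ n * (kap * H).
Proof.
move=> Hgt0 small.
have [x0 Xx0] := X0.
have t01 : 0 <= d / `|xi| <= 1.
  by rewrite divr_ge0 ?(ltW d0)//= ler_pdivrMr ?normr_gt0// mul1r ge_min lexx orbT.
have n2N : (2 * N <= n)%N by apply: leq_trans n1N (leq_addr _ _).
have [m [xs [ys [mN xs0 xsm hxy tE]]]] := acc Xx0 t01 n2N.
have [//|no] := pselect (exists z, X z /\ forall z', X z' -> agree p z' z ->
    forall om, tw xi n W z' om <= H - q ^+ n * (kap * H)).
exfalso.
have bad i : (i < m)%N ->
   (exists a, forall s, `|W (xs i) s - H * cos (s - a)| <= d * H * (c1 + B * th ^+ p1)) /\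
  forall s, `|W (ys i) s - W (xs i) (s + xi * (birkhoff f n (xs i) - birkhoff f n (ys i)))| <=
    d * H * (2 * c1 + (2 * B + 4 * F') * th ^+ p1).
  move=> im; have [Xxi _ Xyi xyi _] := hxy i im.
  have [[z [om [Xz zx hz]]]|nz] := pselect (exists z om,
      [/\ X z, agree p z (iter n sshift (xs i)) & H - q ^+ n * (kap * H) < tw xi n W z om]).
    exact: uncontracted_phase xyi zx hz.
  exfalso; apply: no; exists (iter n sshift (xs i)); split; first exact: SFT_iter.
  move=> z Xz az om; rewrite leNgt; apply/negP => lt; apply: nz.
  by exists z, om.
have chain l : (l <= m)%N -> forall s, `|W (xs l) s - W (xs 0%N) (s + xi *
    \sum_(i < l) (birkhoff f n (xs i) - birkhoff f n (ys i)))| <= l%:R * (d * H * E2).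
  elim: l => [|l IH] lm s.
    by rewrite big_ord0 mulr0 addr0 subrr normr0 mul0r.
  have [Xxl Xxl1 Xyl _ axy] := hxy l lm.
  have [_ h1] := bad l lm.
  rewrite big_ord_recr /= mulrDr [X in s + X]addrC addrA.
  set tau := birkhoff f n (xs l) - _ in h1 *.
  have h2 := IH (ltnW lm) (s + xi * tau).
  have h3 : `|W (xs l.+1) s - W (ys l) s| <= d * H * (B * th ^+ (n1 - c0)).
    apply: le_trans (hV s Xxl1 Xyl (agree_sym axy)) _.
    have -> : (n - c0 = n1 - c0 + j)%N by rewrite /n addnC -addnBA// addnC.
    have -> : B * `|xi| * H * th ^+ (n1 - c0 + j) = B * H * (`|xi| * th ^+ (n1 - c0 + j)) by ring.
    have -> : d * H * (B * th ^+ (n1 - c0)) = B * H * (d * th ^+ (n1 - c0)) by ring.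
    by apply: ler_wpM2l; [exact: mulr_ge0 | exact: xid].
  have t1 := ler_distD (W (ys l) s) (W (xs l.+1) s) (W (xs 0%N) (s + xi * tau + xi *
    \sum_(i < l) (birkhoff f n (xs i) - birkhoff f n (ys i)))).
  have t2 := ler_distD (W (xs l) (s + xi * tau)) (W (ys l) s) (W (xs 0%N) (s + xi * tau + xi *
    \sum_(i < l) (birkhoff f n (xs i) - birkhoff f n (ys i)))).
  have E : d * H * E2 = d * H * (2 * c1 + (2 * B + 4 * F') * th ^+ p1) +
      d * H * (B * th ^+ (n1 - c0)) by rewrite /E2; ring.
  have h4 := h1 s; rewrite -natr1 mulrDl mul1r; lra.
have m0 : (0 < m)%N.
  case: m mN xsm hxy tE bad chain => // _ _ _ + _ _; rewrite big_ord0 => /eqP.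
  by rewrite mulf_eq0 invr_eq0 normr_eq0 (negbTE xi0) (gt_eqF d0).
have [[a ha] _] := bad 0%N m0.
have h0 := chain m (leqnn m) (a + pi / 2).
rewrite -tE xs0 xsm in h0; rewrite xs0 in ha.
pose u := xi * (d / `|xi|).
have h1 := ha (a + pi / 2); have h2 := ha (a + pi / 2 + u).
rewrite (_ : a + pi / 2 - a = pi / 2) in h1; last by ring.
rewrite (_ : a + pi / 2 + u - a = u + pi / 2) in h2; last by ring.
rewrite cos_pihalf mulr0 in h1; rewrite cosDpihalf mulrN in h2.
have sinu : `|sin u| = sin d.
  have sd : 0 <= sin d.
    apply: (le_trans (mulr_ge0 (ltW (cos1_gt0 R)) (ltW d0))).
    by apply: sin_ge; rewrite (ltW d0) d1.
  have [xip|] := ltP 0 xi.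
    by rewrite /u (gtr0_norm xip) mulrC divfK// ger0_norm.
  rewrite le_eqVlt (negbTE xi0) /= => xin.
  by rewrite /u (ltr0_norm xin) invrN !mulrN mulrC divfK// sinN normrN ger0_norm.
have h3 := ler_distD (W x0 (a + pi / 2)) 0 (- (H * sin u)).
have h4 := ler_distD (W x0 (a + pi / 2 + u)) (W x0 (a + pi / 2)) (- (H * sin u)).
rewrite (_ : `|0 - - (H * sin u)| = H * sin d) in h3; last first.
  by rewrite sub0r opprK normrM (ger0_norm H0) sinu.
rewrite distrC in h1.
have E2c : c1 + B * th ^+ p1 <= E2.
  have := mulr_ge0 B0 (thn p1); have := mulr_ge0 F'0 (thn p1).
  have := mulr_ge0 B0 (thn (n1 - c0)); move: c10; rewrite /E2; lra.
have dH0 : 0 < d * H by rewrite mulr_gt0.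
have h5 : d * H * (c1 + B * th ^+ p1) <= d * H * E2 by rewrite ler_wpM2l// ltW.
have h6 : m%:R * (d * H * E2) <= N%:R * (d * H * E2).
  rewrite ler_wpM2r ?ler_nat// mulr_ge0 ?(ltW dH0)//.
  by apply: le_trans E2c; rewrite addr_ge0// mulr_ge0.
have h7 : d * H * ((N + 2)%:R * E2) < d * H * cos 1 by rewrite ltr_pM2l.
have h8 : H * (cos 1 * d) <= H * sin d by rewrite ler_wpM2l// sin_ge// (ltW d0) d1.
rewrite natrD in h7.
rewrite -/u in h0; lra.
Qed.
End loop.
End contraction.

Lemma addn_shuffle (a b c i : nat) : (a + b + c + 2 * i = (a + i) + (b + i + c))%N.
Proof. lia. Qed.

Section decay.
Context {R : realType} {k : nat} (M : rel 'I_k.+1).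
Local Notation X := (SFT M).
Context (g f : Sigma k -> R) (q th A F : R) (c0 N : nat).
Hypothesis NW : normalized_weight M g q th A.
Hypothesis hf : lipX X th F f.
Hypothesis F0 : 0 <= F.
Hypothesis acc : accessible X f c0 N.
Hypothesis X0 : exists x, X x.
Local Notation L := (ruelle M g).
Local Notation tw := (twist M g f).
Implicit Types (W : Sigma k -> R -> R) (x y z : Sigma k) (H V B d xi om : R).

Let th0 : 0 < th. Proof. by case/andP: (nw_th NW). Qed.
Let th1 : th < 1. Proof. by case/andP: (nw_th NW). Qed.
Let q0 : 0 < q. Proof. by case/andP: (nw_q NW). Qed.
Let q1 : q <= 1. Proof. by case/andP: (nw_q NW). Qed.
Let thn n : 0 <= th ^+ n. Proof. by rewrite exprn_ge0// ltW. Qed.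
Let qn n : 0 <= q ^+ n. Proof. by rewrite exprn_ge0// ltW. Qed.

Lemma twist_contraction B : 0 <= B -> exists (T0 : nat) (c : R),
  0 < c <= 4^-1 /\ forall j xi H W, xi != 0 -> `|xi| * th ^+ j <= 1 ->
    trigonometric M W -> (forall x, X x -> forall om, `|W x om| <= H) ->
    (forall om, lipX X th (B * `|xi| * H) (W^~ om)) ->
    forall y, X y -> forall om, `|tw xi (T0 + 2 * j) W y om| <=
      (1 - c * Num.min 1 `|xi| ^+ 2 * (q ^+ 2) ^+ j) * H.
Proof.
move=> B0; have [N0 reach] := mixing_reach (nw_mixing NW).
pose F' := F / (1 - th).
have F'0 : 0 <= F' by rewrite divr_ge0// subr_ge0 ltW.
pose e : R := cos 1 / (4 * (N + 2)%:R).
have e0 : 0 < e by rewrite divr_gt0 ?cos1_gt0// mulr_gt0// ltr0n addn2.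
have e1 : e <= 1.
  rewrite ler_pdivrMr ?mulr_gt0 ?ltr0n ?addn2// mul1r.
  apply: le_trans (cos_le1 1) _; rewrite -natrM ler1n muln_gt0 //.
have eN : (N + 2)%:R * (4 * e) = cos 1.
  have : ((N + 2)%:R : R) != 0 by rewrite pnatr_eq0 addn2.
  by rewrite /e; move: ((N + 2)%:R : R) => K Kn0; field.
clearbody e.
have K0 : 0 < 2 * B + 4 * F' + 1 by lra.
have [p' hp'] : exists p', th ^+ p' <= e / (2 * B + 4 * F' + 1).
  by apply: exp_small; [rewrite (ltW th0) | rewrite divr_gt0].
have {}hp' : (2 * B + 4 * F' + 1) * th ^+ p' <= e by rewrite mulrC -ler_pdivlMr.
pose p1 := p'.+1; pose n1 := (2 * N + c0 + p')%N; pose c1 := e / 2.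
pose T0 := (n1 + p1 + N0)%N.
exists T0, (q ^+ T0 * c1 ^+ 2 / 2); split.
  rewrite /c1 !mulr_gt0 ?exprn_gt0 ?divr_gt0//=.
  have : q ^+ T0 <= 1 by rewrite exprn_ile1// ltW.
  have : (e / 2) ^+ 2 <= 2^-1.
    rewrite expr2; have : e / 2 * (e / 2) <= 2^-1 * 1 by rewrite ler_pM; lra.
    lra.
  have h0 : 0 <= (e / 2) ^+ 2 by rewrite sqr_ge0.
  move=> h1 h2; have : q ^+ T0 * (e / 2) ^+ 2 <= 1 * 2^-1 by rewrite ler_pM.
  lra.
move=> j xi H W xi0 xij hW hH hV.
have H0 : 0 <= H by have [x0 Xx0] := X0; apply: le_trans (normr_ge0 _) (hH x0 Xx0 0).
set d := Num.min 1 `|xi|.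
have up y : X y -> forall om, tw xi (T0 + 2 * j) W y om <=
      (1 - q ^+ T0 * c1 ^+ 2 / 2 * d ^+ 2 * (q ^+ 2) ^+ j) * H.
  move=> Xy om; have [Hgt0|] := ltP 0 H; last first.
    move=> Hle0; have HE : H = 0 by apply/eqP; rewrite eq_le Hle0.
    have := twist_bound f NW xi (T0 + 2 * j) hH Xy om.
    by rewrite HE mulr0 normr_le0 => /eqP ->.
  have [z [Xz hz]] : exists z, X z /\ forall z', X z' -> agree (p1 + j) z' z ->
     forall om, tw xi (n1 + j) W z' om <=
       H - q ^+ (n1 + j) * ((c1 * d) ^+ 2 / 2 * H).
    apply: (contracted_point NW hf F0 acc X0 B0) => //.
    - by rewrite /n1 -addnA leq_addr.
    - by rewrite /n1 addnAC leq_addl.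
    - by rewrite divr_ge0// ltW.
    - rewrite -/F' -eN ltr_pM2l ?ltr0n ?addn2//.
      have h1 : th ^+ p1 <= th ^+ p' by rewrite ler_wiXn2l// ltW.
      have h2 : th ^+ (n1 - c0) <= th ^+ p'.
        rewrite ler_wiXn2l ?(ltW th0) ?(ltW th1)// /n1.
        by rewrite addnAC addnK leq_addl.
      have h3 : (2 * B + 4 * F') * th ^+ p1 <= (2 * B + 4 * F' + 1) * th ^+ p'.
        by rewrite ler_pM//; lra.
      have h4 : B * th ^+ (n1 - c0) <= (2 * B + 4 * F' + 1) * th ^+ p'.
        by rewrite ler_pM//; lra.
      rewrite /c1; lra.
  have -> : (T0 + 2 * j = (n1 + j) + (p1 + j + N0))%N by exact: addn_shuffle.
  rewrite (twistD g f)// /twist -/(twist M g f xi (n1 + j) W).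
  have [x [Xx xz nx]] := reach (p1 + j)%N z y Xz Xy.
  apply: le_trans (normalized_one_preimage NW Xy Xx nx (H := H) _) _.
    move=> v Xv; apply: le_trans (ler_norm _) _.
    exact: (twist_bound f NW _ _ hH).
  have /(_ (om + xi * birkhoff f (p1 + j + N0) x)) := hz x Xx xz.
  move=> h0; have h : q ^+ (n1 + j) * ((c1 * d) ^+ 2 / 2 * H) <=
     H - tw xi (n1 + j) W x (om + xi * birkhoff f (p1 + j + N0) x).
    by move: h0; rewrite !lerBrDr addrC.
  apply: le_trans (lerB (lexx H) (ler_wpM2l (qn _) h)) _.
  rewrite le_eqVlt; apply/orP; left; apply/eqP.
  rewrite /T0 !exprD -!exprM mul2n -addnn exprD; ring.
move=> y Xy om; rewrite ler_norml up// andbT lerNl.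
by rewrite -(trigonometricN _ (twist_trig _ _ _ _ hW) Xy) ?up.
Qed.

End decay.

Section decay_iterates.
Context {R : realType} {k : nat} (M : rel 'I_k.+1).
Local Notation X := (SFT M).
Context (g f : Sigma k -> R) (q th A F : R) (c0 N : nat).
Hypothesis NW : normalized_weight M g q th A.
Hypothesis hf : lipX X th F f.
Hypothesis F0 : 0 <= F.
Hypothesis acc : accessible X f c0 N.
Hypothesis X0 : exists x, X x.
Local Notation tw := (twist M g f).
Implicit Types (W : Sigma k -> R -> R) (x y z : Sigma k) (H V B d xi om : R).

Let th0 : 0 < th. Proof. by case/andP: (nw_th NW). Qed.
Let q0 : 0 < q. Proof. by case/andP: (nw_q NW). Qed.
Let q1 : q <= 1. Proof. by case/andP: (nw_q NW). Qed.
Let thn n : 0 <= th ^+ n. Proof. by rewrite exprn_ge0// ltW. Qed.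

Definition in_cone B xi H W := [/\ trigonometric M W,
  forall x, X x -> forall om, `|W x om| <= H &
  forall om, lipX X th (B * `|xi| * H) (W^~ om)].

Lemma lipX_le (U V : R) w : U <= V -> lipX X th U w -> lipX X th V w.
Proof. by move=> UV h n x y Xx Xy /h -/(_ Xx Xy) /le_trans; apply; rewrite ler_wpM2r. Qed.

Lemma twist_cone_step : exists (B c : R) (T1 n0 : nat), [/\ 0 < B, 0 < c <= 4^-1, (0 < n0)%N, (0 < T1)%N &
  forall j xi H W, xi != 0 -> `|xi| * th ^+ j <= 1 -> in_cone B xi H W ->
    in_cone B xi ((1 - c * Num.min 1 `|xi| ^+ 2 * (q ^+ 2) ^+ j) * H)
      (tw xi (n0 * (T1 + 2 * j)) W)].
Proof.
have [n0 [C [n00 C0 block]]] := twist_block NW hf F0 X0.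
pose B := 2 * C + 1; have B0 : 0 < B by rewrite /B; lra.
have [T0 [c [c01 contr]]] := twist_contraction NW hf F0 acc X0 (ltW B0).
exists B, c, T0.+1, n0; split => // j xi H W xi0 xij [hW hH hV].
have H0 : 0 <= H by have [x0 Xx0] := X0; apply: le_trans (normr_ge0 _) (hH x0 Xx0 0).
set ka := c * _ * _.
have ka4 : ka <= 4^-1.
  have [c_gt0 c4] := andP c01.
  rewrite /ka -mulrA; apply: le_trans c4; rewrite ler_piMr ?(ltW c_gt0)//.
  apply: mulr_ile1; rewrite ?sqr_ge0 ?exprn_ge0 ?exprn_ile1 ?exprn_ge0 ?(ltW q0)//.
have bl s : forall om, lipX X th (B * `|xi| * H) (tw xi (s * n0) W ^~ om) /\
    lipX X th (3 / 4 * (B * `|xi| * H)) (tw xi (s.+1 * n0) W ^~ om).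
  have next n : (forall om, lipX X th (B * `|xi| * H) (tw xi n W ^~ om)) ->
      forall om, lipX X th (3 / 4 * (B * `|xi| * H)) (tw xi (n + n0) W ^~ om).
    move=> hn om; have := block xi (tw xi n W) H (B * `|xi| * H) (twist_trig _ _ _ _ hW) _
      (twist_bound f NW _ _ hH) hn om.
    move=> /(_ (mulr_ge0 (mulr_ge0 (ltW B0) (normr_ge0 _)) H0)) hl m x y Xx Xy xy.
    rewrite !twistD//; apply: le_trans (hl m x y Xx Xy xy) _.
    rewrite ler_wpM2r//.
    have : 0 <= `|xi| * H by rewrite mulr_ge0.
    rewrite /B; lra.
  suff h om : lipX X th (B * `|xi| * H) (tw xi (s * n0) W ^~ om).
    by split => //; rewrite mulSn addnC; exact: next.
  elim: s om => [|s IH] om.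
    rewrite mul0n /twist /= => m x y Xx Xy xy.
    rewrite /birkhoff !big_ord0 mulr0 addr0; exact: hV.
  rewrite mulSn addnC; apply: lipX_le (next _ IH om).
  have : 0 <= B * `|xi| * H by rewrite !mulr_ge0// ltW.
  lra.
split.
- exact: twist_trig.
- move=> x Xx om.
  have [m ->] : exists m, (n0 * (T0.+1 + 2 * j) = (T0 + 2 * j) + m)%N.
    exists (n0 * (T0.+1 + 2 * j) - (T0 + 2 * j))%N; rewrite subnKC//.
    by apply: leq_trans (leq_pmull _ n00); rewrite addSn.
  rewrite twistD//; apply: (twist_bound f NW) => // y Xy s.
  exact: contr.
- move=> om; rewrite addSn mulnC; apply: lipX_le (bl _ om).2.
  have : 0 <= B * `|xi| * H by rewrite !mulr_ge0// ltW.
  have : ka * (B * `|xi| * H) <= 4^-1 * (B * `|xi| * H).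
    by rewrite ler_wpM2r// !mulr_ge0// ltW.
  lra.
Qed.

Lemma twist_iterates : exists (B c : R) (T1 n0 : nat), [/\ 0 < B, 0 < c <= 4^-1, (0 < n0)%N, (0 < T1)%N &
  forall j xi H W n, xi != 0 -> `|xi| * th ^+ j <= 1 -> in_cone B xi H W ->
   forall y, X y -> forall om, `|tw xi n W y om| <=
    (1 - c * Num.min 1 `|xi| ^+ 2 * (q ^+ 2) ^+ j) ^+ (n %/ (n0 * (T1 + 2 * j))) * H].
Proof.
have [B [c [T1 [n0 [B0 c01 n00 T10 step]]]]] := twist_cone_step.
exists B, c, T1, n0; split => // j xi H W n xi0 xij hW.
set T := (n0 * _)%N; set ka := 1 - _.
have it J : in_cone B xi (ka ^+ J * H) (tw xi (J * T) W).
  elim: J => [|J IH].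
    rewrite mul0n expr0 mul1r; have [h1 h2 h3] := hW; split.
    - exact: twist_trig.
    - exact: (twist_bound f NW).
    - move=> om m x y Xx Xy xy.
      by rewrite /twist /= /birkhoff !big_ord0 mulr0 addr0; exact: h3.
  have [h1 h2 h3] := step j xi _ _ xi0 xij IH.
  rewrite mulSn addnC exprS -mulrA; split.
  - by have [h _ _] := hW; exact: twist_trig.
  - by move=> x Xx om; rewrite twistD//; exact: h2.
  - by move=> om m x y Xx Xy xy; rewrite !twistD//; exact: h3.
move=> y Xy om; rewrite {1}(divn_eq n T) twistD//.
apply: (twist_bound f NW) => // x Xx s.
by have [_ h _] := it (n %/ T)%N; exact: h.
Qed.

End decay_iterates.

Section decay.
Context {R : realType}.

Lemma power_decay (s : nat) : exists2 C : R, 0 <= C &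
  forall (ka : R) (n T : nat), 0 <= ka <= 4^-1 -> (0 < T)%N ->
  (1 - ka) ^+ (n %/ T) * (ka * n%:R / T%:R) ^+ s <= C.
Proof.
have [C C0 hC] : exists2 C : R, 0 <= C & forall x : R, 0 <= x -> x ^+ s <= C * expR x.
  case: s => [|s].
    by exists 1 => // x x0; rewrite expr0 mul1r -(expR0 R) ler_expR.
  exists (s.+1%:R ^+ s.+1) => [|x x0]; first by rewrite exprn_ge0.
  have -> : expR x = expR (x / s.+1%:R) ^+ s.+1.
    by rewrite -expRM_natl mulrC divfK.
  rewrite -exprMn lerXn2r ?nnegrE ?mulr_ge0 ?expR_ge0//.
  rewrite mulrC -ler_pdivrMr ?ltr0n//.
  by apply: le_trans (expR_ge1Dx _); rewrite lerDr.
exists (4 / 3 * C); first by rewrite mulr_ge0// divr_ge0.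
move=> ka n T /andP[ka0 ka4] T0.
set J := (n %/ T)%N.
have xle : ka * n%:R / T%:R <= ka * J.+1%:R.
  rewrite -mulrA ler_wpM2l// ler_pdivrMr ?ltr0n// -natrM ler_nat.
  by rewrite ltnW// ltn_ceil.
have x0 : 0 <= ka * n%:R / T%:R by rewrite divr_ge0// mulr_ge0.
have k1 : 0 <= 1 - ka by lra.
have le1 : (1 - ka) ^+ J.+1 <= expR (- (ka * J.+1%:R)).
  rewrite -mulNr expRM_natr lerXn2r ?nnegrE ?expR_ge0//.
  by apply: le_trans (expR_ge1Dx _).
have le2 : (1 - ka) ^+ J * (3 / 4) <= (1 - ka) ^+ J.+1.
  rewrite exprSr ler_wpM2l ?exprn_ge0//; lra.
have le3 : (ka * n%:R / T%:R) ^+ s <= C * expR (ka * J.+1%:R).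
  apply: le_trans (hC _ x0) _; by rewrite ler_wpM2l// ler_expR.
have h0 : 0 <= (1 - ka) ^+ J * (3 / 4) by rewrite mulr_ge0 ?exprn_ge0 ?divr_ge0.
have h1 : 0 <= (ka * n%:R / T%:R) ^+ s by rewrite exprn_ge0.
have := ler_pM h0 h1 (le_trans le2 le1) le3.
have -> : expR (- (ka * J.+1%:R)) * (C * expR (ka * J.+1%:R)) = C.
  by rewrite mulrCA -expRD addNr expR0 mulr1.
lra.
Qed.

End decay.

Section spectral_decay.
Context {R : realType} {k : nat} (M : rel 'I_k.+1).
Local Notation X := (SFT M).
Context (g f : Sigma k -> R) (q th A F : R) (c0 N : nat).
Hypothesis NW : normalized_weight M g q th A.
Hypothesis hf : lipX X th F f.
Hypothesis F0 : 0 <= F.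
Hypothesis acc : accessible X f c0 N.
Hypothesis X0 : exists x, X x.
Local Notation tw := (twist M g f).

Let th0 : 0 < th. Proof. by case/andP: (nw_th NW). Qed.
Let th1 : th < 1. Proof. by case/andP: (nw_th NW). Qed.
Let q0 : 0 < q. Proof. by case/andP: (nw_q NW). Qed.
Let q1 : q <= 1. Proof. by case/andP: (nw_q NW). Qed.
Let thn n : 0 <= th ^+ n. Proof. by rewrite exprn_ge0// ltW. Qed.

Variable W : R -> Sigma k -> R -> R.
Hypothesis W_trig : forall xi, trigonometric M (W xi).
Hypothesis W_decay : forall l : nat, exists2 D : R, 0 <= D & forall xi om,
  (forall x, X x -> `|xi| ^+ l * `|W xi x om| <= D) /\
  (forall n x y, X x -> X y -> agree n x y ->
     `|xi| ^+ l * `|W xi x om - W xi y om| <= D * th ^+ n).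

Lemma W_in_cone B l : 0 < B -> exists2 D : R, 0 <= D & forall xi, xi != 0 ->
  (l = 0%N -> `|xi| <= 1) -> (l <> 0%N -> 1 <= `|xi|) ->
  in_cone M th B xi (D / `|xi| ^+ (if l is 0 then 1 else l)) (W xi).
Proof.
move=> B0; have [D D0 hD] := W_decay l.
exists (D + D / B) => [|xi xi0 l0 l1]; first by rewrite addr_ge0// divr_ge0// ltW.
have nxi : 0 < `|xi| by rewrite normr_gt0.
have DB : 0 <= D / B by rewrite divr_ge0// ltW.
set l' := if l is 0 then _ else _.
have le1 : `|xi| ^+ l' <= `|xi| ^+ l.
  by rewrite /l'; case: (l) l0 l1 => // + _ => /(_ erefl); rewrite expr1 expr0.
have le2 : `|xi| ^+ l' <= `|xi| * `|xi| ^+ l.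
  rewrite /l'; case: (l) l0 l1 => [|l''] _ h; first by rewrite expr1 expr0 mulr1.
  by rewrite ler_peMl ?exprn_ge0 ?h.
split; first exact: W_trig.
- move=> x Xx om; rewrite ler_pdivlMr ?exprn_gt0//.
  apply: le_trans (_ : D <= _); last by rewrite lerDl.
  apply: le_trans ((hD xi om).1 x Xx); rewrite mulrC.
  by rewrite ler_wpM2r.
- move=> om n x y Xx Xy xy; have h2 := (hD xi om).2 n x y Xx Xy xy.
  have h1 := ler_wpM2r (normr_ge0 (W xi x om - W xi y om)) le2.
  rewrite -mulrA in h1.
  have h3 : `|xi| ^+ l' * `|W xi x om - W xi y om| <= `|xi| * (D * th ^+ n).
    by apply: le_trans h1 _; rewrite ler_wpM2l.
  have -> : B * `|xi| * ((D + D / B) / `|xi| ^+ l') * th ^+ n =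
     (B * D + D) * th ^+ n * `|xi| / `|xi| ^+ l'.
    have n1 : `|xi| ^+ l' != 0 by rewrite expf_neq0// gt_eqF.
    have n2 : B != 0 by rewrite gt_eqF.
    by field; rewrite n1 n2.
  rewrite ler_pdivlMr ?exprn_gt0// mulrC; apply: le_trans h3 _.
  have : 0 <= B * D * th ^+ n * `|xi| by rewrite !mulr_ge0// ltW.
  lra.
Qed.

Lemma spectral_decay (kk : nat) (eps : R) : 0 < eps -> exists2 C : R, 0 <= C &
  forall n, (0 < n)%N -> forall xi, n%:R `^ (- 2^-1 + eps) <= `|xi| ->
  forall y, X y -> forall om, `|tw xi n (W xi) y om| <= C * n%:R ^- kk.
Proof.
move=> eps0.
have [B [c [T1 [n0 [B0 /andP[cgt0 c4] n00 T10 it]]]]] := twist_iterates NW hf F0 acc X0.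
have T0 j : (0 < n0 * (T1 + 2 * j))%N by rewrite muln_gt0 n00 addn_gt0 T10.
have small : exists2 C : R, 0 <= C & forall n, (0 < n)%N -> forall xi,
    n%:R `^ (- 2^-1 + eps) <= `|xi| -> `|xi| <= 1 ->
    forall y, X y -> forall om, `|tw xi n (W xi) y om| <= C * n%:R ^- kk.
  have [D D0 hD] := W_in_cone 0 B0.
  pose s := Num.bound (kk.+1%:R / (2 * eps)).
  have hs : kk.+1%:R <= 2 * eps * s%:R.
    rewrite mulrC -ler_pdivrMr ?mulr_gt0//; apply/ltW/archi_boundP.
    by rewrite divr_ge0// mulr_ge0// ltW.
  have [P P0 hP] := @power_decay R s.
  pose T := (n0 * (T1 + 2 * 0))%N.
  have Tpos : 0 < (T%:R : R) by rewrite ltr0n T0.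
  have cT : 0 <= T%:R / c by rewrite divr_ge0// ltW.
  exists (P * (T%:R / c) ^+ s * D).
    by apply: mulr_ge0 => //; apply: mulr_ge0 => //; apply: exprn_ge0.
  move=> n n_gt0 xi hxi xi1 y Xy om.
  set a : R := n%:R; have a1 : 1 <= a by rewrite ler1n.
  have a0 : 0 < a by lra.
  have powa0 (b : R) : 0 < a `^ b by rewrite powR_gt0.
  have xip : 0 < `|xi| by exact: lt_le_trans hxi.
  have xi0 : xi != 0 by rewrite -normr_gt0.
  have powS (b : R) : a * a `^ b = a `^ (1 + b).
    by rewrite powRD ?powRr1 ?(ltW a0)// (gt_eqF a0) implybT.
  have h1 : 1 <= a * `|xi|.
    apply: le_trans (_ : a * a `^ (- 2^-1 + eps) <= _); last by rewrite ler_pM2l.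
    rewrite powS -[leLHS](powRr0 a) ler_powR//; lra.
  have h2 : a `^ (2 * eps) <= `|xi| ^+ 2 * a.
    apply: le_trans (_ : (a `^ (- 2^-1 + eps)) ^+ 2 * a <= _).
      rewrite -powR_mulrn ?(ltW (powa0 _))// -powRrM [leRHS]mulrC powS ler_powR//; lra.
    by rewrite ler_pM2r// lerXn2r ?nnegrE ?(ltW (powa0 _)).
  have h3 : a ^+ kk.+1 <= (`|xi| ^+ 2 * a) ^+ s.
    apply: le_trans (_ : (a `^ (2 * eps)) ^+ s <= _).
      rewrite -[leRHS]powR_mulrn ?(ltW (powa0 _))// -powRrM -powR_mulrn ?(ltW a0)//.
      by rewrite ler_powR.
    rewrite lerXn2r ?nnegrE ?(ltW (powa0 _))//.
    by rewrite mulr_ge0 ?exprn_ge0// ltW.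
  have xij : `|xi| * th ^+ 0 <= 1 by rewrite expr0 mulr1.
  have cone : in_cone M th B xi (D / `|xi|) (W xi).
    by rewrite -[`|xi|]expr1; exact: hD.
  have := it 0%N xi _ _ n xi0 xij cone y Xy om.
  rewrite min_r// expr0 mulr1 -/T.
  set ka := c * `|xi| ^+ 2 => h.
  have ka0 : 0 <= ka by apply: mulr_ge0; [exact: ltW | exact: exprn_ge0].
  have ka4 : ka <= 4^-1.
    apply: le_trans c4; rewrite /ka ler_piMr ?(ltW cgt0)//.
    by rewrite exprn_ile1.
  have ka04 : 0 <= ka <= 4^-1 by rewrite ka0.
  have k1 : 0 <= (1 - ka) ^+ (n %/ T) by rewrite exprn_ge0//; lra.
  have {hP} hP := hP ka n T ka04 (T0 0%N).
  have {}hP : (1 - ka) ^+ (n %/ T) * a ^+ kk.+1 <= P * (T%:R / c) ^+ s.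
    apply: le_trans (ler_wpM2l k1 h3) _.
    have -> : `|xi| ^+ 2 * a = ka * a / T%:R * (T%:R / c).
      by rewrite /ka; field; rewrite !gt_eqF.
    rewrite exprMn mulrA ler_wpM2r//; exact: exprn_ge0.
  apply: le_trans h _.
  have hDx : D / `|xi| <= D * a.
    by rewrite ler_wpM2l// -[leLHS]mul1r ler_pdivrMr.
  apply: le_trans (ler_wpM2l k1 hDx) _.
  rewrite ler_pdivlMr ?exprn_gt0//.
  have -> : (1 - ka) ^+ (n %/ T) * (D * a) * a ^+ kk = (1 - ka) ^+ (n %/ T) * a ^+ kk.+1 * D.
    by rewrite exprS; ring.
  by rewrite ler_wpM2r.
have large : exists2 C : R, 0 <= C & forall n, (0 < n)%N -> forall xi, 1 < `|xi| ->
    forall y, X y -> forall om, `|tw xi n (W xi) y om| <= C * n%:R ^- kk.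
  pose r := q ^+ 2; have r0 : 0 < r by rewrite exprn_gt0.
  have r1 : r <= 1 by rewrite exprn_ile1// ltW.
  have [l' hl'] : exists l, th ^+ l <= (r / 2) ^+ kk.
    by apply: exp_small; [rewrite (ltW th0) | rewrite exprn_gt0// divr_gt0].
  pose l := l'.+1.
  have hl : th ^+ l <= (r / 2) ^+ kk.
    by apply: le_trans hl'; rewrite ler_wiXn2l// ltW.
  have [D D0 hD] := W_in_cone l B0.
  have [P P0 hP] := @power_decay R kk.
  pose K := n0%:R * (T1 + 2)%:R / c.
  have K0 : 0 <= K by rewrite divr_ge0 ?mulr_ge0// ltW.
  exists (P * K ^+ kk * (D / th ^+ l)).
    by rewrite !mulr_ge0 ?exprn_ge0 ?invr_ge0.
  move=> n n_gt0 xi xi1 y Xy om.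
  have xi0 : xi != 0 by rewrite -normr_gt0; lra.
  have ex : exists j, `|xi| * th ^+ j <= 1.
    have [j hj] : exists j, th ^+ j <= `|xi|^-1.
      by apply: exp_small; [rewrite (ltW th0) | rewrite invr_gt0 normr_gt0].
    by exists j; rewrite mulrC -ler_pdivlMr ?normr_gt0// mul1r.
  case: (ex_minnP ex) => j hj jmin.
  have j0 : (0 < j)%N.
    by case: (j) hj => //; rewrite expr0 mulr1 leNgt xi1.
  have hj1 : 1 <= `|xi| * th ^+ j.-1.
    rewrite ltW// ltNge; apply/negP => /jmin; rewrite leqNgt prednK// leqnn //.
  have cone : in_cone M th B xi (D / `|xi| ^+ l) (W xi).
    by apply: hD => // _; exact: ltW.
  have := it j xi _ _ n xi0 hj cone y Xy om.
  have -> : Num.min 1 `|xi| = 1 by rewrite min_l// ltW.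
  rewrite expr1n mulr1 -/r.
  set ka := c * r ^+ j; set T := (n0 * _)%N => h.
  have rj0 : 0 < r ^+ j by rewrite exprn_gt0.
  have ka0 : 0 < ka by rewrite mulr_gt0.
  have ka4 : ka <= 4^-1.
    by apply: le_trans c4; rewrite ler_piMr ?(ltW cgt0)// exprn_ile1// ltW.
  have ka04 : 0 <= ka <= 4^-1 by rewrite ka4 ltW.
  have {hP} hP := hP ka n T ka04 (T0 j).
  have Tpos : 0 < (T%:R : R) by rewrite ltr0n T0.
  have npos : 0 < (n%:R : R) by rewrite ltr0n.
  have u0 : 0 < ka * n%:R / T%:R by rewrite divr_gt0// mulr_gt0.
  have {}hP : (1 - ka) ^+ (n %/ T) <= P * (T%:R / ka) ^+ kk * n%:R ^- kk.
    move: hP; rewrite -ler_pdivlMr ?exprn_gt0// => /le_trans; apply.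
    rewrite -[leRHS]mulrA ler_wpM2l// -!exprVn -exprMn.
    rewrite le_eqVlt; apply/orP; left; apply/eqP; congr (_ ^+ _).
    by field; rewrite !gt_eqF.
  have {}hT : T%:R <= n0%:R * (T1 + 2)%:R * 2 ^+ j :> R.
    rewrite -natrX -!natrM ler_nat -mulnA leq_mul2l; apply/orP; right.
    rewrite mulnDl leq_add//; first by rewrite leq_pmulr// expn_gt0.
    by rewrite leq_mul2l /= ltnW// ltn_expl.
  have hTk : (T%:R / ka) ^+ kk * th ^+ (l * j) <= K ^+ kk.
    have e1 : th ^+ (l * j) <= ((r / 2) ^+ j) ^+ kk.
      have -> : ((r / 2) ^+ j) ^+ kk = ((r / 2) ^+ kk) ^+ j by rewrite -!exprM mulnC.
      have r2 : 0 <= r / 2 by rewrite divr_ge0// ltW.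
      by rewrite exprM lerXn2r ?nnegrE ?(exprn_ge0 _ r2).
    apply: le_trans (_ : (T%:R / ka) ^+ kk * ((r / 2) ^+ j) ^+ kk <= _).
      by rewrite ler_wpM2l// exprn_ge0// divr_ge0// ltW.
    rewrite -exprMn lerXn2r ?nnegrE//.
      apply: mulr_ge0; first by rewrite divr_ge0// ltW.
      by apply: exprn_ge0; rewrite divr_ge0// ltW.
    have -> : T%:R / ka * (r / 2) ^+ j = T%:R / 2 ^+ j / c.
      rewrite /ka expr_div_n; field.
      by rewrite (gt_eqF cgt0) expf_eq0 pnatr_eq0 andbF (gt_eqF rj0).
    by rewrite /K ler_wpM2r ?invr_ge0 ?(ltW cgt0)// ler_pdivrMr ?exprn_gt0.
  have hH : D / `|xi| ^+ l <= D / th ^+ l * th ^+ (l * j).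
    rewrite -mulrA ler_wpM2l// -(ler_pM2r (_ : 0 < `|xi| ^+ l)); last by rewrite exprn_gt0// normr_gt0.
    rewrite mulVf ?expf_neq0 ?normr_eq0//.
    have -> : th ^- l * th ^+ (l * j) * `|xi| ^+ l = (`|xi| * th ^+ j.-1) ^+ l.
      rewrite exprMn -exprM -{1}(prednK j0) mulnS exprD mulnC.
      by field; rewrite expf_neq0// gt_eqF.
    exact: exprn_ege1.
  apply: le_trans h _; rewrite -/l.
  have k1 : 0 <= (1 - ka) ^+ (n %/ T) by rewrite exprn_ge0//; lra.
  apply: le_trans (ler_pM k1 _ hP hH) _.
    by rewrite divr_ge0// exprn_ge0.
  have -> : P * (T%:R / ka) ^+ kk / n%:R ^+ kk * (D / th ^+ l * th ^+ (l * j)) =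
     P * (D / th ^+ l) / n%:R ^+ kk * ((T%:R / ka) ^+ kk * th ^+ (l * j)) by ring.
  have -> : P * K ^+ kk * (D / th ^+ l) / n%:R ^+ kk =
     P * (D / th ^+ l) / n%:R ^+ kk * K ^+ kk by ring.
  rewrite ler_wpM2l//; apply: mulr_ge0; last by rewrite invr_ge0 exprn_ge0.
  by apply: mulr_ge0 => //; apply: divr_ge0.
have [C1 C10 h1] := small; have [C2 C20 h2] := large.
exists (C1 + C2) => [|n n_gt0 xi hxi y Xy om]; first by rewrite addr_ge0.
have [xi1|xi1] := leP `|xi| 1.
  apply: le_trans (h1 n n_gt0 xi hxi xi1 y Xy om) _.
  by rewrite ler_wpM2r// lerDl.
apply: le_trans (h2 n n_gt0 xi xi1 y Xy om) _.
by rewrite ler_wpM2r// lerDr.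
Qed.

End spectral_decay.

(** * Measurability on the sequence space *)

Section bounded_integration.
Context {d : measure_display} {T : measurableType d} {R : realType}.
Context (m : {finite_measure set T -> \bar R}) (D : set T).
Hypothesis mD : measurable D.
Implicit Types (f : T -> R) (B : R).

Lemma bounded_integrable f B : measurable_fun D f ->
  (forall x, D x -> `|f x| <= B) -> m.-integrable D (EFin \o f).
Proof.
move=> mf hB; apply: measurable_bounded_integrable => //.
  by rewrite ltey_eq fin_num_measure.
exists B; split; first exact: num_real.
by move=> y By x Dx; apply: le_trans (hB x Dx) (ltW By).
Qed.

Lemma bounded_Rintegral_norm f B : measurable_fun D f ->
  (forall x, D x -> `|f x| <= B) -> `|\int[m]_(x in D) f x| <= B * fine (m D).
Proof.
move=> mf hB; have fi := bounded_integrable mf hB.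
apply: le_trans (le_normr_Rintegral mD fi) _.
rewrite -Rintegral_cst//; apply: le_Rintegral => //.
- have := @bounded_integrable (fun x => `|f x|) B; apply.
    exact: measurableT_comp.
  by move=> x Dx; rewrite normr_id hB.
- by apply: (@bounded_integrable (fun=> B) `|B|).
Qed.

Lemma bounded_Rintegral_cvg (h : nat -> T -> R) f B :
  (forall n, measurable_fun D (h n)) ->
  (forall n x, D x -> `|h n x| <= B) ->
  (forall x, D x -> h ^~ x @ \oo --> f x) ->
  (fun n => \int[m]_(x in D) h n x) @ \oo --> \int[m]_(x in D) f x.
Proof.
move=> mh hB hf.
have mf : measurable_fun D f by exact: measurable_fun_cvg mh hf.
have fB x : D x -> `|f x| <= B.
  move=> Dx; have hn : (fun n => `|h n x|) @ \oo --> `|f x|.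
    exact: (cvg_norm (hf x Dx)).
  rewrite -(cvg_lim _ hn)//; apply: limr_le; first by apply/cvg_ex; eexists; exact: hn.
  by apply: nearW => n; exact: hB.
apply: fine_cvg; rewrite fineK; last first.
  apply: integrable_fin_num => //; exact: bounded_integrable fB.
have := @dominated_convergence _ _ _ m D mD (fun n => EFin \o h n)
  (EFin \o f) (fun=> B%:E).
case => //.
- by move=> n; apply/measurable_EFinP.
- exact/measurable_EFinP.
- apply: aeW => x Dx; apply: cvg_EFin; first exact: nearW.
  exact: hf.
- exact: (@bounded_integrable (fun=> B) `|B|).
- by apply: aeW => x n Dx; rewrite lee_fin hB.
Qed.

End bounded_integration.

Section sequence_space_measurability.
Context {k : nat} (M : rel 'I_k.+1).
Local Notation X := (SFT M).
Implicit Types (x y : Sigma k).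

Lemma measurable_cyl x n : measurable (cyl x n : set (Sigma k)).
Proof. by apply: sub_sigma_algebra; exists x, n. Qed.

Lemma measurable_of_agree n (A : set (Sigma k)) :
  (forall x y, agree n x y -> A x -> A y) -> measurable A.
Proof.
move=> hA; pose C (s : seq 'I_k.+1) : set (Sigma k) :=
  [set x | A x /\ mkseq x n = s].
have -> : A = \bigcup_s C s.
  apply/seteqP; split => x /=; first by move=> Ax; exists (mkseq x n).
  by move=> [s _ []].
apply: countable_bigcupT_measurable => [|s]; first exact: countableP.
have [[x [Ax xs]]|no] := pselect (exists x, A x /\ mkseq x n = s); last first.
  have -> : C s = set0 by rewrite -subset0 => x Cx; apply: no; exists x.
  exact: measurable0.
have -> : C s = cyl x n; last exact: measurable_cyl.
have sE y : mkseq y n = s <-> agree n x y.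
  rewrite -xs; split => [/(congr1 (nth ord0)) h i ni|h].
    by have := congr1 (fun F => F i) h; rewrite !nth_mkseq.
  by apply/eq_in_map => i; rewrite mem_iota /= => /h.
apply/seteqP; split => y /=.
  by move=> [Ay /sE h] i ni; rewrite h.
by move=> h; have xy : agree n x y by [move=> i ni; rewrite h]; split;
  [exact: hA xy Ax | exact/sE].
Qed.

Lemma measurable_SFT : measurable X.
Proof.
have -> : X = \bigcap_i [set x : Sigma k | M (x i) (x i.+1)].
  by apply/seteqP; split => [x Xx i _|x h i]; [exact: Xx | exact: h].
apply: bigcapT_measurable => i; apply: (@measurable_of_agree i.+2) => x y xy /=.
by rewrite !xy.
Qed.

Lemma measurable_sshift : measurable_fun [set: Sigma k] (sshift : Sigma k -> Sigma k).
Proof.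
apply: (@measurability _ _ (Sigma k) (Sigma k) _ _ (@cylinders k)) => //.
move=> _ [_ [x [n ->]] <-]; rewrite setTI.
by apply: (@measurable_of_agree n.+1) => y z yz h i ni /=; rewrite /sshift -yz// -h.
Qed.

Lemma measurable_iter_sshift n :
  measurable_fun [set: Sigma k] (iter n sshift : Sigma k -> Sigma k).
Proof.
elim: n => [|n IH]; first exact: measurable_id.
exact: (measurableT_comp measurable_sshift IH).
Qed.

Lemma measurable_scons a : measurable_fun [set: Sigma k] (scons a : Sigma k -> Sigma k).
Proof.
apply: (@measurability _ _ (Sigma k) (Sigma k) _ _ (@cylinders k)) => //.
move=> _ [_ [x [n ->]] <-]; rewrite setTI.
by apply: (@measurable_of_agree n) => y z yz h [|i] ni /=;
  [exact: (h 0%N ni) | rewrite -(yz i (ltnW ni)); exact: (h i.+1 ni)].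
Qed.

Lemma measurable_fun_agree {R : realType} n (w : Sigma k -> R) :
  (forall x y, agree n x y -> w x = w y) -> measurable_fun setT w.
Proof.
move=> hw _ B mB; rewrite setTI; apply: (@measurable_of_agree n) => x y xy /=.
by rewrite (hw x y xy).
Qed.

Lemma measurable_lipX {R : realType} (th V : R) w : 0 <= th < 1 ->
  lipX X th V w -> measurable_fun X w.
Proof.
move=> th01 hw.
pose rep n x : Sigma k := get (fun y => X y /\ agree n y x).
have repP n x : X x -> X (rep n x) /\ agree n (rep n x) x.
  by move=> Xx; apply: (@getPex _ (fun y => X y /\ agree n y x)); exists x.
apply: (@measurable_fun_cvg _ _ _ _ (fun n x => w (rep n x))).
  move=> n; apply: measurable_funTS; apply: (@measurable_fun_agree _ n) => x y xy.
  congr (w _); rewrite /rep; congr get; apply/funext => z.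
  by apply/propext; split => -[Xz zx]; split => //;
    [exact: agree_trans xy | exact: agree_trans (agree_sym xy)].
move=> x Xx; apply/cvgrPdist_le => e e0.
have V0 : 0 <= V.
  have : `|w x - w x| <= V * th ^+ 0 by exact: hw.
  by rewrite subrr normr0 mulr1.
have [N hN] : exists N, th ^+ N <= e / (V + 1).
  by apply: exp_small => //; rewrite divr_gt0// ltr_wpDl.
exists N => // n /= Nn.
have [Xr ar] := repP n x Xx.
apply: le_trans (hw n _ _ Xx Xr (agree_sym ar)) _.
have [th0 th1] := andP th01.
apply: le_trans (_ : (V + 1) * th ^+ N <= _); last first.
  by rewrite mulrC -ler_pdivlMr// ltr_wpDl.
by apply: ler_pM => //; [rewrite exprn_ge0 | rewrite lerDl | rewrite ler_wiXn2l// ltW].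
Qed.

End sequence_space_measurability.

Lemma measurable_sum_cond {d : measure_display} {T : measurableType d} {R : realType}
  (D : set T) (I : Type) (r : seq I) (P : pred I) (F : I -> T -> R) :
  (forall i, P i -> measurable_fun D (F i)) ->
  measurable_fun D (fun x => \sum_(i <- r | P i) F i x).
Proof.
move=> mF; elim: r => [|i r IH].
  under eq_fun do rewrite big_nil.
  exact: measurable_cst.
have [Pi|/negbTE Pi] := boolP (P i); under eq_fun do rewrite big_cons Pi.
  by apply: measurable_funD => //; exact: mF.
exact: IH.
Qed.

Lemma bounded_Rintegral_sum {d : measure_display} {T : measurableType d} {R : realType}
  (m : {finite_measure set T -> \bar R}) (D : set T) (I : eqType) (r : seq I) (P : pred I)
  (F : I -> T -> R) (B : I -> R) : measurable D ->
  (forall i, P i -> measurable_fun D (F i)) ->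
  (forall i x, P i -> D x -> `|F i x| <= B i) ->
  \int[m]_(x in D) (\sum_(i <- r | P i) F i x) = \sum_(i <- r | P i) \int[m]_(x in D) F i x.
Proof.
move=> mD mF FB; elim: r => [|i r IH].
  rewrite big_nil.
  under eq_Rintegral do rewrite big_nil.
  by rewrite Rintegral_cst// mul0r.
rewrite big_cons -IH.
have [Pi|/negbTE Pi] := boolP (P i); under eq_Rintegral do rewrite big_cons Pi.
  2: by [].
rewrite RintegralD//.
  exact: bounded_integrable (mF i Pi) (fun x => FB i x Pi).
apply: (@bounded_integrable _ _ _ m _ mD _ (\sum_(i <- r | P i) B i)).
  exact: measurable_sum_cond.
move=> x Dx; apply: le_trans (ler_norm_sum _ _ _) _.
by apply: ler_sum => j Pj; exact: FB.
Qed.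

(** * Gibbs measures and their normalized weights *)

Section invariant_measure.
Context {R : realType} {k : nat} (M : rel 'I_k.+1) (mu : probability (Sigma k) R).
Local Notation X := (SFT M).
Hypothesis muX : mu X = 1%E.
Hypothesis mu_inv : forall A : set (Sigma k), measurable A ->
  mu (sshift @^-1` A) = mu A.
Context (th : R).
Hypothesis th01 : 0 < th < 1.
Local Notation S := (ruelle M (fun=> 1 : R)).
Implicit Types (x y : Sigma k) (v w : Sigma k -> R) (A : set (Sigma k)).

Let mX : measurable X := measurable_SFT M.

Definition cylp n x : R := fine (mu (cyl x n)).

Definition hits n x m : set (Sigma k) := [set y | agree m (iter n sshift y) x].

Lemma measurable_hits n x m : measurable (hits n x m).
Proof.
apply: (@measurable_of_agree _ (n + m)) => y z yz h.
by apply: agree_trans h; apply: agree_iter; exact: agree_sym.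
Qed.

Lemma mu_iter n A : measurable A -> mu (iter n sshift @^-1` A) = mu A.
Proof.
elim: n A => [//|n IH] A mA; rewrite -[RHS]mu_inv// -[RHS]IH//.
by rewrite -[X in measurable X]setTI; exact: measurable_sshift.
Qed.

Lemma Rintegral_setI_indic v A : measurable A -> measurable_fun X v ->
  \int[mu]_(x in X `&` A) v x = \int[mu]_(x in X) (v x * \1_A x).
Proof.
move=> mA mv; rewrite Rintegral_mkcondr; apply: eq_Rintegral => x _.
by rewrite patchE indicE; case: (x \in A); rewrite ?mulr1 ?mulr0.
Qed.

Lemma Rintegral_indic A : measurable A -> \int[mu]_(x in X) \1_A x = fine (mu A).
Proof.
move=> mA; have := @Rintegral_setI_indic (fun=> 1) A mA (measurable_cst _).
under [in RHS]eq_Rintegral do rewrite mul1r.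
move=> <-; rewrite Rintegral_cst ?mul1r; last exact: measurableI.
congr fine.
have mXC : mu (~` X) = 0%E.
  by rewrite probability_setC// muX subee.
rewrite [RHS](measureDI _ mA mX) setIC -[LHS]add0e; congr (_ + _)%E.
apply/esym/(subset_measure0 _ _ _ mXC); last by move=> x [].
- exact: measurableD.
- exact: measurableC.
Qed.

Lemma lipX_bounded V w : lipX X th V w -> exists2 B, 0 <= B & forall x, X x -> `|w x| <= B.
Proof.
move=> hw; have [[x0 Xx0]|no] := pselect (exists x, X x); last first.
  by exists 0 => // x Xx; case: no; exists x.
exists (`|w x0| + `|V|) => [|x Xx]; first by rewrite addr_ge0.
have : `|w x - w x0| <= V * th ^+ 0 by exact: hw.
rewrite expr0 mulr1 => h; have := ler_norm V.
have := ler_normD (w x - w x0) (w x0); rewrite subrK; lra.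
Qed.

Lemma cylinder_sum V v n m y : lipX X th V v -> (0 < m)%N -> X y ->
  `|iter n S (fun x => cylp (n + m) x * v x) y
    - \int[mu]_(x in X) (v x * \1_(hits n y m) x)|
  <= V * th ^+ (n + m) * fine (mu (hits n y m)).
Proof.
move=> hv; have [B B0 vB] := lipX_bounded hv.
have [th0 th1] := andP th01.
have mv : measurable_fun X v by apply: measurable_lipX hv; rewrite ltW.
elim: n m y => [|n IH] m y m0 Xy.
  have cE : hits 0 y m = cyl y m by [].
  rewrite /= add0n cE -(Rintegral_setI_indic (measurable_cyl y m) mv).
  rewrite /cylp -(Rintegral_indic (measurable_cyl y m)).
  have e1 : \int[mu]_(x in X) \1_(cyl y m) x = \int[mu]_(x in X `&` cyl y m) 1.
    rewrite Rintegral_setI_indic//; first by apply: eq_Rintegral => x _; rewrite mul1r.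
    exact: measurable_cyl.
  have mXc : measurable (X `&` cyl y m) by apply: measurableI => //; exact: measurable_cyl.
  rewrite e1 Rintegral_cst// mul1r mulrC -(Rintegral_cst mu mXc (v y)).
  have mvc : measurable_fun (X `&` cyl y m) v.
    by apply: measurable_funS mv => // x [].
  rewrite -RintegralB//.
  - apply: bounded_Rintegral_norm => //; first by apply: measurable_funB.
    by move=> x [Xx yx]; apply: hv => // i im; rewrite yx.
  - by apply: (@bounded_integrable _ _ _ mu _ mXc (fun=> v y) B) => // x _; exact: vB.
  - by apply: (@bounded_integrable _ _ _ mu _ mXc v B) => // x [Xx _]; exact: vB.
have hitsS x : X x -> \1_(hits n.+1 y m) x = \sum_(a | M a (y 0%N)) \1_(hits n (scons a y) m.+1) x :> R.
  move=> Xx; rewrite indicE; have [xh|xh] := boolP (x \in hits n.+1 y m).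
    have h : agree m (iter n.+1 sshift x) y by rewrite inE in xh.
    have hn : M (iter n sshift x 0%N) (y 0%N).
      by rewrite -(h 0%N m0); exact: (SFT_iter n Xx).
    rewrite (bigD1 (iter n sshift x 0%N))//= big1 => [|a /andP[_ an]].
      rewrite addr0 indicE mem_set//= => -[|i] im //=.
      by rewrite -(h i im).
    rewrite indicE memNset//= => ha; move: an; rewrite (ha 0%N isT) /=.
    by rewrite eqxx.
  rewrite big1// => a Ma; rewrite indicE memNset//= => ha.
  move/negP: xh; apply; rewrite inE => i im.
  exact: (ha i.+1 im).
have mh z l : measurable_fun X (\1_(hits n z l) : _ -> R).
  by apply: measurable_funTS; apply: measurable_indic; exact: measurable_hits.
have ind1 z l x : `|\1_(hits n z l) x : R| <= 1.
  by rewrite indicE; case: (_ \in _); rewrite ?normr1 ?normr0.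
have I1 : \int[mu]_(x in X) (v x * \1_(hits n.+1 y m) x) =
    \sum_(a | M a (y 0%N)) \int[mu]_(x in X) (v x * \1_(hits n (scons a y) m.+1) x).
  rewrite -(@bounded_Rintegral_sum _ _ _ mu X _ _ _ _ (fun=> B))//.
  - apply: eq_Rintegral => x; rewrite inE => Xx.
    by rewrite hitsS// big_distrr.
  - by move=> a _; apply: measurable_funM.
  - move=> a x _ Xx; rewrite normrM -[leRHS]mulr1.
    by apply: ler_pM; [exact: normr_ge0 | exact: normr_ge0 | exact: vB | exact: ind1].
have I2 : fine (mu (hits n.+1 y m)) =
    \sum_(a | M a (y 0%N)) fine (mu (hits n (scons a y) m.+1)).
  rewrite -Rintegral_indic; last exact: measurable_hits.
  under [RHS]eq_bigr => a _ do rewrite -(Rintegral_indic (measurable_hits _ _ _)).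
  rewrite -(@bounded_Rintegral_sum _ _ _ mu X _ _ _ _ (fun=> 1))//.
  by apply: eq_Rintegral => x; rewrite inE => Xx; rewrite hitsS.
rewrite iterS I1 I2 /ruelle -sumrB big_distrr /=.
apply: le_trans (ler_norm_sum _ _ _) _; apply: ler_sum => a Ma.
rewrite mul1r addSnnS; apply: IH => //; exact: SFT_scons.
Qed.

Lemma fine_hits n x m : fine (mu (hits n x m)) = cylp m x.
Proof. by congr fine; rewrite -(mu_iter n (measurable_cyl x m)). Qed.

Lemma cylinder_sum1 n m y : (0 < m)%N -> X y ->
  iter n S (fun x => cylp (n + m) x) y = cylp m y.
Proof.
move=> m0 Xy; have h1 : lipX X th 0 (fun=> 1 : R).
  by move=> p x z _ _ _; rewrite subrr normr0 mul0r.
have := cylinder_sum n h1 m0 Xy; rewrite !mul0r normr_le0 subr_eq0 => /eqP.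
under [in X in X -> _]eq_Rintegral do rewrite mul1r.
rewrite Rintegral_indic ?fine_hits; last exact: measurable_hits.
by move=> <-; congr (iter n S _ y); apply/funext => x; rewrite mulr1.
Qed.

End invariant_measure.

Section sequence_limits.
Context {R : realType}.
Implicit Types (u v : nat -> R) (l c : R).

Lemma cvgn_le u l c : u @ \oo --> l -> (forall n, u n <= c) -> l <= c.
Proof.
move=> ul uc; rewrite -(cvg_lim _ ul)//; apply: limr_le; last exact: nearW.
by apply/cvg_ex; exists l.
Qed.

Lemma cvgn_ge u l c : u @ \oo --> l -> (forall n, c <= u n) -> c <= l.
Proof.
move=> ul uc; rewrite -(cvg_lim _ ul)//; apply: limr_ge; last exact: nearW.
by apply/cvg_ex; exists l.
Qed.

Lemma cvgn_le2 u v l c : u @ \oo --> l -> v @ \oo --> c ->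
  (forall n, u n <= v n) -> l <= c.
Proof.
move=> ul vc uv; rewrite -subr_ge0.
by apply: (@cvgn_ge (fun n => v n - u n)); [exact: cvgB | move=> n; rewrite subr_ge0].
Qed.

Lemma cvgn_sum (I : Type) (r : seq I) (P : pred I) (u : I -> nat -> R) (l : I -> R) :
  (forall i, P i -> u i @ \oo --> l i) ->
  (fun n => \sum_(i <- r | P i) u i n) @ \oo --> \sum_(i <- r | P i) l i.
Proof.
move=> ul; elim: r => [|i r IH].
  under eq_fun do rewrite big_nil.
  by rewrite big_nil; exact: cvg_cst.
rewrite [in X in _ --> X]big_cons.
have [Pi|/negbTE Pi] := boolP (P i); under eq_fun do rewrite big_cons Pi.
  by apply: cvgD => //; exact: ul.
exact: IH.
Qed.

End sequence_limits.

Lemma ruelle_cvg {R : realType} {k : nat} (M : rel 'I_k.+1) (G : Sigma k -> R)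
    (w_ : nat -> Sigma k -> R) w y : SFT M y ->
  (forall x, SFT M x -> w_ ^~ x @ \oo --> w x) ->
  (fun n => ruelle M G (w_ n) y) @ \oo --> ruelle M G w y.
Proof.
move=> Xy hw; apply: cvgn_sum => a Ma; apply: cvgM; [exact: cvg_cst | apply: hw].
exact: SFT_scons.
Qed.

Section gibbs.
Context {R : realType} {k : nat} (M : rel 'I_k.+1) (mu : probability (Sigma k) R).
Local Notation X := (SFT M).
Hypothesis muX : mu X = 1%E.
Hypothesis mu_inv : forall A : set (Sigma k), measurable A ->
  mu (sshift @^-1` A) = mu A.
Context (th : R) (phi : Sigma k -> R) (Fp P K : R).
Hypothesis th01 : 0 < th < 1.
Hypothesis phi_lip : lipX X th Fp phi.
Hypothesis Fp0 : 0 <= Fp.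
Hypothesis K0 : 0 < K.
Hypothesis gibbs : forall x, X x -> forall n, (0 < n)%N ->
  K^-1 * expR (birkhoff phi n x - n%:R * P) <= cylp mu n x /\
  cylp mu n x <= K * expR (birkhoff phi n x - n%:R * P).
Local Notation S := (ruelle M (fun=> 1 : R)).
Local Notation p := (cylp mu).
Implicit Types (x y : Sigma k) (v w : Sigma k -> R).

Definition gibbs_weight x := expR (phi x - P).
Local Notation G0 := gibbs_weight.
Local Notation LL := (ruelle M G0).
Let E n x := expR (birkhoff phi n x - n%:R * P).

Let th0 : 0 < th. Proof. by case/andP: th01. Qed.
Let th1 : th < 1. Proof. by case/andP: th01. Qed.
Let thn n : 0 <= th ^+ n. Proof. by rewrite exprn_ge0// ltW. Qed.

Lemma gibbs_weight_gt0 x : 0 < G0 x. Proof. exact: expR_gt0. Qed.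

Let ES n x : E n.+1 x = E n x * G0 (iter n sshift x).
Proof.
rewrite /E /G0 -expRD -addn1 birkhoffD [birkhoff _ 1 _]/birkhoff big_ord_recl big_ord0.
by congr expR; rewrite natrD /=; ring.
Qed.

Let prodE n x : \prod_(i < n) G0 (iter i sshift x) = E n x.
Proof.
elim: n => [|n IH]; last by rewrite big_ord_recr /= IH ES.
by rewrite big_ord0 /E /birkhoff big_ord0 mul0r subrr expR0.
Qed.

Lemma gibbs_iter n w y : G0 y * iter n LL w y = iter n S (fun x => E n.+1 x * w x) y.
Proof.
rewrite ruelle_iter_weight -ruelle_iter_pull; congr (iter n S _ y); apply/funext => x.
by rewrite prodE ES mulrA; congr (_ * _); rewrite mulrC.
Qed.

Let u n := iter n LL (fun=> 1).

Lemma gibbs_iter1_bounds n y : X y -> K ^- 2 <= u n y <= K ^+ 2.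
Proof.
move=> Xy; have Gy := gibbs_weight_gt0 y.
have E1 : E 1 y = G0 y.
  by rewrite ES /E /birkhoff big_ord0 mul0r subrr expR0 mul1r.
have [l1 l2] := gibbs Xy (ltn0Sn 0).
rewrite -/(E 1 y) E1 in l1 l2.
have s1 : iter n S (fun x => p (n + 1) x) y = p 1 y.
  by apply: (cylinder_sum1 muX mu_inv th01).
have le1 : iter n S (fun x => p (n + 1) x) y <= K * iter n S (fun x => E n.+1 x * 1) y.
  rewrite -ruelle_iterZ; apply: ruelle_iter_le => // x Xx _.
  by rewrite mulr1 addn1; have [] := gibbs Xx (ltn0Sn n).
have le2 : K^-1 * iter n S (fun x => E n.+1 x * 1) y <= iter n S (fun x => p (n + 1) x) y.
  rewrite -ruelle_iterZ; apply: ruelle_iter_le => // x Xx _.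
  by rewrite mulr1 addn1; have [] := gibbs Xx (ltn0Sn n).
rewrite -gibbs_iter s1 in le1 le2.
apply/andP; split.
  rewrite -(ler_pM2l Gy) -(ler_pM2l K0); apply: le_trans le1.
  apply: le_trans l1; rewrite le_eqVlt; apply/orP; left; apply/eqP.
  by field; rewrite gt_eqF.
rewrite -(ler_pM2l Gy) -(ler_pM2l (_ : 0 < K^-1)) ?invr_gt0//.
apply: le_trans le2 _; apply: le_trans l2 _.
rewrite le_eqVlt; apply/orP; left; apply/eqP.
by field; rewrite gt_eqF.
Qed.

Definition log_lipschitz (A : R) w := forall n x y, (0 < n)%N -> X x -> X y ->
  agree n x y -> w x <= expR (A * th ^+ n) * w y.

Let A := Fp * th / (1 - th).
Let A0 : 0 <= A.
Proof. by rewrite divr_ge0 ?mulr_ge0 ?(ltW th0)// subr_ge0 ltW. Qed.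
Let AE : Fp * th + A * th = A.
Proof. by rewrite /A; field; rewrite subr_eq0 eq_sym lt_eqF. Qed.

Lemma gibbs_weight_lip n x y : X x -> X y -> agree n x y ->
  G0 x <= expR (Fp * th ^+ n) * G0 y.
Proof.
move=> Xx Xy xy; rewrite /G0 -expRD ler_expR.
by have := phi_lip Xx Xy xy; have := ler_norm (phi x - phi y); lra.
Qed.

Lemma gibbs_log_lipschitz w : (forall x, X x -> 0 <= w x) ->
  log_lipschitz A w -> log_lipschitz A (LL w).
Proof.
move=> w0 hw n x y n0 Xx Xy xy.
rewrite /ruelle big_distrr /= (xy 0%N n0); apply: ler_sum => a Ma.
have Xax : X (scons a x) by apply: SFT_scons => //; rewrite (xy 0%N n0).
have Xay : X (scons a y) by exact: SFT_scons.
have axy : agree n.+1 (scons a x) (scons a y) by exact: agree_scons.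
have := ler_pM (ltW (gibbs_weight_gt0 _)) (w0 _ Xax)
  (gibbs_weight_lip Xax Xay axy) (hw _ _ _ (ltn0Sn n) Xax Xay axy).
move/le_trans; apply; rewrite mulrACA -expRD.
rewrite !exprS !mulrA -mulrDl AE; exact: lexx.
Qed.

Let uS n y : u n.+1 y = LL (u n) y. Proof. by []. Qed.

Let LLle w v y : X y -> (forall x, X x -> w x <= v x) -> LL w y <= LL v y.
Proof.
move=> Xy wv; apply: (@ruelle_iter_le _ _ _ _ 1) => // x Xx; last by move=> _; exact: wv.
exact: ltW (gibbs_weight_gt0 x).
Qed.

Lemma gibbs_superharmonic : exists v, [/\ forall x, X x -> K ^- 2 <= v x <= K ^+ 2,
  log_lipschitz A v & forall x, X x -> LL v x <= v x].
Proof.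
pose B y m := [set u (m + j)%N y | j in setT].
pose vm m y := inf (B y m).
have B0 y m : B y m !=set0 by exists (u (m + 0)%N y), 0%N.
have Blb y m : X y -> lbound (B y m) (K ^- 2).
  by move=> Xy _ [j _ <-]; have /andP[] := gibbs_iter1_bounds (m + j) Xy.
have vm_le y m j : X y -> vm m y <= u (m + j)%N y.
  by move=> Xy; apply: ge_inf; [exists (K ^- 2); exact: Blb | exists j].
have vm_ge y m c : (forall j, c <= u (m + j)%N y) -> c <= vm m y.
  by move=> h; apply: lb_le_inf => // _ [j _ <-].
have vm_bd y m : X y -> K ^- 2 <= vm m y <= K ^+ 2.
  move=> Xy; apply/andP; split; first by apply: lb_le_inf => //; exact: Blb.
  apply: le_trans (vm_le y m 0%N Xy) _.
  by have /andP[] := gibbs_iter1_bounds (m + 0) Xy.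
have vm_mono y : X y -> {homo (vm ^~ y) : m n / (m <= n)%N >-> m <= n}.
  move=> Xy m n mn; apply: vm_ge => j; rewrite -(subnKC mn) -addnA; exact: vm_le.
pose v y := sup (range (vm ^~ y)).
have vmv y : X y -> vm ^~ y @ \oo --> v y.
  move=> Xy; apply: nondecreasing_cvgn; first exact: vm_mono.
  by exists (K ^+ 2) => _ [m _ <-]; have /andP[] := vm_bd y m Xy.
exists v; split.
- move=> x Xx; apply/andP; split.
    by apply: (cvgn_ge (vmv x Xx)) => m; have /andP[] := vm_bd x m Xx.
  by apply: (cvgn_le (vmv x Xx)) => m; have /andP[] := vm_bd x m Xx.
- have ulog n : log_lipschitz A (u n).
    elim: n => [|n IH].
      move=> n x y _ _ _ _; rewrite /u /= mulr1 -(expR0 R) ler_expR mulr_ge0//.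
    apply: gibbs_log_lipschitz => // x Xx.
    have /andP[h _] := gibbs_iter1_bounds n Xx; apply: le_trans h.
    by rewrite invr_ge0 exprn_ge0// ltW.
  move=> n x y n0 Xx Xy xy.
  have vc : (fun m => expR (A * th ^+ n) * vm m y) @ \oo --> expR (A * th ^+ n) * v y.
    by apply: cvgM; [exact: cvg_cst | exact: vmv].
  apply: (cvgn_le2 (vmv x Xx) vc) => m.
  rewrite mulrC -ler_pdivrMr ?expR_gt0//; apply: vm_ge => j.
  rewrite ler_pdivrMr ?expR_gt0// mulrC.
  by apply: le_trans (vm_le x m j Xx) _; exact: ulog.
- move=> x Xx; have h1 : (fun m => LL (vm m) x) @ \oo --> LL v x.
    exact: (ruelle_cvg Xx (fun z Xz => vmv z Xz)).
  have h2 : (fun m => vm m.+1 x) @ \oo --> v x.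
    by have := vmv x Xx; rewrite -(cvg_shiftS (vm ^~ x)).
  apply: (cvgn_le2 h1 h2) => m; apply: vm_ge => j.
  rewrite addSn uS; apply: LLle => // z Xz; exact: vm_le.
Qed.

Lemma gibbs_eigenfunction : exists h, [/\ forall x, X x -> K ^- 4 <= h x <= K ^+ 2,
  log_lipschitz A h & forall x, X x -> LL h x = h x].
Proof.
have [v [vb vlog vsup]] := gibbs_superharmonic.
pose w n := iter n LL v.
have w_dec n x : X x -> w n.+1 x <= w n x.
  elim: n x => [|n IH] x Xx; first exact: vsup.
  by rewrite /w !iterS; apply: LLle => // z Xz; exact: IH.
have w_ub n x : X x -> w n x <= K ^+ 2.
  elim: n => [|n IH] Xx; first by have /andP[] := vb x Xx.
  exact: le_trans (w_dec n x Xx) (IH Xx).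
have w_lb n x : X x -> K ^- 4 <= w n x.
  move=> Xx; have -> : K ^- 4 = K ^- 2 * K ^- 2 by rewrite -invfM -exprD.
  apply: le_trans (_ : K ^- 2 * u n x <= _).
    rewrite ler_wpM2l ?invr_ge0 ?exprn_ge0 ?(ltW K0)//.
    by have /andP[] := gibbs_iter1_bounds n Xx.
  rewrite /u -ruelle_iterZ; apply: ruelle_iter_le => // z Xz.
    exact: ltW (gibbs_weight_gt0 z).
  by move=> _; rewrite mulr1; have /andP[] := vb z Xz.
pose h x := inf (range (w ^~ x)).
have wh x : X x -> w ^~ x @ \oo --> h x.
  move=> Xx; apply: nonincreasing_cvgn.
    by apply/nonincreasing_seqP => n; exact: w_dec.
  by exists (K ^- 4) => _ [n _ <-]; exact: w_lb.
exists h; split.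
- move=> x Xx; apply/andP; split.
    by apply: (cvgn_ge (wh x Xx)) => n; exact: w_lb.
  by apply: (cvgn_le (wh x Xx)) => n; exact: w_ub.
- have wlog_ n : log_lipschitz A (w n).
    elim: n => [//|n IH]; apply: gibbs_log_lipschitz => // x Xx.
    by apply: le_trans (w_lb n x Xx); rewrite invr_ge0 exprn_ge0// ltW.
  move=> n x y n0 Xx Xy xy.
  have hc : (fun m => expR (A * th ^+ n) * w m y) @ \oo --> expR (A * th ^+ n) * h y.
    by apply: cvgM; [exact: cvg_cst | exact: wh].
  by apply: (cvgn_le2 (wh x Xx) hc) => m; exact: wlog_.
- move=> x Xx; have h1 : (fun m => LL (w m) x) @ \oo --> LL h x.
    exact: (ruelle_cvg Xx wh).
  have h2 : (fun m => w m.+1 x) @ \oo --> h x.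
    by have := wh x Xx; rewrite -(cvg_shiftS (w ^~ x)).
  exact: cvg_unique h1 h2.
Qed.

End gibbs.

Section gibbs_normalized.
Context {R : realType} {k : nat} (M : rel 'I_k.+1) (mu : probability (Sigma k) R).
Local Notation X := (SFT M).
Hypothesis muX : mu X = 1%E.
Hypothesis mu_inv : forall A : set (Sigma k), measurable A ->
  mu (sshift @^-1` A) = mu A.
Context (th : R) (phi : Sigma k -> R) (Fp P K : R).
Hypothesis th01 : 0 < th < 1.
Hypothesis phi_lip : lipX X th Fp phi.
Hypothesis Fp0 : 0 <= Fp.
Hypothesis K0 : 0 < K.
Hypothesis gibbs : forall x, X x -> forall n, (0 < n)%N ->
  K^-1 * expR (birkhoff phi n x - n%:R * P) <= cylp mu n x /\
  cylp mu n x <= K * expR (birkhoff phi n x - n%:R * P).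
Hypothesis mix : topologically_mixing X.
Local Notation S := (ruelle M (fun=> 1 : R)).
Local Notation p := (cylp mu).
Local Notation G0 := (gibbs_weight phi P).
Local Notation LL := (ruelle M G0).
Implicit Types (x y : Sigma k) (v w : Sigma k -> R).

Let th0 : 0 < th. Proof. by case/andP: th01. Qed.
Let th1 : th < 1. Proof. by case/andP: th01. Qed.
Let thn n : 0 <= th ^+ n. Proof. by rewrite exprn_ge0// ltW. Qed.

Lemma gibbs_normalized_weight : exists (g : Sigma k -> R) (q A C : R),
  [/\ normalized_weight M g q th A, 0 <= C & forall n v y, X y ->
    (forall x, X x -> 0 <= v x) ->
    iter n S (fun x => p (n + 1) x * v x) y <= C * iter n (ruelle M g) v y].
Proof.
have [h [hb hlog hE]] := gibbs_eigenfunction muX mu_inv th01 phi_lip Fp0 K0 gibbs.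
set A := Fp * th / (1 - th) in hlog.
have A0 : 0 <= A by rewrite divr_ge0 ?mulr_ge0 ?(ltW th0)// subr_ge0 ltW.
have Kn n : 0 < K ^- n by rewrite invr_gt0 exprn_gt0.
have h0 x : X x -> 0 < h x.
  by move=> Xx; have /andP[h1 _] := hb x Xx; exact: lt_le_trans (Kn 4) h1.
have [Bp Bp0 hBp] := lipX_bounded phi_lip.
pose Gmax := expR (Bp - P); pose Gmin := expR (- Bp - P).
have Gle x : X x -> G0 x <= Gmax.
  by move=> Xx; rewrite ler_expR lerD2r; apply: le_trans (ler_norm _) (hBp x Xx).
have Gge x : X x -> Gmin <= G0 x.
  by move=> Xx; rewrite ler_expR lerD2r lerNl; apply: le_trans (hBp x Xx); rewrite -normrN ler_norm.
have G0p x : 0 < G0 x by exact: gibbs_weight_gt0.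
pose g x := G0 x * h x / h (sshift x).
have conj n v y : X y -> iter n (ruelle M g) v y = (h y)^-1 * iter n LL (fun x => h x * v x) y.
  elim: n y => [|n IH] y Xy; first by rewrite /= mulKf// gt_eqF// h0.
  rewrite !iterS /ruelle big_distrr /=; apply: eq_bigr => a Ma.
  have Xa : X (scons a y) by exact: SFT_scons.
  rewrite IH// /g sshift_scons; field.
  by rewrite !gt_eqF ?h0.
pose A2 := Fp + 2 * A.
have A20 : 0 <= A2 by rewrite addr_ge0// mulr_ge0.
have glog n x y a : (0 < n)%N -> X x -> X y -> agree n x y -> M a (x 0%N) ->
    g (scons a x) <= expR (A2 * th ^+ n) * g (scons a y).
  move=> n0 Xx Xy xy Ma.
  have Xax : X (scons a x) by exact: SFT_scons.
  have Xay : X (scons a y) by apply: SFT_scons => //; rewrite -(xy 0%N n0).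
  have axy : agree n.+1 (scons a x) (scons a y) by exact: agree_scons.
  have le1 := gibbs_weight_lip P phi_lip Xax Xay axy.
  have le2 := hlog _ _ _ (ltn0Sn n) Xax Xay axy.
  have le3 := hlog _ _ _ n0 Xy Xx (agree_sym xy).
  have thS : th ^+ n.+1 <= th ^+ n by rewrite ler_wiXn2l// ltW.
  rewrite /g !sshift_scons ler_pdivrMr ?h0//.
  have le12 := ler_pM (ltW (G0p _)) (ltW (h0 _ Xax)) le1 le2.
  apply: le_trans le12 _.
  have -> : expR (A2 * th ^+ n) = expR (Fp * th ^+ n) * expR (A * th ^+ n) * expR (A * th ^+ n).
    by rewrite -!expRD; congr expR; rewrite /A2; ring.
  have e1 : expR (Fp * th ^+ n.+1) <= expR (Fp * th ^+ n) by rewrite ler_expR ler_wpM2l.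
  have e2 : expR (A * th ^+ n.+1) <= expR (A * th ^+ n) by rewrite ler_expR ler_wpM2l.
  have e12 := ler_pM (expR_ge0 _) (expR_ge0 _) e1 e2.
  have pos : 0 <= G0 (scons a y) * h (scons a y) by rewrite mulr_ge0 ?(ltW (G0p _)) ?(ltW (h0 _ Xay)).
  have le4 : 1 <= expR (A * th ^+ n) / h y * h x.
    by rewrite mulrAC ler_pdivlMr ?h0// mul1r.
  have := ler_pM (mulr_ge0 (expR_ge0 _) (expR_ge0 _)) pos e12 (lexx _).
  rewrite mulrACA => /le_trans; apply.
  have pos2 : 0 <= expR (Fp * th ^+ n) * expR (A * th ^+ n) * (G0 (scons a y) * h (scons a y)).
    by rewrite mulr_ge0// mulr_ge0// expR_ge0.
  have := ler_wpM2l pos2 le4; rewrite mulr1 => /le_trans; apply.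
  by rewrite le_eqVlt; apply/orP; left; apply/eqP; ring.
have g0 x : X x -> 0 < g x.
  by move=> Xx; rewrite /g divr_gt0 ?mulr_gt0 ?h0//; exact: SFT_sshift.
have gsum y : X y -> \sum_(a | M a (y 0%N)) g (scons a y) = 1.
  move=> Xy; rewrite /g; under eq_bigr do rewrite sshift_scons.
  have := hE y Xy; rewrite -big_distrl /= /ruelle => ->.
  by rewrite divff// gt_eqF// h0.
exists g, (Num.min 1 (Gmin * K ^- 4 / K ^+ 2)), (2 * (A2 * expR A2)), (K ^+ 7 * Gmax); split.
- split=> //.
  + rewrite lt_min ltr01 ge_min lexx /= andbT.
    by rewrite divr_gt0 ?exprn_gt0// mulr_gt0 ?expR_gt0.
  + move=> x Xx; rewrite ge_min; apply/orP; right; rewrite /g.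
    have Xs := SFT_sshift Xx.
    have /andP[h1 h2] := hb x Xx; have /andP[h3 h4] := hb _ Xs.
    apply: ler_pM.
    * by rewrite mulr_ge0 ?expR_ge0 ?(ltW (Kn 4)).
    * by rewrite invr_ge0 exprn_ge0// ltW.
    * by apply: ler_pM => //; rewrite ?expR_ge0 ?(ltW (Kn 4)) ?Gge.
    * by rewrite lef_pV2// posrE ?exprn_gt0// h0.
  + move=> n x y n0 Xx Xy xy.
    set t := A2 * th ^+ n.
    have t0 : 0 <= t by rewrite mulr_ge0.
    have et : expR t - 1 <= A2 * expR A2 * th ^+ n.
      have e1 : expR t - 1 <= t * expR t.
        have := expR_ge1Dx (- t); rewrite -(ler_pM2r (expR_gt0 t)) -expRD addNr expR0.
        lra.
      apply: le_trans e1 _; rewrite [leRHS]mulrAC ler_wpM2l// ler_expR.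
      by rewrite ler_piMr// exprn_ile1// ltW.
    have et0 : 0 <= expR t - 1 by rewrite subr_ge0 -(expR0 R) ler_expR.
    have Ma' a : M a (x 0%N) -> M a (y 0%N) by rewrite (xy 0%N n0).
    have gd a : M a (x 0%N) -> `|g (scons a x) - g (scons a y)| <=
        (expR t - 1) * (g (scons a x) + g (scons a y)).
      move=> Ma.
      have u1 := glog n x y a n0 Xx Xy xy Ma.
      have u2 := glog n y x a n0 Xy Xx (agree_sym xy) (Ma' a Ma).
      rewrite -/t in u1 u2.
      have gx := ltW (g0 _ (SFT_scons Xx Ma)).
      have gy := ltW (g0 _ (SFT_scons Xy (Ma' a Ma))).
      have gx' := mulr_ge0 et0 gx; have gy' := mulr_ge0 et0 gy.
      rewrite ler_norml; apply/andP; split; lra.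
    apply: le_trans (ler_sum _ gd) _.
    rewrite -big_distrr /= big_split /= gsum// (xy 0%N n0) gsum//.
    by move: et; lra.
  + by rewrite mulr_ge0// mulr_ge0// expR_ge0.
- by rewrite mulr_ge0 ?expR_ge0// exprn_ge0// ltW.
- move=> n v y Xy v0.
  have /andP[h1 h2] := hb y Xy.
  have LL0 : 0 <= iter n LL (fun x => h x * v x) y.
    have -> : 0 = iter n LL (fun x => 0 * 0) y :> R by rewrite ruelle_iterZ mul0r.
    apply: ruelle_iter_le => // [x _|x Xx _]; first exact: ltW.
    by rewrite mul0r mulr_ge0 ?(ltW (h0 x Xx)) ?v0.
  apply: le_trans (_ : K * (G0 y * iter n LL v y) <= _).
    rewrite gibbs_iter -ruelle_iterZ; apply: ruelle_iter_le => // x Xx _.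
    rewrite mulrA ler_wpM2r ?v0// addn1.
    by have [] := gibbs Xx (ltn0Sn n).
  have le1 : iter n LL v y <= K ^+ 4 * iter n LL (fun x => h x * v x) y.
    rewrite -ruelle_iterZ; apply: ruelle_iter_le => // [x _|x Xx _]; first exact: ltW.
    rewrite mulrA ler_peMl ?v0// mulrC -ler_pdivrMr ?exprn_gt0// mul1r.
    by have /andP[] := hb x Xx.
  rewrite conj//.
  have -> : K ^+ 7 * Gmax * ((h y)^-1 * iter n LL (fun x => h x * v x) y) =
     K * (Gmax * (K ^+ 4 * (K ^+ 2 / h y * iter n LL (fun x => h x * v x) y))) by ring.
  rewrite ler_pM2l//; apply: ler_pM; rewrite ?(ltW (G0p _)) ?Gle//.
    have -> : 0 = iter n LL (fun x => 0 * 0) y :> R by rewrite ruelle_iterZ mul0r.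
    apply: ruelle_iter_le => // [x _|x Xx _]; first exact: ltW.
    by rewrite mul0r v0.
  apply: le_trans le1 _; rewrite ler_wpM2l ?exprn_ge0 ?(ltW K0)//.
  by rewrite ler_peMl// ler_pdivlMr ?h0// mul1r.
Qed.

End gibbs_normalized.

Section lipschitz_algebra.
Context {R : realType} {k : nat} (X : set (Sigma k)) (th : R).
Hypothesis th01 : 0 < th < 1.
Implicit Types (x y : Sigma k) (v w : Sigma k -> R) (U V B : R).

Let thn n : 0 <= th ^+ n.
Proof. by case/andP: th01 => th0 _; rewrite exprn_ge0// ltW. Qed.

Lemma lipX_add U V v w : lipX X th U v -> lipX X th V w ->
  lipX X th (U + V) (fun x => v x + w x).
Proof.
move=> hv hw n x y Xx Xy xy; rewrite opprD addrACA mulrDl.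
by apply: le_trans (ler_normD _ _) _; apply: lerD; [exact: hv | exact: hw].
Qed.

Lemma lipX_sub U V v w : lipX X th U v -> lipX X th V w ->
  lipX X th (U + V) (fun x => v x - w x).
Proof.
move=> hv hw; apply: lipX_add => // n x y Xx Xy xy.
by rewrite -opprD normrN; exact: hw.
Qed.

Lemma lipX_sum (n : nat) (V : nat -> R) (w : nat -> Sigma k -> R) :
  (forall i, lipX X th (V i) (w i)) ->
  lipX X th (\sum_(i < n) V i) (fun x => \sum_(i < n) w i x).
Proof.
move=> hw m x y Xx Xy xy; rewrite -sumrB big_distrl /=.
by apply: le_trans (ler_norm_sum _ _ _) _; apply: ler_sum => i _; exact: hw.
Qed.

Lemma lipX_mul U V A B v w : 0 <= U -> 0 <= V ->
  (forall x, X x -> `|v x| <= A) -> (forall x, X x -> `|w x| <= B) ->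
  lipX X th U v -> lipX X th V w -> lipX X th (A * V + U * B) (fun x => v x * w x).
Proof.
move=> U0 V0 hA hB hv hw n x y Xx Xy xy.
have -> : v x * w x - v y * w y = v x * (w x - w y) + (v x - v y) * w y by ring.
apply: le_trans (ler_normD _ _) _; rewrite !normrM mulrDl; apply: lerD.
  by rewrite -mulrA; apply: ler_pM => //; [exact: hA | exact: hw].
by rewrite mulrAC; apply: ler_pM => //; [exact: hv | exact: hB].
Qed.

Lemma lipX_agree n w B : 0 <= B -> (forall x, X x -> `|w x| <= B) ->
  (forall x y, agree n x y -> w x = w y) ->
  lipX X th (2 * B / th ^+ n) w.
Proof.
have [th0 th1] := andP th01.
move=> B0 hB hw m x y Xx Xy xy; have [nm|mn] := leqP n m.
  rewrite (hw x y) ?subrr ?normr0 ?mulr_ge0 ?invr_ge0//.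
  exact: agree_le xy.
apply: le_trans (_ : 2 * B <= _).
  by apply: le_trans (ler_normB _ _) _; have := hB x Xx; have := hB y Xy; lra.
rewrite -mulrA ler_peMr ?mulr_ge0// mulrC ler_pdivlMr ?exprn_gt0// mul1r.
by rewrite ler_wiXn2l ?(ltW th0) ?(ltW th1) ?(ltnW mn).
Qed.

End lipschitz_algebra.

Section transfer_invariance.
Context {R : realType} {k : nat} (M : rel 'I_k.+1) (mu : probability (Sigma k) R).
Local Notation X := (SFT M).
Hypothesis muX : mu X = 1%E.
Hypothesis mu_inv : forall A : set (Sigma k), measurable A ->
  mu (sshift @^-1` A) = mu A.
Context (g : Sigma k -> R) (q th A C : R).
Hypothesis NW : normalized_weight M g q th A.
Local Notation L := (ruelle M g).
Hypothesis C0 : 0 <= C.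
Hypothesis dominated : forall n (v : Sigma k -> R) y, X y -> (forall x, X x -> 0 <= v x) ->
  iter n (ruelle M (fun=> 1)) (fun x => cylp mu (n + 1) x * v x) y <= C * iter n L v y.
Implicit Types (x y : Sigma k) (v w : Sigma k -> R) (V B U : R).

Let th01 := nw_th NW.
Let th0 : 0 < th. Proof. by case/andP: th01. Qed.
Let th1 : th < 1. Proof. by case/andP: th01. Qed.
Let thn n : 0 <= th ^+ n. Proof. by rewrite exprn_ge0// ltW. Qed.
Let mX : measurable X := measurable_SFT M.
Let m_lip V w : lipX X th V w -> measurable_fun X w.
Proof. by apply: measurable_lipX; rewrite ltW. Qed.

Lemma lipX_ruelle V w : 0 <= V -> lipX X th V w -> lipX X th (V + (th * V + A * V)) (L w).
Proof.
move=> V0 hw [|n] x y Xx Xy xy.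
  rewrite expr0 mulr1; apply: le_trans (_ : V <= _).
    exact: (oscX_norm (normalized_osc NW 1 (lipX_osc hw)) Xx Xy).
  by rewrite lerDl addr_ge0// mulr_ge0 ?(ltW th0) ?(nw_A NW).
have := ruelle_lip1 NW V0 (lipX_osc hw) (fun n x y _ => @hw n x y).
move=> /(_ n.+1 x y isT Xx Xy xy) /le_trans; apply.
by rewrite ler_wpM2r// lerDr.
Qed.

Let muXC : mu (~` X) = 0%E.
Proof. by rewrite probability_setC// muX subee. Qed.

Lemma Rintegral_full w B : measurable_fun setT w -> (forall x, `|w x| <= B) ->
  \int[mu]_x w x = \int[mu]_(x in X) w x.
Proof.
move=> mw wB; rewrite -[in LHS](setUv X) Rintegral_setU//.
- have mXC : measurable (~` X) by exact: measurableC.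
  have mwC : measurable_fun (~` X) w by exact: measurable_funTS.
  have h : `|\int[mu]_(x in ~` X) w x| <= B * fine (mu (~` X)).
    exact: bounded_Rintegral_norm (fun x _ => wB x).
  by move: h; rewrite muXC /= mulr0 normr_le0 => /eqP ->; rewrite addr0.
- exact: measurableC.
- rewrite setUv; apply: (@bounded_integrable _ _ _ mu setT measurableT w B) => // x _; exact: wB.
- by rewrite disj_set2E setICr eqxx.
Qed.

Lemma Rintegral_sshift w B : measurable_fun X w -> (forall x, X x -> `|w x| <= B) ->
  \int[mu]_(x in X) w (sshift x) = \int[mu]_(x in X) w x.
Proof.
move=> mw wB.
pose w' : Sigma k -> R := w \_ X.
have mw' : measurable_fun setT w' by apply/(measurable_restrictT w mX).
have w'B x : `|w' x| <= `|B|.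
  rewrite /w' patchE; case: ifPn => [|_]; last by rewrite normr0.
  by rewrite inE => /wB /le_trans; apply; exact: ler_norm.
have mw's : measurable_fun [set: Sigma k] (fun x : Sigma k => w' (sshift x)).
  exact: measurableT_comp mw' measurable_sshift.
transitivity (\int[mu]_x w' (sshift x)).
  rewrite (Rintegral_full mw's (fun x => w'B _)).
  apply: eq_Rintegral => x; rewrite inE => Xx /=.
  by rewrite /w' patchE mem_set//; exact: SFT_sshift.
rewrite [RHS]Rintegral_mkcond -/w' /Rintegral; congr fine.
have := @integral_pushforward _ _ _ _ R _ (@measurable_sshift k) mu setT (EFin \o w')
  ((measurable_EFinP _ _).2 mw') _ measurableT.
rewrite preimage_setT => <-.
  apply: eq_measure_integral; first exact: measurable_sshift.
  by move=> h Y mY _; exact: mu_inv.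
by apply: (@bounded_integrable _ _ _ mu setT measurableT _ `|B|) => // x _; exact: w'B.
Qed.

Lemma Rintegral_cst_SFT (r : R) : \int[mu]_(x in X) r = r.
Proof.
rewrite Rintegral_cst//; transitivity (r * fine (1%E : \bar R)); last by rewrite mulr1.
by congr (_ * fine _); exact: muX.
Qed.

Lemma dominated_integral v V U n : lipX X th V v -> 0 <= V -> (forall x, X x -> 0 <= v x) ->
  (forall y, X y -> iter n L v y <= U) -> 0 <= U ->
  \int[mu]_(x in X) v x <= k.+1%:R * (C * U + V * th ^+ n.+1).
Proof.
move=> hv V0 v0 hU U0.
have [B B0 vB] := lipX_bounded hv.
pose H b := [set x : Sigma k | x n = b].
have mH b : measurable (H b).
  by apply: (@measurable_of_agree _ n.+1) => x y xy; rewrite /H /= xy.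
have mi b : measurable_fun X (fun x => v x * \1_(H b) x).
  apply: measurable_funM; first exact: m_lip hv.
  by apply: measurable_funTS; apply: measurable_indic.
have partE x : X x -> v x = \sum_b v x * \1_(H b) x.
  move=> Xx; rewrite (bigD1 (x n))//= indicE mem_set// mulr1.
  rewrite big1 ?addr0// => b bn; rewrite indicE memNset ?mulr0// => xb.
  by move: bn; rewrite -xb eqxx.
have -> : \int[mu]_(x in X) v x = \sum_b \int[mu]_(x in X) (v x * \1_(H b) x).
  rewrite -(@bounded_Rintegral_sum _ _ _ mu X _ _ _ _ (fun=> B))//.
    by apply: eq_Rintegral => x; rewrite inE => Xx; rewrite {1}partE.
  move=> b x _ Xx; rewrite normrM -[leRHS]mulr1; apply: ler_pM => //; first exact: vB.
  by rewrite indicE; case: (_ \in _); rewrite ?normr1 ?normr0.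
have -> : k.+1%:R * (C * U + V * th ^+ n.+1) = \sum_(b < k.+1) (C * U + V * th ^+ n.+1).
  by rewrite sumr_const card_ord mulr_natl.
apply: ler_sum => b _.
have rhs0 : 0 <= C * U + V * th ^+ n.+1 by rewrite addr_ge0// mulr_ge0.
have [[y [Xy yb]]|no] := pselect (exists y, X y /\ y 0%N = b); last first.
  rewrite (_ : \int[mu]_(x in X) _ = 0)//.
  rewrite -[RHS](_ : \int[mu]_(x in X) 0 = 0); last by rewrite Rintegral_cst// mul0r.
  apply: eq_Rintegral => x; rewrite inE => Xx.
  rewrite indicE memNset ?mulr0// => xb; apply: no; exists (iter n sshift x).
  by split; [exact: SFT_iter | rewrite iter_sshiftE addn0].
have HE : H b = hits n y 1.
  apply/seteqP; split => x /=; rewrite /H /hits /= => h.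
    by move=> [|//] _; rewrite iter_sshiftE addn0 yb.
  by have := h 0%N isT; rewrite iter_sshiftE addn0 yb.
have := cylinder_sum muX th01 n hv (ltn0Sn 0) Xy.
rewrite -HE addn1 => h1.
have h2 := dominated n Xy v0; rewrite addn1 in h2.
have h3 : C * iter n L v y <= C * U by rewrite ler_wpM2l// hU.
have h4 : V * th ^+ n.+1 * fine (mu (H b)) <= V * th ^+ n.+1.
  rewrite ler_piMr ?mulr_ge0// -lee_fin fineK ?fin_num_measure//.
  exact: probability_le1.
move: h1; rewrite ler_norml => /andP[h1 _]; lra.
Qed.

Lemma integral_of_ruelle_null V m : 0 <= V -> lipX X th V m ->
  (forall x, X x -> L m x = 0) -> \int[mu]_(x in X) m x = 0.
Proof.
move=> V0 hm Lm0.
have [B B0 mB] := lipX_bounded hm.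
pose s N x := \sum_(i < N) m (iter i sshift x).
have sB N x : X x -> `|s N x| <= N%:R * B.
  move=> Xx; apply: le_trans (ler_norm_sum _ _ _) _.
  apply: le_trans (ler_sum _ (fun (i : 'I_N) _ => mB _ (SFT_iter i Xx))) _.
  by rewrite sumr_const card_ord mulr_natl.
have sLip N : exists2 W, 0 <= W & lipX X th W (s N).
  exists (\sum_(i < N) V / th ^+ i).
    by rewrite sumr_ge0// => i _; rewrite divr_ge0.
  by apply: (@lipX_sum _ _ _ _ _ (fun i => V / th ^+ i) (fun i x => m (iter i sshift x))) => i;
    exact: lipX_iter_sshift.
have sS N x : s N.+1 x = m x + s N (sshift x).
  by rewrite /s big_ord_recl /=; congr (_ + _); apply: eq_bigr => i _; rewrite -iterS iterSr.
have key N n y : (N <= n)%N -> X y -> iter n L (fun x => s N x ^+ 2) y <= N%:R * B ^+ 2.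
  elim: N n y => [|N IH] n y Nn Xy.
    rewrite mul0r; apply: (normalized_le NW) => // x _ _.
    by rewrite /s big_ord0 expr0n.
  case: n Nn => // n Nn; rewrite iterSr.
  apply: le_trans (_ : iter n L (fun z => B ^+ 2 + s N z ^+ 2) y <= _); last first.
    rewrite ruelle_iterD -natr1 mulrDl mul1r addrC; apply: lerD; first exact: IH.
    by rewrite (normalized_cst NW).
  apply: ruelle_iter_le => // [x Xx|x Xx _].
    by apply: le_trans (nw_ge NW Xx); case/andP: (nw_q NW) => /ltW.
  have -> : L (fun z => s N.+1 z ^+ 2) x =
     L (fun z => m z ^+ 2) x + 2 * s N x * L m x + s N x ^+ 2 * L (fun=> 1) x.
    rewrite /ruelle [X in _ = _ + X + _]big_distrr [X in _ = _ + X]big_distrr /=.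
    rewrite -!big_split /=; apply: eq_bigr => a _.
    by rewrite sS sshift_scons; ring.
  have L1 : L (fun=> 1) x = 1 := normalized_cst NW 1 1 Xx.
  rewrite Lm0// mulr0 addr0 L1 mulr1 lerD2r.
  apply: (normalized_le NW (n := 1)) => // z Xz _.
  by rewrite -real_normK ?num_real// lerXn2r ?nnegrE// mB.
have mm : measurable_fun X m by exact: m_lip hm.
have ms N : measurable_fun X (s N) by have [W _ /m_lip] := sLip N.
pose I := \int[mu]_(x in X) m x.
have sI N : \int[mu]_(x in X) s N x = N%:R * I.
  elim: N => [|N IH].
    by rewrite mul0r /s; under eq_Rintegral do rewrite big_ord0; rewrite Rintegral_cst// mul0r.
  under eq_Rintegral do rewrite sS.
  rewrite RintegralD//.
  - by rewrite (Rintegral_sshift (ms N) (sB N)) IH -natr1 mulrDl mul1r addrC.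
  - exact: (bounded_integrable mu mX mm mB).
  - have mss : measurable_fun X (fun x => s N (sshift x)).
      have [W W0 hW] := sLip N; have := lipX_iter_sshift (M := M) th01 1 W0 hW.
      exact: m_lip.
    by apply: (bounded_integrable mu mX mss) => x Xx; apply: sB; exact: SFT_sshift.
have sq N : (N%:R * I) ^+ 2 <= \int[mu]_(x in X) s N x ^+ 2.
  set c := N%:R * I.
  have i1 := bounded_integrable mu mX (ms N) (sB N).
  have msq : measurable_fun X (fun x => s N x ^+ 2) by apply: measurable_funX.
  have i2 : mu.-integrable X (EFin \o (fun x => s N x ^+ 2)).
    apply: (bounded_integrable mu (B := (N%:R * B) ^+ 2) mX msq) => x Xx.
    by rewrite normrX lerXn2r ?nnegrE ?mulr_ge0// sB.
  have ic : mu.-integrable X (EFin \o (fun=> c ^+ 2)).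
    exact: (bounded_integrable mu (B := `|c ^+ 2|) mX).
  have : 0 <= \int[mu]_(x in X) (s N x - c) ^+ 2.
    by apply: Rintegral_ge0 => x _; exact: sqr_ge0.
  have -> : \int[mu]_(x in X) (s N x - c) ^+ 2 =
     \int[mu]_(x in X) (s N x ^+ 2 + (c ^+ 2 - (2 * c) * s N x)).
    by apply: eq_Rintegral => x _; ring.
  have i3 : mu.-integrable X (EFin \o (fun x => (2 * c) * s N x)).
    have -> : EFin \o (fun x => (2 * c) * s N x) = (fun x => (2 * c)%:E * (EFin \o s N) x)%E by [].
    exact: integrableZl.
  have i4 : mu.-integrable X (EFin \o (fun x => c ^+ 2 - (2 * c) * s N x)).
    exact: (integrableB mX ic i3).
  rewrite RintegralD// RintegralB// Rintegral_cst_SFT RintegralZl// sI.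
  rewrite -/c; lra.
have fin N : (N%:R * I) ^+ 2 <= k.+1%:R * (C * (N%:R * B ^+ 2)).
  apply: le_trans (sq N) _.
  have [W W0 hW] := sLip N.
  pose V2 := N%:R * B * W + W * (N%:R * B).
  have V20 : 0 <= V2 by rewrite addr_ge0// mulr_ge0// mulr_ge0.
  have h2 : lipX X th V2 (fun x => s N x ^+ 2).
    by apply: lipX_mul => //; exact: sB.
  apply: (@cvgn_ge _ (fun n => k.+1%:R * (C * (N%:R * B ^+ 2) + V2 * th ^+ (n + N).+1))) => [|n].
    rewrite -[in X in _ --> X](addr0 (C * _)); apply: cvgM; first exact: cvg_cst.
    apply: cvgD; first exact: cvg_cst.
    rewrite -[X in _ --> X](mulr0 V2); apply: cvgM; first exact: cvg_cst.
    have : (fun n => th ^+ n) @ \oo --> (0 : R).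
      by apply: cvg_expr; rewrite ger0_norm ?(ltW th0).
    by rewrite -(cvg_shiftn N.+1) => h; under eq_fun do rewrite -addnS.
  apply: dominated_integral => //.
  - by move=> x _; exact: sqr_ge0.
  - by move=> y Xy; apply: key => //; exact: leq_addl.
  - by rewrite mulr_ge0// sqr_ge0.
have I2 : I ^+ 2 = 0.
  apply/eqP; rewrite eq_le sqr_ge0 andbT.
  apply: (@cvgn_ge _ (fun N => k.+1%:R * (C * B ^+ 2) * (N.+1%:R)^-1)) => [|N].
    rewrite -[X in _ --> X](mulr0 (k.+1%:R * (C * B ^+ 2))); apply: cvgM; first exact: cvg_cst.
    exact: cvg_harmonic.
  have := fin N.+1; rewrite exprMn expr2 -mulrA.
  have N0 : 0 < (N.+1%:R : R) by rewrite ltr0n.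
  rewrite ler_pdivlMr// => h.
  rewrite -(ler_pM2l N0); move: h; lra.
by apply/eqP; rewrite -sqrf_eq0; apply/eqP.
Qed.

(* The function [m = w - (L w) o sigma] satisfies [L m = 0], hence its Birkhoff
   sums have [int (S_N m)^2 = O(N)]; by invariance [int S_N m = N int m], so
   [int m = 0]. *)
Lemma transfer_invariant_lip V w : 0 <= V -> lipX X th V w ->
  \int[mu]_(x in X) L w x = \int[mu]_(x in X) w x.
Proof.
move=> V0 hw; have hL := lipX_ruelle V0 hw.
set VL := V + _ in hL.
have VL0 : 0 <= VL by rewrite /VL addr_ge0// addr_ge0// mulr_ge0 ?(ltW th0) ?(nw_A NW).
have hLs : lipX X th (VL / th ^+ 1) (fun x => L w (sshift x)).
  exact: (lipX_iter_sshift (M := M) th01 1 VL0 hL).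
have [B B0 wB] := lipX_bounded hw; have [D D0 LD] := lipX_bounded hL.
have := @integral_of_ruelle_null (V + VL / th ^+ 1) (fun x => w x - L w (sshift x)).
rewrite RintegralB//.
- rewrite (Rintegral_sshift (m_lip hL) LD) => h; apply/esym/subr0_eq/h.
  + by rewrite addr_ge0// divr_ge0.
  + exact: lipX_sub.
  + move=> x Xx; rewrite /ruelle; under eq_bigr do rewrite sshift_scons mulrBr.
    rewrite sumrB -/(L w x) -big_distrl /= (nw_sum NW Xx) mul1r subrr//.
- exact: (bounded_integrable mu mX (m_lip hw) wB).
- apply: (bounded_integrable mu mX (m_lip hLs)) => x Xx.
  by apply: LD; exact: SFT_sshift.
Qed.

End transfer_invariance.

Section transfer_bounded.
Context {R : realType} {k : nat} (M : rel 'I_k.+1) (mu : probability (Sigma k) R).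
Local Notation X := (SFT M).
Hypothesis muX : mu X = 1%E.
Hypothesis mu_inv : forall A : set (Sigma k), measurable A ->
  mu (sshift @^-1` A) = mu A.
Context (g : Sigma k -> R) (q th A C : R).
Hypothesis NW : normalized_weight M g q th A.
Local Notation L := (ruelle M g).
Hypothesis C0 : 0 <= C.
Hypothesis dominated : forall n (v : Sigma k -> R) y, X y -> (forall x, X x -> 0 <= v x) ->
  iter n (ruelle M (fun=> 1)) (fun x => cylp mu (n + 1) x * v x) y <= C * iter n L v y.
Implicit Types (x y : Sigma k) (v w G : Sigma k -> R).

Let th01 := nw_th NW.
Let mX : measurable X := measurable_SFT M.

Lemma measurable_ruelle G : measurable_fun setT G -> measurable_fun X (L G).
Proof.
move=> mG; pose ka a := L (fun x => (x 0%N == a)%:R).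
have mka a : measurable_fun X (ka a).
  have hl : lipX X th (2 * 1 / th ^+ 1) (fun x => (x 0%N == a)%:R).
    apply: lipX_agree => //; first by move=> x _; rewrite ger0_norm// lern1 leq_b1.
    by move=> x y xy; rewrite (xy 0%N isT).
  have V0 : 0 <= 2 * 1 / th ^+ 1.
    by case/andP: th01 => th0 _; rewrite divr_ge0// exprn_ge0// ltW.
  apply: measurable_lipX (lipX_ruelle NW V0 hl).
  by case/andP: th01 => /ltW -> ->.
apply: (@eq_measurable_fun _ _ _ _ X (fun y => \sum_a ka a y * G (scons a y))).
  move=> y _; rewrite /ka /ruelle [RHS]big_mkcond; apply: eq_bigr => a _.
  rewrite big_mkcond (bigD1 a)//= big1 ?addr0 ?eqxx ?mulr1.
    by case: ifP; rewrite ?mul0r.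
  by move=> b ba; rewrite (negbTE ba) mulr0 if_same.
apply: measurable_sum => a; apply: measurable_funM; first exact: mka.
by apply: measurable_funTS; apply: measurableT_comp mG _; exact: measurable_scons.
Qed.

Lemma ruelle_bound G B : (forall x, `|G x| <= B) -> forall y, X y -> `|L G y| <= B.
Proof. by move=> GB y Xy; apply: (normalized_bound NW 1) => // x _. Qed.

Definition transfer_invariant G := [/\ measurable_fun setT G,
  exists B, forall x, `|G x| <= B &
  \int[mu]_(x in X) L G x = \int[mu]_(x in X) G x].

Lemma transfer_invariantD v w : transfer_invariant v -> transfer_invariant w ->
  transfer_invariant (fun x => v x + w x).
Proof.
move=> [mv [Bv hv] Iv] [mw [Bw hw] Iw]; split.
- exact: measurable_funD.
- by exists (Bv + Bw) => x; apply: le_trans (ler_normD _ _) _; apply: lerD.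
- have -> : L (fun x => v x + w x) = (fun x => L v x + L w x).
    by apply/funext => x; exact: (ruelle_iterD M g 1).
  rewrite !RintegralD ?Iv ?Iw//.
  + exact: (bounded_integrable mu mX (measurable_funTS mv) (fun x _ => hv x)).
  + exact: (bounded_integrable mu mX (measurable_funTS mw) (fun x _ => hw x)).
  + exact: (bounded_integrable mu mX (measurable_ruelle mv) (ruelle_bound hv)).
  + exact: (bounded_integrable mu mX (measurable_ruelle mw) (ruelle_bound hw)).
Qed.

Lemma transfer_invariantZ c v : transfer_invariant v -> transfer_invariant (fun x => c * v x).
Proof.
move=> [mv [Bv hv] Iv]; split.
- exact: measurable_funM.
- by exists (`|c| * Bv) => x; rewrite normrM ler_wpM2l.
- have -> : L (fun x => c * v x) = (fun x => c * L v x).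
    by apply/funext => x; exact: (ruelle_iterZ M g 1).
  rewrite !RintegralZl ?Iv//.
  + exact: (bounded_integrable mu mX (measurable_funTS mv) (fun x _ => hv x)).
  + exact: (bounded_integrable mu mX (measurable_ruelle mv) (ruelle_bound hv)).
Qed.

Lemma transfer_invariant_cvg (v_ : nat -> Sigma k -> R) v B :
  (forall n, transfer_invariant (v_ n)) -> (forall n x, `|v_ n x| <= B) ->
  (forall x, v_ ^~ x @ \oo --> v x) -> transfer_invariant v.
Proof.
move=> iv vB cv; split.
- apply: (measurable_fun_cvg (h := v_)) => // n; by have [] := iv n.
- exists B => x; apply: (@cvgn_le _ (fun n => `|v_ n x|)) => //.
  exact: (cvg_norm (cv x)).
- have h1 : (fun n => \int[mu]_(x in X) v_ n x) @ \oo --> \int[mu]_(x in X) v x.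
    apply: (bounded_Rintegral_cvg mX (B := B)) => //.
    by move=> n; have [/measurable_funTS] := iv n.
  have h2 : (fun n => \int[mu]_(x in X) L (v_ n) x) @ \oo --> \int[mu]_(x in X) L v x.
    apply: (bounded_Rintegral_cvg mX (B := B)) => //.
    + by move=> n; apply: measurable_ruelle; have [] := iv n.
    + by move=> n; exact: ruelle_bound.
    + by move=> x Xx; apply: ruelle_cvg.
  have h3 : (fun n => \int[mu]_(x in X) L (v_ n) x) = (fun n => \int[mu]_(x in X) v_ n x).
    by apply/funext => n; have [] := iv n.
  by rewrite h3 in h2; exact: cvg_unique h2 h1.
Qed.

Lemma transfer_invariant_cyl x n : transfer_invariant \1_(cyl x n).
Proof.
have b1 y : `|\1_(cyl x n) y : R| <= 1.
  by rewrite indicE; case: (_ \in _); rewrite ?normr1 ?normr0.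
split; first by apply: measurable_indic; exact: measurable_cyl.
  by exists 1.
have hl : lipX X th (2 * 1 / th ^+ n) (\1_(cyl x n) : _ -> R).
  apply: lipX_agree => // y z yz; rewrite !indicE; congr (nat_of_bool _)%:R.
  by apply/idP/idP; rewrite !inE => h i ni; [rewrite -yz ?h | rewrite yz ?h].
have V0 : 0 <= 2 * 1 / th ^+ n.
  by case/andP: th01 => th0 _; rewrite divr_ge0// exprn_ge0// ltW.
exact: (transfer_invariant_lip muX mu_inv NW C0 dominated V0 hl).
Qed.

Lemma transfer_invariant_indic E : measurable E -> transfer_invariant \1_E.
Proof.
pose H := [set E : set (Sigma k) | measurable E /\ transfer_invariant \1_E].
pose cyl0 := @cylinders k `|` [set set0].
have inv0 : transfer_invariant \1_set0.
  have := transfer_invariantZ 0 (transfer_invariant_cyl (fun=> ord0) 0).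
  by congr transfer_invariant; apply/funext => x; rewrite mul0r indic0.
have invT : transfer_invariant \1_[set: Sigma k].
  have := transfer_invariant_cyl (fun=> ord0) 0.
  by congr transfer_invariant; congr indic; apply/seteqP; split.
move=> mE; suff : H E by case.
have : <<s setT, cyl0 >> E.
  move: E mE; apply: (@sub_smallest2r _ _ (@cylinders k) cyl0).
    exact: smallest_sigma_algebra.
  by move=> B ?; left.
apply: (@lambda_system_subset _ cyl0 _ setT H) => //.
- move=> _ _ [[x [n ->]]|->] [[y [m ->]]|->]; rewrite ?set0I ?setI0; try by right.
  have [[z [zx zy]]|no] := pselect (exists z, cyl x n z /\ cyl y m z); last first.
    by right; apply/seteqP; split => // z [zx zy]; apply: no; exists z.
  left; exists z, (maxn n m); apply/seteqP; split => w /=.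
    move=> [wx wy] i; rewrite leq_max => /orP[ni|mi].
      by rewrite wx ?zx.
    by rewrite wy ?zy.
  move=> wz; split=> i im.
    by rewrite (wz i) ?leq_max ?im//; exact: zx.
  by rewrite (wz i) ?leq_max ?im ?orbT//; exact: zy.
- split=> //.
  + move=> E' F FE [mE' iE] [mF iF]; split; first exact: measurableD.
    have := transfer_invariantD iE (transfer_invariantZ (-1) iF).
    congr transfer_invariant; apply/funext => x; rewrite !indicE mulN1r.
    have [xF|xF] := boolP (x \in F).
      have xE : x \in E' by move: xF; rewrite !inE; exact: FE.
      rewrite xE subrr memNset//= => -[_]; apply.
      by rewrite inE in xF.
    rewrite subr0; congr (nat_of_bool _)%:R; apply/idP/idP; rewrite !inE => //.
      by move=> Ex; split => //; move/negP: xF; rewrite inE.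
    by case.
  + move=> F ndF HF; split; first by apply: bigcup_measurable => i _; have [] := HF i.
    apply: (@transfer_invariant_cvg (fun n => \1_(F n)) _ 1).
    * by move=> n; have [] := HF n.
    * by move=> n x; rewrite indicE; case: (_ \in _); rewrite ?normr1 ?normr0.
    * move=> x; apply: cvg_near_cst.
      have [[N _ FN]|no] := pselect ((\bigcup_i F i) x).
        exists N => // n /= Nn; rewrite !indicE !mem_set//; first by exists N.
        by have /subsetPset/(_ x FN) := ndF N n Nn.
      exists 0%N => // n _ /=; rewrite !indicE !memNset// => Fx; apply: no.
      by exists n.
- move=> _ [[x [n ->]]|->]; split => //; first exact: measurable_cyl.
  exact: transfer_invariant_cyl.
Qed.

Lemma transfer_invariant_measurable G B : measurable_fun setT G -> (forall x, `|G x| <= B) ->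
  transfer_invariant G.
Proof.
move=> mG GB.
pose F x := (G x + B)%:E.
have mF : measurable_fun setT F.
  by apply/measurable_EFinP; apply: measurable_funD.
have F0 x : [set: Sigma k] x -> (0 <= F x)%E.
  by move=> _; rewrite lee_fin -lerBlDr sub0r; have := GB x; rewrite ler_norml => /andP[].
pose sf n := nnsfun_approx measurableT mF n.
pose s n : Sigma k -> R := sf n.
have sF x : s ^~ x @ \oo --> G x + B.
  have := cvg_nnsfun_approx measurableT mF F0 (I : [set: Sigma k] x).
  by move/fine_cvg.
have s_le n x : s n x <= G x + B.
  rewrite -(cvg_lim _ (sF x))//; apply: (nondecreasing_cvgn_le (u_ := s ^~ x)).
    by move=> a b ab; have /lefP := nd_nnsfun_approx measurableT mF ab; apply.
  by apply/cvg_ex; exists (G x + B).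
have inv_s n : transfer_invariant (s n).
  have -> : s n = (fun x => \sum_(y <- finmap.enum_fset (fset_set (range (s n))))
      (y * \1_(s n @^-1` [set y]) x)).
    apply/funext => x; rewrite /s fimfunE fsbig_finite//.
  elim: (finmap.enum_fset _) => [|y r IH].
    under eq_fun do rewrite big_nil.
    have := transfer_invariantZ 0 (transfer_invariant_indic measurableT).
    by congr transfer_invariant; apply/funext => x; rewrite mul0r.
  under eq_fun do rewrite big_cons.
  apply: transfer_invariantD => //; apply: transfer_invariantZ.
  exact: transfer_invariant_indic.
have inv1 : transfer_invariant (fun x => G x + B).
  apply: (@transfer_invariant_cvg s _ (B + B)) => // n x.
  rewrite ger0_norm//; apply: le_trans (s_le n x) _.
  by rewrite lerD2r; apply: le_trans (ler_norm _) (GB x).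
have := transfer_invariantD inv1 (transfer_invariantZ (- B) (transfer_invariant_indic measurableT)).
congr transfer_invariant; apply/funext => x.
by rewrite indicT mulr1 addrK.
Qed.

Lemma transfer_invariant_iter n G B : measurable_fun X G -> (forall x, X x -> `|G x| <= B) ->
  measurable_fun X (iter n L G) /\
  \int[mu]_(x in X) iter n L G x = \int[mu]_(x in X) G x.
Proof.
move=> mG GB; elim: n => [//|n [mn In]].
have nB x : X x -> `|iter n L G x| <= B by move=> Xx; apply: (normalized_bound NW).
pose G' : Sigma k -> R := iter n L G \_ X.
have mG' : measurable_fun [set: Sigma k] G' by apply/(measurable_restrictT _ mX).
have G'B x : `|G' x| <= `|B|.
  rewrite /G' patchE; case: ifPn => [|_]; last by rewrite normr0.
  by rewrite inE => /nB /le_trans; apply; exact: ler_norm.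
have LE x : X x -> L G' x = iter n.+1 L G x.
  move=> Xx; rewrite iterS; apply: (@ruelle_iter_eq _ _ M g 1) => // z Xz _.
  by rewrite /G' patchE mem_set.
have [_ _ I'] := transfer_invariant_measurable mG' G'B.
split.
  apply: (@eq_measurable_fun _ _ _ _ X (L G')); last exact: measurable_ruelle.
  by move=> x; rewrite inE => Xx; rewrite LE.
rewrite -In; transitivity (\int[mu]_(x in X) L G' x).
  by apply: eq_Rintegral => x; rewrite inE => Xx; rewrite LE.
by rewrite I'; apply: eq_Rintegral => x; rewrite inE => Xx; rewrite /G' patchE mem_set.
Qed.

End transfer_bounded.

Section bridge.
Context {R : realType} {k : nat}.
Implicit Types (x y : Sigma k) (th : R).

Lemma dtheta_agree th n x y : 0 < th < 1 -> agree n x y -> dtheta th x y <= th ^+ n.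
Proof.
move=> /andP[th0 th1] xy; rewrite /dtheta; case: pselect => [h|_]; last by rewrite exprn_ge0// ltW.
case: ex_minnP => j xyj _; rewrite ler_wiXn2l ?(ltW th0) ?(ltW th1)// leqNgt.
by apply/negP => /xy /eqP; rewrite (negbTE xyj).
Qed.

Lemma dtheta_ge0 th x y : 0 < th < 1 -> 0 <= dtheta th x y.
Proof.
by move=> /andP[th0 th1]; rewrite /dtheta; case: pselect => // h; rewrite exprn_ge0// ltW.
Qed.

Lemma agree_dtheta th n c C x y : 0 < th < 1 -> C * th ^+ c < 1 ->
  dtheta th x y <= C * th ^+ n -> agree (n - c) x y.
Proof.
move=> /andP[th0 th1] Cc; rewrite /dtheta; case: pselect => [h|no] le i inc; last first.
  by apply/eqP; apply: contra_notT no => xyi; exists i.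
move: le; case: ex_minnP => j xyj jmin le.
apply/eqP/negPn/negP => /jmin ji.
have jcn : (j + c < n)%N by rewrite addnC -ltn_subRL; exact: leq_ltn_trans ji inc.
have : th ^+ n < th ^+ (j + c) by rewrite ltr_iXn2l.
rewrite ltNge => /negP; apply.
rewrite exprD; apply: le_trans (ler_wpM2r _ le) _; first by rewrite exprn_ge0// ltW.
by rewrite mulrAC ler_piMl ?(ltW Cc)// exprn_ge0// ltW.
Qed.

Lemma lip_theta_lipX th th' (X : set (Sigma k)) w : 0 < th < 1 -> th <= th' < 1 ->
  lip_theta th X w -> exists2 F, 0 <= F & lipX X th' F w.
Proof.
move=> th01 /andP[le1 lt1] [l hl]; exists `|l| => // n x y Xx Xy xy.
have [th0 th1] := andP th01.
apply: le_trans (hl x y Xx Xy) _.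
apply: le_trans (ler_wpM2r (dtheta_ge0 x y th01) (ler_norm l)) _.
rewrite ler_wpM2l//; apply: le_trans (dtheta_agree th01 xy) _.
by rewrite lerXn2r ?nnegrE ?(ltW th0)//; exact: le_trans (ltW th0) le1.
Qed.

Lemma collapsed_accessible_agree th (X : set (Sigma k)) f : 0 < th < 1 ->
  collapsed_accessible th X f -> exists c0 N, accessible X f c0 N.
Proof.
move=> th01 [C [N acc]]; have [th0 th1] := andP th01.
have [c hc] : exists c, th ^+ c <= (`|C| + 2)^-1.
  apply: exp_small; first by rewrite (ltW th0).
  by rewrite invr_gt0 ltr_wpDl.
have Cc : C * th ^+ c < 1.
  apply: le_lt_trans (_ : `|C| * (`|C| + 2)^-1 < 1); last first.
    by rewrite ltr_pdivrMr ?mul1r ?ltrDl// ltr_wpDl.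
  apply: le_trans (_ : `|C| * th ^+ c <= _); last by rewrite ler_wpM2l.
  by rewrite ler_wpM2r ?ler_norm// exprn_ge0// ltW.
exists c, N => x Xx t t01 n nN.
have [m [xs [ys [mN [xs0 [xsm [Xm [h tE]]]]]]]] := acc x Xx t t01 n nN.
exists m, xs, ys; split => // i im.
have [Xxi [Xyi [e d]]] := h i im.
have Xi1 : X (xs i.+1).
  move: im; rewrite leq_eqVlt => /predU1P[->//|im1].
  by have [] := h i.+1 im1.
by split => //; exact: agree_dtheta d.
Qed.

End bridge.

Lemma gibbs_transfer {R : realType} {k : nat} (M : rel 'I_k.+1)
    (mu : probability (Sigma k) R) (th : R) :
  topologically_mixing (SFT M) -> gibbs_measure (SFT M) mu -> 0 < th < 1 ->
  exists (th' : R) (g : Sigma k -> R) (q A : R),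
    [/\ th <= th' < 1, normalized_weight M g q th' A &
    forall n (G : Sigma k -> R) (B : R), measurable_fun (SFT M) G -> (forall x, SFT M x -> `|G x| <= B) ->
      measurable_fun (SFT M) (iter n (ruelle M g) G) /\
      \int[mu]_(x in SFT M) iter n (ruelle M g) G x = \int[mu]_(x in SFT M) G x].
Proof.
move=> mix [muX [mu_inv [phi [be [be01 [lphi [P [K [K0 gib]]]]]]]]] th01.
have [th0 th1] := andP th01; have [be0 be1] := andP be01.
pose t := Num.max th be.
have t1 : t < 1 by rewrite gt_max th1 be1.
have tht : th <= t by rewrite le_max lexx.
have bet : be <= t by rewrite le_max lexx orbT.
have t01 : 0 < t < 1 by rewrite t1 andbT; exact: lt_le_trans th0 tht.
have [Fp Fp0 phi_lip] : exists2 F, 0 <= F & lipX (SFT M) t F phi.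
  by apply: (lip_theta_lipX be01 _ lphi); rewrite bet.
have gibbs x : SFT M x -> forall n, (0 < n)%N ->
  K^-1 * expR (birkhoff phi n x - n%:R * P) <= cylp mu n x /\
  cylp mu n x <= K * expR (birkhoff phi n x - n%:R * P).
  move=> Xx n n0; have [h1 h2] := gib x Xx n n0.
  have muf : mu (cyl x n) = (cylp mu n x)%:E.
    by rewrite /cylp fineK// fin_num_measure//; exact: measurable_cyl.
  by rewrite muf !lee_fin in h1 h2; split.
have [g [q [A [C [NW C0 dom]]]]] :=
  gibbs_normalized_weight muX mu_inv t01 phi_lip Fp0 K0 gibbs mix.
exists t, g, q, A; split => //; first by rewrite tht.
move=> n G B mG GB.
exact: (transfer_invariant_iter muX mu_inv NW C0 dom n mG GB).
Qed.

(** * Fourier transforms of Schwartz functions *)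

Section integral_of_derivative.
Context {R : realType}.
Notation leb := (@lebesgue_measure R).
Implicit Types (F h : R -> R) (a b r M : R).

Lemma oneDsqrV_integrable : leb.-integrable setT (EFin \o (fun r : R => (1 + r ^+ 2)^-1)).
Proof.
apply/integrableP; split.
  apply/measurable_EFinP; apply: continuous_measurable_fun.
  exact: continuous_oneDsqrV.
under eq_integral => r _.
  rewrite gee0_abs; last by rewrite /= lee_fin invr_ge0 addr_ge0// sqr_ge0.
  over.
rewrite ge0_symfun_integralT.
- rewrite -set_itvcy integral0y_oneDsqr -EFinM; exact: ltry.
- by move=> r; rewrite invr_ge0 addr_ge0// sqr_ge0.
- exact: continuous_oneDsqrV.
- by move=> r /=; rewrite sqrrN.
Qed.

Lemma decaying_integrable h M : continuous h ->
  (forall r, (1 + r ^+ 2) * `|h r| <= M) -> leb.-integrable setT (EFin \o h).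
Proof.
move=> ch hM.
have M0 : 0 <= M.
  by apply: le_trans (hM 0); rewrite mulr_ge0// addr_ge0// sqr_ge0.
have i1 : leb.-integrable setT (EFin \o (fun r : R => M * (1 + r ^+ 2)^-1)).
  exact: (integrableZl measurableT M oneDsqrV_integrable).
apply: (le_integrable measurableT _ _ i1).
  by apply/measurable_EFinP; exact: continuous_measurable_fun.
move=> r _ /=; rewrite lee_fin.
have p0 : 0 < 1 + r ^+ 2 by rewrite ltr_wpDr// sqr_ge0.
rewrite [leRHS]ger0_norm ?divr_ge0 ?(ltW p0)//.
by rewrite ler_pdivlMr// mulrC.
Qed.

Lemma FTC_diff F h a b : a <= b -> continuous h ->
  (forall r, is_derive r 1 F (h r)) ->
  \int[leb]_(r in `[a, b]) h r = F b - F a.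
Proof.
rewrite le_eqVlt => /predU1P[->|ab] ch Fh.
  by rewrite subrr set_itv1 Rintegral_set1.
have cF : continuous F.
  by move=> r; apply: differentiable_continuous; apply/derivable1_diffP; have [] := Fh r.
rewrite /Rintegral (continuous_FTC2 (F := F)) ?EFinB//.
- exact: continuous_subspaceT.
- split.
  + by move=> r _; have [] := Fh r.
  + by apply: cvg_at_right_filter; exact: cF.
  + by apply: cvg_at_left_filter; exact: cF.
- by move=> r _; rewrite derive1E; have [_ ->] := Fh r.
Qed.

Lemma integral_segment_cvg h : leb.-integrable setT (EFin \o h) ->
  (fun n : nat => \int[leb]_(r in `[- n%:R, n%:R]) h r) @ \oo --> \int[leb]_r h r.
Proof.
move=> ih; have /integrableP[mh _] := ih.
have mh' : measurable_fun setT h by apply/measurable_EFinP.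
pose hn (n : nat) := h \_ `[- n%:R, n%:R].
have E n : \int[leb]_(r in `[- n%:R, n%:R]) h r = \int[leb]_r hn n r.
  by rewrite Rintegral_mkcond.
under eq_fun do rewrite E.
apply: fine_cvg; rewrite fineK; last exact: integrable_fin_num.
have iabs : leb.-integrable setT (abse \o (EFin \o h)) by exact: integrable_abse.
have := @dominated_convergence _ _ _ leb setT measurableT (fun n => EFin \o hn n)
  (EFin \o h) (abse \o (EFin \o h)).
case => //.
- move=> n; apply/measurable_EFinP; apply/(measurable_restrictT h (measurable_itv _)).
  exact: measurable_funTS.
- apply: aeW => r _; apply: cvg_near_cst.
  exists (Num.bound `|r|) => // n /= bn.
  rewrite /hn patchE mem_set//= in_itv /= -ler_norml.
  apply: le_trans (ltW (archi_boundP (normr_ge0 r))) _.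
  by rewrite ler_nat.
- apply: aeW => r n _ /=; rewrite /hn patchE; case: ifPn => // _.
  by rewrite normr0 lee_fin.
Qed.

Lemma integral_derivative0 F h M : continuous h -> leb.-integrable setT (EFin \o h) ->
  (forall r, is_derive r 1 F (h r)) -> (forall r, `|r| * `|F r| <= M) ->
  \int[leb]_r h r = 0.
Proof.
move=> ch ih Fh FM; have c1 := integral_segment_cvg ih.
have c2 : (fun n : nat => \int[leb]_(r in `[- n%:R, n%:R]) h r) @ \oo --> (0 : R).
  rewrite -cvg_shiftS.
  apply: (@squeeze_cvgr _ _ _ _ (fun n => - (2 * M * n.+1%:R^-1)) (fun n => 2 * M * n.+1%:R^-1)).
  - apply: nearW => n /=; rewrite -ler_norml (FTC_diff _ ch Fh); last first.
      by rewrite -subr_ge0 opprK addr_ge0.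
    have n0 : 0 < (n.+1%:R : R) by rewrite ltr0n.
    have := FM n.+1%:R; have := FM (- n.+1%:R).
    rewrite normrN (ger0_norm (ltW n0)) ![n.+1%:R * _]mulrC -!ler_pdivlMr// => h1 h2.
    apply: le_trans (ler_normB _ _) _; apply: le_trans (lerD h2 h1) _.
    by rewrite -mulrDl mulr_natl mulr2n.
  - rewrite -[X in _ --> X]oppr0 -[X in _ --> - X](mulr0 (2 * M)); apply: cvgN.
    by apply: cvgM; [exact: cvg_cst | exact: cvg_harmonic].
  - rewrite -[X in _ --> X](mulr0 (2 * M)).
    by apply: cvgM; [exact: cvg_cst | exact: cvg_harmonic].
exact: cvg_unique c1 c2.
Qed.

End integral_of_derivative.

Section schwartz.
Context {R : realType}.
Notation leb := (@lebesgue_measure R).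
Implicit Types (u v : R -> R) (xi om r : R).

Lemma schwartz_derive1n n u : schwartz_real u -> schwartz_real (derive1n n u).
Proof.
move=> [du bu]; have E m : derive1n m (derive1n n u) = derive1n (m + n) u.
  by elim: m => [//|m IH]; rewrite addSn !derive1nS IH.
by split => [m r|a b]; rewrite E; [exact: du | exact: bu].
Qed.

Lemma schwartz_is_derive u r : schwartz_real u -> is_derive r 1 u (derive1n 1 u r).
Proof.
move=> [du _]; rewrite derive1n1 derive1E; apply: derivableP.
exact: (du 0%N).
Qed.

Lemma schwartz_continuous u : schwartz_real u -> continuous u.
Proof.
move=> [du _] r; apply: differentiable_continuous; apply/derivable1_diffP.
exact: (du 0%N).
Qed.

Lemma schwartz_bound a u : schwartz_real u -> exists2 C, 0 <= C & forall r, `|r| ^+ a * `|u r| <= C.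
Proof.
move=> [_ bu]; have [C hC] := bu a 0%N; exists C => //.
by apply: le_trans (hC 0); rewrite mulr_ge0// exprn_ge0.
Qed.

Lemma schwartz_decay u : schwartz_real u -> exists C, forall r, (1 + r ^+ 2) * `|u r| <= C.
Proof.
move=> su; have [C0 _ h0] := schwartz_bound 0 su; have [C2 _ h2] := schwartz_bound 2 su.
exists (C0 + C2) => r; rewrite mulrDl mul1r; apply: lerD.
  by have := h0 r; rewrite expr0 mul1r.
by have := h2 r; rewrite real_normK ?num_real.
Qed.

Lemma schwartz_integrable u : schwartz_real u -> leb.-integrable setT (EFin \o u).
Proof.
move=> su; have [C hC] := schwartz_decay su.
exact: decaying_integrable (schwartz_continuous su) hC.
Qed.

Definition fourier u xi om : R := \int[leb]_r (u r * cos (r * xi + om)).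

Lemma continuous_cos_affine xi om : continuous (fun r : R => cos (r * xi + om)).
Proof.
move=> r; apply: (@continuous_comp _ _ _ (fun r => r * xi + om) cos); last exact: continuous_cos.
by apply: cvgD; [apply: cvgM; [exact: cvg_id | exact: cvg_cst] | exact: cvg_cst].
Qed.

Lemma continuous_mul_cos u xi om : continuous u -> continuous (fun r : R => u r * cos (r * xi + om)).
Proof. by move=> cu r; apply: cvgM; [exact: cu | exact: continuous_cos_affine]. Qed.

Lemma integrable_mul_cos u xi om : continuous u -> leb.-integrable setT (EFin \o u) ->
  leb.-integrable setT (EFin \o (fun r => u r * cos (r * xi + om))).
Proof.
move=> cu iu; apply: (le_integrable measurableT _ _ iu).
  by apply/measurable_EFinP; apply: continuous_measurable_fun; exact: continuous_mul_cos.
by move=> r _ /=; rewrite lee_fin normrM ler_piMr// norm_cos_le1.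
Qed.

Lemma fourier_derive u xi om : schwartz_real u ->
  fourier (derive1n 1 u) xi (om + pi / 2) = xi * fourier u xi om.
Proof.
move=> su; have su' := schwartz_derive1n 1 su.
have cu := schwartz_continuous su; have cu' := schwartz_continuous su'.
have [C C0 hC] := schwartz_bound 1 su.
pose F r := u r * cos (r * xi + (om + pi / 2)).
pose h r := derive1n 1 u r * cos (r * xi + (om + pi / 2)) - xi * (u r * cos (r * xi + om)).
have Fh r : is_derive r 1 F (h r).
  have d1 := schwartz_is_derive r su.
  pose A := xi \*: (@id R) + cst (om + pi / 2).
  have AE z : A z = z * xi + (om + pi / 2) by rewrite /A !fctE /= [_ *: _]mulrC.
  have d2 : is_derive r 1 A xi.
    have dZ := is_deriveZ xi (is_derive_id r (1 : R)).
    have dA := is_deriveD dZ (is_derive_cst (om + pi / 2) r (1 : R)).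
    by apply: (is_derive_eq dA); rewrite addr0 [_ *: _]mulr1.
  have d3 := is_derive1_comp (is_derive_cos (A r)) d2.
  have -> : F = u * (cos \o A) by apply/funext => z; rewrite /F fctE /= AE.
  apply: (is_derive_eq (is_deriveM d1 d3)).
  rewrite /h /= AE addrA cosDpihalf sinDpihalf -[_ *: _]/(_ * _) -[_ *: derive1n 1 u r]/(_ * _).
  by rewrite derive1n1; ring.
have i1 := integrable_mul_cos xi (om + pi / 2) cu' (schwartz_integrable su').
have i2 := integrable_mul_cos xi om cu (schwartz_integrable su).
have i3 : leb.-integrable setT (EFin \o (fun r => xi * (u r * cos (r * xi + om)))).
  exact: (integrableZl measurableT xi i2).
have ch : continuous h.
  move=> r; apply: cvgB; first exact: continuous_mul_cos.
  by apply: cvgM; [exact: cvg_cst | exact: continuous_mul_cos].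
have ih : leb.-integrable setT (EFin \o h) by exact: (integrableB measurableT i1 i3).
have := integral_derivative0 ch ih Fh (M := C).
rewrite /h RintegralB// RintegralZl// => h0; apply/eqP; rewrite -subr_eq0; apply/eqP; apply: h0.
move=> r; rewrite normrM mulrA -[leRHS]mulr1; apply: ler_pM => //; last exact: norm_cos_le1.
by have := hC r; rewrite expr1.
Qed.

End schwartz.

Section fourier.
Context {R : realType}.
Notation leb := (@lebesgue_measure R).
Implicit Types (u v : R -> R) (xi om r : R).

Lemma integrable_cos_schwartz u xi om : schwartz_real u ->
  leb.-integrable setT (EFin \o (fun r => u r * cos (r * xi + om))).
Proof.
by move=> su; apply: integrable_mul_cos;
  [exact: schwartz_continuous | exact: schwartz_integrable].
Qed.

Lemma fourier_derive1n l u xi om : schwartz_real u ->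
  fourier (derive1n l u) xi (om + l%:R * (pi / 2)) = xi ^+ l * fourier u xi om.
Proof.
move=> su; elim: l om => [|l IH] om; first by rewrite mul0r addr0 mul1r.
rewrite derive1nS -derive1n1.
have -> : om + l.+1%:R * (pi / 2) = (om + l%:R * (pi / 2)) + pi / 2.
  by rewrite -natr1; ring.
by rewrite fourier_derive ?IH ?exprS ?mulrA//; exact: schwartz_derive1n.
Qed.

Lemma integrable_subr u v : schwartz_real u -> schwartz_real v ->
  leb.-integrable setT (EFin \o (fun r => u r - v r)).
Proof.
move=> su sv.
exact: (integrableB measurableT (schwartz_integrable su) (schwartz_integrable sv)).
Qed.

Lemma integrable_norm u : leb.-integrable setT (EFin \o u) ->
  leb.-integrable setT (EFin \o (fun r => `|u r|)).
Proof. by move=> iu; exact: (integrable_abse iu). Qed.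

Lemma fourier_diff_le u v xi om : schwartz_real u -> schwartz_real v ->
  `|fourier u xi om - fourier v xi om| <= \int[leb]_r `|u r - v r|.
Proof.
move=> su sv.
have iu := integrable_cos_schwartz xi om su; have iv := integrable_cos_schwartz xi om sv.
rewrite -RintegralB//; apply: le_trans (le_normr_Rintegral measurableT _) _.
  exact: (integrableB measurableT iu iv).
apply: le_Rintegral => //.
- exact: integrable_norm (integrableB measurableT iu iv).
- exact: integrable_norm (integrable_subr su sv).
by move=> r _; rewrite -mulrBl normrM ler_piMr// norm_cos_le1.
Qed.

Lemma fourier_le u xi om : schwartz_real u -> `|fourier u xi om| <= \int[leb]_r `|u r|.
Proof.
move=> su; have iu := integrable_cos_schwartz xi om su.
apply: le_trans (le_normr_Rintegral measurableT iu) _.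
apply: le_Rintegral => //.
- exact: integrable_norm iu.
- exact: integrable_norm (schwartz_integrable su).
by move=> r _; rewrite normrM ler_piMr// norm_cos_le1.
Qed.

Lemma fourier_diff_decay l u v xi om : schwartz_real u -> schwartz_real v ->
  `|xi| ^+ l * `|fourier u xi om - fourier v xi om| <=
  \int[leb]_r `|derive1n l u r - derive1n l v r|.
Proof.
move=> su sv; rewrite -normrX -normrM mulrBr -!fourier_derive1n//.
by apply: fourier_diff_le; exact: schwartz_derive1n.
Qed.

Lemma fourier_decay l u xi om : schwartz_real u ->
  `|xi| ^+ l * `|fourier u xi om| <= \int[leb]_r `|derive1n l u r|.
Proof.
move=> su; rewrite -normrX -normrM -fourier_derive1n//.
by apply: fourier_le; exact: schwartz_derive1n.
Qed.

Lemma fourier_trig u xi om : schwartz_real u ->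
  fourier u xi om = fourier u xi 0 * cos om + fourier u xi (pi / 2) * sin om.
Proof.
move=> su; have i0 := integrable_cos_schwartz xi 0 su.
have i1 := integrable_cos_schwartz xi (pi / 2) su.
rewrite mulrC [X in _ = _ + X]mulrC /fourier -!RintegralZl// -RintegralD//.
- by apply: eq_Rintegral => r _; rewrite addr0 cosDpihalf cosD; ring.
- exact: (integrableZl measurableT (cos om) i0).
- exact: (integrableZl measurableT (sin om) i1).
Qed.

Lemma fourier0 u om : schwartz_real u -> fourier u 0 om = cos om * \int[leb]_r u r.
Proof.
move=> su; rewrite -RintegralZl//; last exact: schwartz_integrable.
by apply: eq_Rintegral => r _; rewrite mulr0 add0r mulrC.
Qed.

Lemma schwartz_diff_le u v r : schwartz_real u -> schwartz_real v ->
  `|u r - v r| <= \int[leb]_s `|derive1n 1 u s - derive1n 1 v s|.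
Proof.
move=> su sv; have su' := schwartz_derive1n 1 su; have sv' := schwartz_derive1n 1 sv.
have ib := integrable_subr su' sv'; have ia := integrable_norm ib.
set I := Rintegral _ _ _.
have [C C0 hu] := schwartz_bound 1 su; have [D D0 hv] := schwartz_bound 1 sv.
have sub n : - n%:R <= r -> `|(u r - v r) - (u (- n%:R) - v (- n%:R))| <= I.
  move=> nr.
  have -> : u r - v r - (u (- n%:R) - v (- n%:R)) =
    \int[leb]_(s in `[- n%:R, r]) (derive1n 1 u s - derive1n 1 v s).
    have cu' := schwartz_continuous su'; have cv' := schwartz_continuous sv'.
    rewrite RintegralB//.
    - rewrite (FTC_diff nr cu' (fun s => schwartz_is_derive s su)).
      by rewrite (FTC_diff nr cv' (fun s => schwartz_is_derive s sv)); ring.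
    - by apply: (integrableS (E := setT)) => //; exact: schwartz_integrable.
    - by apply: (integrableS (E := setT)) => //; exact: schwartz_integrable.
  apply: le_trans (le_normr_Rintegral _ _) _ => //.
    by apply: (integrableS (E := setT)) => //.
  rewrite /I Rintegral_mkcond; apply: le_Rintegral => //.
  - have /integrableP[mia _] := ia.
    have mia' : measurable_fun setT (fun s => `|derive1n 1 u s - derive1n 1 v s|) by apply/measurable_EFinP.
    apply: (le_integrable measurableT _ _ ia).
      apply/measurable_EFinP; apply/(measurable_restrictT _ (measurable_itv _)).
      exact: measurable_funTS.
    by move=> s _ /=; rewrite lee_fin patchE; case: ifPn => // _; rewrite normr0.
  - by move=> s _; rewrite patchE; case: ifPn => // _; exact: normr_ge0.
apply/ler_addgt0Pr => e e0.
pose n := Num.bound (`|r| + (C + D) / e).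
have CD0 : 0 <= (C + D) / e by rewrite divr_ge0 ?addr_ge0// ltW.
have hn : `|r| + (C + D) / e < n%:R by apply: archi_boundP; rewrite addr_ge0.
have n0 : 0 < (n%:R : R) by apply: le_lt_trans hn; rewrite addr_ge0.
have nr : - n%:R <= r.
  by rewrite lerNl; apply: le_trans (ler_norm _) _; rewrite normrN; apply: ltW; apply: le_lt_trans hn; rewrite lerDl.
have h1 := sub n nr.
have h2 : `|u (- n%:R) - v (- n%:R)| <= e.
  have := hu (- n%:R); have := hv (- n%:R).
  rewrite !expr1 !normrN !(ger0_norm (ltW n0)) => hv' hu'.
  rewrite -(ler_pM2l n0); apply: le_trans (_ : C + D <= _).
    by apply: le_trans (ler_wpM2l (ltW n0) (ler_normB _ _)) _; rewrite mulrDr lerD.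
  rewrite -ler_pdivrMr//; apply: ltW; apply: le_lt_trans hn; by rewrite lerDr.
have := ler_normD (u r - v r - (u (- n%:R) - v (- n%:R))) (u (- n%:R) - v (- n%:R)).
by rewrite subrK; lra.
Qed.

End fourier.

(** * Signed measures *)

Section simple_approximation.
Context {d : measure_display} {T : measurableType d} {R : realType}.
Implicit Types (h s : T -> R) (c : R) (D E : set T).

Lemma simple_approximation h c : measurable_fun setT h -> (forall x, `|h x| <= c) ->
  exists (s : nat -> T -> R) (r : nat -> seq R),
  [/\ forall n, measurable_fun setT (s n), forall n x, `|s n x| <= c,
      forall x, s ^~ x @ \oo --> h x, forall n, uniq (r n) & forall n x, s n x \in r n].
Proof.
move=> mh hc; pose F x := (h x + c)%:E.
have mF : measurable_fun setT F by apply/measurable_EFinP; apply: measurable_funD.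
have F0 x : [set: T] x -> (0 <= F x)%E.
  by move=> _; rewrite lee_fin -lerBlDr sub0r; have := hc x; rewrite ler_norml => /andP[].
pose sf n := nnsfun_approx measurableT mF n.
pose s n (x : T) : R := sf n x - c.
have sf0 n (x : T) : (0 : R) <= sf n x by exact: fun_ge0.
have sF x : (fun n => sf n x : R) @ \oo --> h x + c.
  by have := cvg_nnsfun_approx measurableT mF F0 (I : [set: T] x); move/fine_cvg.
have s_le n x : sf n x <= h x + c.
  rewrite -(cvg_lim _ (sF x))//; apply: (nondecreasing_cvgn_le (u_ := fun n => sf n x)).
    by move=> a b ab; have /lefP := nd_nnsfun_approx measurableT mF ab; apply.
  by apply/cvg_ex; exists (h x + c).
exists s, (fun n => [seq y - c | y <- finmap.enum_fset (fset_set (range (sf n)))]); split.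
- by move=> n; apply: measurable_funB.
- move=> n x; have := s_le n x; have := sf0 n x; have := hc x.
  by rewrite /s !ler_norml => /andP[? ?] ? ?; apply/andP; split; lra.
- move=> x; rewrite -[X in _ --> X](addrK c); apply: cvgB; [exact: sF | exact: cvg_cst].
- by move=> n; rewrite map_inj_uniq ?finmap.fset_uniq// => a b /addIr.
- move=> n x; apply/mapP; exists (sf n x) => //.
  by rewrite in_fset_set// inE; exists x.
Qed.

Lemma Rintegral_indicI (m : {finite_measure set T -> \bar R}) D E : measurable D -> measurable E ->
  \int[m]_(x in D) \1_E x = fine (m (D `&` E)).
Proof.
move=> mD mE.
transitivity (\int[m]_(x in D `&` E) (1 : R)); last first.
  by rewrite Rintegral_cst ?mul1r//; exact: measurableI.
rewrite Rintegral_mkcondr; apply: eq_Rintegral => x _.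
by rewrite patchE indicE; case: (x \in E).
Qed.

Lemma simple_Rintegral (m : {finite_measure set T -> \bar R}) D s (r : seq R) :
  measurable D -> measurable_fun setT s -> uniq r -> (forall x, s x \in r) ->
  \int[m]_(x in D) s x = \sum_(y <- r) y * fine (m (D `&` s @^-1` [set y])).
Proof.
move=> mD ms ur sr.
have mE y : measurable (s @^-1` [set y]) by rewrite -[X in measurable X]setTI; exact: ms.
have sE x : s x = \sum_(y <- r) y * \1_(s @^-1` [set y]) x.
  rewrite (bigD1_seq (s x))//= big1 ?addr0; first by rewrite indicE mem_set ?mulr1.
  by move=> y ys; rewrite indicE memNset ?mulr0//= => xy; move: ys; rewrite -xy eqxx.
have i1 y x : `|y * \1_(s @^-1` [set y]) x : R| <= `|y|.
  by rewrite normrM ler_piMr// indicE; case: (_ \in _); rewrite ?normr1 ?normr0.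
transitivity (\int[m]_(x in D) \sum_(y <- r) (y * \1_(s @^-1` [set y]) x)).
  by apply: eq_Rintegral => x _; exact: sE.
have mi y : measurable_fun D (\1_(s @^-1` [set y]) : T -> R).
  by apply: measurable_funTS; exact: measurable_indic.
rewrite (@bounded_Rintegral_sum _ _ _ m D _ _ _ _ (fun y => `|y|))//; last first.
  by move=> y _; apply: measurable_funM.
apply: eq_bigr => y _; rewrite RintegralZl ?Rintegral_indicI//.
apply: (@bounded_integrable _ _ _ m D mD _ 1) => // x _.
by rewrite indicE; case: (_ \in _); rewrite ?normr1 ?normr0.
Qed.

Definition signed_measure (m1 m2 : {finite_measure set T -> \bar R}) E : R :=
  fine (m1 E) - fine (m2 E).

Definition signed_integral (m1 m2 : {finite_measure set T -> \bar R}) D h : R :=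
  \int[m1]_(x in D) h x - \int[m2]_(x in D) h x.

Lemma signed_integral_cvg m1 m2 D (s : nat -> T -> R) h c : measurable D ->
  (forall n, measurable_fun D (s n)) -> (forall n x, D x -> `|s n x| <= c) ->
  (forall x, D x -> s ^~ x @ \oo --> h x) ->
  (fun n => signed_integral m1 m2 D (s n)) @ \oo --> signed_integral m1 m2 D h.
Proof.
move=> mD ms sc sh.
by apply: cvgB; apply: (bounded_Rintegral_cvg mD (B := c)).
Qed.

Lemma simple_signed_integral m1 m2 D s (r : seq R) :
  measurable D -> measurable_fun setT s -> uniq r -> (forall x, s x \in r) ->
  signed_integral m1 m2 D s = \sum_(y <- r) y * signed_measure m1 m2 (D `&` s @^-1` [set y]).
Proof.
move=> mD ms ur sr; rewrite /signed_integral !(simple_Rintegral _ mD ms ur sr) -sumrB.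
by apply: eq_bigr => y _; rewrite mulrBr.
Qed.

Definition tv_le (m1 m2 : {finite_measure set T -> \bar R}) D (V : R) :=
  forall (n : nat) (F : nat -> set T),
  (forall j, (j < n)%N -> measurable (F j) /\ F j `<=` D) ->
  trivIset [set j | (j < n)%N] F ->
  \sum_(j < n) `|signed_measure m1 m2 (F j)| <= V.

Lemma signed_integral_le m1 m2 D h c V : measurable D -> measurable_fun setT h -> 0 <= c ->
  (forall x, D x -> `|h x| <= c) -> tv_le m1 m2 D V ->
  `|signed_integral m1 m2 D h| <= c * V.
Proof.
move=> mD mh c0 hc hV.
pose h' : T -> R := h \_ D.
have mh' : measurable_fun setT h'.
  by apply/(measurable_restrictT _ mD); exact: measurable_funTS.
have h'c x : `|h' x| <= c.
  by rewrite /h' patchE; case: ifPn => [|_]; [rewrite inE; exact: hc | rewrite normr0].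
have hE : signed_integral m1 m2 D h = signed_integral m1 m2 D h'.
  by congr (_ - _); apply: eq_Rintegral => x xD; rewrite /h' patchE xD.
have [s [r [ms sc sh ur sr]]] := simple_approximation mh' h'c.
rewrite hE; apply: (@cvgn_le _ (fun n => `|signed_integral m1 m2 D (s n)|)).
  apply: cvg_norm; apply: (signed_integral_cvg (c := c)) => //.
  by move=> n; exact: measurable_funTS.
move=> n; rewrite (simple_signed_integral _ _ mD (ms n) (ur n) (sr n)).
apply: le_trans (ler_norm_sum _ _ _) _.
apply: le_trans (_ : \sum_(y <- r n) c * `|signed_measure m1 m2 (D `&` s n @^-1` [set y])| <= _).
  apply: ler_sum => y _; rewrite normrM.
  have [[x [Dx xy]]|no] := pselect (exists x, D x /\ s n x = y).
    by rewrite ler_wpM2r// -xy.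
  have -> : D `&` s n @^-1` [set y] = set0.
    by rewrite -subset0 => x [Dx xy]; apply: no; exists x.
  by rewrite /signed_measure !measure0 subrr normr0 !mulr0.
rewrite -big_distrr /= ler_wpM2l// (big_nth 0) big_mkord.
apply: (hV _ (fun j => D `&` s n @^-1` [set nth 0 (r n) j])) => [j jn|i j /= ni nj [x [[_ xi] [_ xj]]]].
  split; last by move=> x [].
  by apply: measurableI => //; rewrite -[X in measurable X]setTI; exact: ms.
have : nth 0 (r n) i = nth 0 (r n) j by rewrite -xi -xj.
by move/eqP; rewrite nth_uniq// => /eqP.
Qed.

Lemma measurable_signed_integral {d' : measure_display} {S : measurableType d'}
    (Y : set S) (m1 m2 : S -> {finite_measure set T -> \bar R}) h c :
  (forall E, measurable E -> measurable_fun Y (fun x => signed_measure (m1 x) (m2 x) E)) ->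
  measurable_fun setT h -> (forall x, `|h x| <= c) ->
  measurable_fun Y (fun x => signed_integral (m1 x) (m2 x) setT h).
Proof.
move=> mm mh hc; have [s [r [ms sc sh ur sr]]] := simple_approximation mh hc.
apply: (measurable_fun_cvg (h := fun n x => signed_integral (m1 x) (m2 x) setT (s n))).
  move=> n; under eq_fun do rewrite (simple_signed_integral _ _ measurableT (ms n) (ur n) (sr n)).
  apply: measurable_sum => y; apply: measurable_funM => //; apply: mm.
  by rewrite setTI -[X in measurable X]setTI; exact: ms.
move=> x Yx; apply: (signed_integral_cvg (c := c)) => //.
Qed.

End simple_approximation.

Section product_measurability.
Context {d : measure_display} {T : measurableType d} {R : realType}.

Lemma jointly_measurable (F : T -> R -> R) :
  (forall r, measurable_fun setT (F ^~ r)) ->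
  (forall x (u : nat -> R) r, u @ \oo --> r -> (fun n => F x (u n)) @ \oo --> F x r) ->
  measurable_fun setT (fun z : T * R => F z.1 z.2).
Proof.
move=> mF cF.
pose q (n : nat) (r : R) : R := (Num.floor (r * n.+1%:R))%:~R / n.+1%:R.
have qr r : q ^~ r @ \oo --> r.
  apply: (@squeeze_cvgr _ _ _ _ (fun n => r - n.+1%:R^-1) (fun=> r)).
  - apply: nearW => n /=.
    have /andP[h1 h2] := floor_itv (r * n.+1%:R).
    rewrite ler_pdivrMr// h1 andbT ler_pdivlMr// mulrBl mulVf ?gt_eqF//.
    by move: h2; rewrite intrD; lra.
  - rewrite -[X in _ --> X]subr0; apply: cvgB; [exact: cvg_cst | exact: cvg_harmonic].
  - exact: cvg_cst.
apply: (measurable_fun_cvg (h := fun n z => F z.1 (q n z.2))); last first.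
  by move=> z _; apply: cF; exact: qr.
move=> n _ B mB; rewrite setTI.
have -> : (fun z : T * R => F z.1 (q n z.2)) @^-1` B =
  \bigcup_(v in [set: int]) ((F ^~ (v%:~R / n.+1%:R) @^-1` B) `*`
     [set r : R | Num.floor (r * n.+1%:R) = v]).
  apply/seteqP; split => [[x r] /= h|[x r] [v _ [/= h rv]]] /=.
    by exists (Num.floor (r * n.+1%:R)).
  by rewrite /q rv.
apply: countable_bigcupT_measurable => [|v]; first exact: countableP.
apply: measurableX; first by rewrite -[X in measurable X]setTI; exact: mF.
have -> : [set r : R | Num.floor (r * n.+1%:R) = v] =
    (fun r : R => r * n.+1%:R) @^-1` `[v%:~R, (v + 1)%:~R[.
  apply/seteqP; split => r /=; rewrite in_itv /=.
    by move/eqP; rewrite floor_eq.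
  by move=> h; apply/eqP; rewrite floor_eq.
rewrite -[X in measurable X]setTI.
by have : measurable_fun setT (fun r : R => r * n.+1%:R) by [apply: measurable_funM]; apply.
Qed.

End product_measurability.

Section fourier_fubini.
Context {R : realType}.
Notation leb := (@lebesgue_measure R).

Lemma measurable_cos_affine2 (s om : R) :
  measurable_fun setT (fun z : R * R => cos ((z.1 + s) * z.2 + om)).
Proof.
apply: measurableT_comp; first by apply: continuous_measurable_fun; exact: continuous_cos.
apply: measurable_funD => //; apply: measurable_funM; last exact: measurable_snd.
by apply: measurable_funD => //; exact: measurable_fst.
Qed.

Lemma fourier_fubini (m : {finite_measure set R -> \bar R}) (u : R -> R) (s om : R) :
  leb.-integrable setT (EFin \o u) ->
  [/\ measurable_fun setT (fun xi => fourier u xi (om + xi * s)),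
      leb.-integrable setT
        (EFin \o (fun r => u r * \int[m]_(xi in setT) cos ((r + s) * xi + om))) &
      \int[leb]_r (u r * \int[m]_(xi in setT) cos ((r + s) * xi + om)) =
      \int[m]_(xi in setT) fourier u xi (om + xi * s)].
Proof.
move=> iu; have /integrableP[mu_ iu_lt] := iu.
have mu : measurable_fun setT u by apply/measurable_EFinP.
pose f (z : R * R) : \bar R := (u z.1 * cos ((z.1 + s) * z.2 + om))%:E.
have mf : measurable_fun setT f.
  apply/measurable_EFinP; apply: measurable_funM; last exact: measurable_cos_affine2.
  exact: measurableT_comp mu measurable_fst.
have mcos r : measurable_fun setT (fun xi : R => cos ((r + s) * xi + om)).
  apply: measurableT_comp; first by apply: continuous_measurable_fun; exact: continuous_cos.
  by apply: measurable_funD => //; apply: measurable_funM.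
have icos r : m.-integrable setT (EFin \o (fun xi : R => cos ((r + s) * xi + om))).
  by apply: (bounded_integrable _ measurableT (B := 1)) => // xi _; exact: norm_cos_le1.
have fi : (leb \x m)%E.-integrable setT f.
  apply: (@integrable12ltyP _ _ _ _ R leb m f mf).2.
  apply: (@le_lt_trans _ _ (\int[leb]_r (`|u r|%:E * m setT))%E).
    apply: ge0_le_integral => //.
    - by move=> r _; apply: integral_ge0 => xi _; exact: abse_ge0.
    - apply: (@measurable_fun_fubini_tonelli_F _ _ _ _ R m (fun z => `|f z|%E)) => //.
      exact: measurableT_comp.
    - apply: emeasurable_funM => //; apply/measurable_EFinP.
      exact: measurableT_comp mu.
    - move=> r _; rewrite -[leRHS](integral_cst m measurableT).
      apply: ge0_le_integral => //.
      + apply: measurableT_comp => //; apply/measurable_EFinP.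
        exact: (measurable_funM (measurable_cst (u r)) (mcos r)).
      + by move=> xi _; rewrite /f /= lee_fin normrM ler_piMr// norm_cos_le1.
  rewrite ge0_integralZr//.
  - apply: lte_mul_pinfty; first exact: integral_ge0.
      by rewrite ge0_fin_numE//; exact: integral_ge0.
    by rewrite ltey_eq fin_num_measure.
  - by apply/measurable_EFinP; exact: measurableT_comp mu.
have GE xi : fubini_G leb f xi = (fourier u xi (om + xi * s))%:E.
  rewrite /fubini_G /fourier /Rintegral fineK; last first.
    apply: integrable_fin_num => //; apply: (le_integrable measurableT _ _ iu).
      apply/measurable_EFinP; apply: measurable_funM => //.
      by apply: continuous_measurable_fun; exact: continuous_cos_affine.
    by move=> r _ /=; rewrite lee_fin normrM ler_piMr// norm_cos_le1.
  apply: eq_integral => r _; rewrite /f /=; congr (_ * cos _)%:E; ring.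
have FE r : fubini_F m f r = (u r * \int[m]_(xi in setT) cos ((r + s) * xi + om))%:E.
  rewrite -RintegralZl// /fubini_F /Rintegral fineK//.
  exact: integrable_fin_num (integrableZl measurableT (u r) (icos r)).
split.
  have := measurable_fubini_G fi; rewrite (_ : fubini_G leb f = EFin \o (fun xi => fourier u xi (om + xi * s))).
    by move/measurable_EFinP.
  by apply/funext => xi; rewrite GE.
  have := integrable_fubini_F fi; apply: eq_integrable => // r _.
  exact: FE.
have := Fubini fi; rewrite -/(fubini_F _ _ _) => h.
rewrite /Rintegral; congr fine.
transitivity (\int[leb]_r fubini_F m f r)%E; first by apply: eq_integral => r _; rewrite FE.
transitivity (\int[m]_xi fubini_G leb f xi)%E; first exact: h.
by apply: eq_integral => xi _; rewrite GE.
Qed.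

End fourier_fubini.

Section skew_product_integral.
Context {R : realType} {k : nat} (mu : probability (Sigma k) R) (X : set (Sigma k)).
Hypothesis mX : measurable X.
Notation leb := (@lebesgue_measure R).

Lemma nu_prod_integral (E : set R) (G : Sigma k * R -> R) (B : R) : measurable E ->
  measurable_fun (X `*` E) G ->
  (forall x, X x -> (\int[leb]_(r in E) `|G (x, r)|%:E <= B%:E)%E) ->
  [/\ (nu_prod mu).-integrable (X `*` E) (EFin \o G),
      measurable_fun X (fun x => \int[leb]_(r in E) G (x, r)),
      forall x, X x -> `|\int[leb]_(r in E) G (x, r)| <= B &
      \int[nu_prod mu]_(z in X `*` E) G z = \int[mu]_(x in X) \int[leb]_(r in E) G (x, r)].
Proof.
move=> mE mG GB.
have mXE : measurable (X `*` E) by exact: measurableX.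
pose G' : Sigma k * R -> R := G \_ (X `*` E).
have mG' : measurable_fun setT G' by apply/(measurable_restrictT G mXE).
have mG'E : measurable_fun setT (EFin \o G') by apply/measurable_EFinP.
have G'E x r : X x -> G' (x, r) = ((fun r => G (x, r)) \_ E) r.
  move=> Xx; rewrite /G' !patchE.
  have [rE|rE] := boolP (r \in E).
    by rewrite mem_set//; split => //; rewrite inE in rE.
  by rewrite memNset//= => -[_ Er]; move/negP: rE; apply; rewrite inE.
have G'0 x r : ~ X x -> G' (x, r) = 0.
  by move=> nX; rewrite /G' patchE memNset// => -[].
have EE x : X x -> (\int[leb]_r `|G' (x, r)|%:E = \int[leb]_(r in E) `|G (x, r)|%:E)%E.
  move=> Xx; rewrite [RHS]integral_mkcond; apply: eq_integral => r _.
  by rewrite G'E// !patchE; case: (r \in E); rewrite ?normr0.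
have i' : (nu_prod mu).-integrable setT (EFin \o G').
  apply: (@integrable12ltyP _ _ _ _ R mu leb _ mG'E).2.
  apply: (@le_lt_trans _ _ (\int[mu]_(x in setT) (`|B|)%:E)%E).
    apply: ge0_le_integral => //.
    - by move=> x _; apply: integral_ge0 => r _; exact: abse_ge0.
    - apply: (@measurable_fun_fubini_tonelli_F _ _ _ _ R leb (fun z => `|(EFin \o G') z|%E)) => //.
      exact: measurableT_comp.
    - move=> x _; have [Xx|nXx] := pselect (X x).
        rewrite (EE x Xx); apply: le_trans (GB x Xx) _.
        by rewrite lee_fin ler_norm.
      under eq_integral => r _ do rewrite /= (G'0 x r nXx) normr0.
      by rewrite integral0 lee_fin.
  rewrite integral_cst//; apply: lte_mul_pinfty => //.
  exact: le_lt_trans (probability_le1 mu measurableT) (ltry 1).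
have FE x : X x -> fubini_F leb (EFin \o G') x = (\int[leb]_(r in E) G (x, r))%:E.
  move=> Xx; rewrite /fubini_F Rintegral_mkcond /Rintegral fineK.
    by apply: eq_integral => r _; rewrite /= G'E.
  have mGx : measurable_fun setT (fun r => G' (x, r)).
    exact: measurableT_comp mG' (pair1_measurable x).
  apply: integrable_fin_num => //.
  have h : leb.-integrable setT (EFin \o (fun r => G' (x, r))).
    apply/integrableP; split; first exact/measurable_EFinP.
    by rewrite (EE x Xx); apply: le_lt_trans (GB x Xx) (ltry _).
  by apply: eq_integrable h => // r _ /=; rewrite G'E.
have F0 x : ~ X x -> fubini_F leb (EFin \o G') x = 0%E.
  move=> nX; rewrite /fubini_F.
  under eq_integral => r _ do rewrite /= (G'0 x r nX).
  by rewrite integral0.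
split.
- apply: (@integrable_mkcond _ _ _ (nu_prod mu) _ (EFin \o G) mXE).2; rewrite restrict_EFin; exact: i'.
- have mF := measurable_fubini_F i'.
  apply: (@eq_measurable_fun _ _ _ _ X (fun x => fine (fubini_F leb (EFin \o G') x))).
    by move=> x; rewrite inE => Xx; rewrite FE.
  by apply: measurable_funTS; exact: measurableT_comp (fine_measurable _) mF.
- move=> x Xx.
  rewrite -lee_fin; apply: le_trans (GB x Xx).
  rewrite -abse_EFin -(FE x Xx) /fubini_F -(EE x Xx).
  by apply: le_abse_integral => //; apply/measurable_EFinP; exact: measurableT_comp mG' (pair1_measurable x).
- rewrite [LHS]Rintegral_mkcond [RHS]Rintegral_mkcond /Rintegral; congr fine.
  rewrite -/G' -(integral12_prod_meas1 i'); apply: eq_integral => x _.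
  rewrite patchE; case: ifPn => xX.
    by rewrite FE//; rewrite inE in xX.
  by rewrite F0// => Xx; move/negP: xX; apply; rewrite inE.
Qed.

End skew_product_integral.

(** * Correlations with a Fourier-Stieltjes transform *)

Section component_measurability.
Context {R : realType} {k : nat} (M : rel 'I_k.+1).
Notation X := (SFT M).
Notation leb := (@lebesgue_measure R).
Variables (m1 m2 : Sigma k -> {finite_measure set R -> \bar R}) (V om : R).
Hypothesis mm : forall E, measurable E ->
  measurable_fun X (fun x => signed_measure (m1 x) (m2 x) E).
Hypothesis mV : forall x, X x -> tv_le (m1 x) (m2 x) setT V.

Definition fourier_stieltjes (x : Sigma k) (r : R) : R :=
  signed_integral (m1 x) (m2 x) setT (fun xi => cos (r * xi + om)).

Lemma measurable_cos_affine (r : R) : measurable_fun setT (fun xi : R => cos (r * xi + om)).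
Proof.
apply: continuous_measurable_fun; rewrite (_ : (fun xi => _) = fun xi => cos (xi * r + om)).
  exact: continuous_cos_affine.
by apply/funext => xi; rewrite mulrC.
Qed.

Lemma fourier_stieltjes_le x r : X x -> `|fourier_stieltjes x r| <= V.
Proof.
move=> Xx; rewrite -[V]mul1r; apply: signed_integral_le (mV Xx) => //.
- exact: measurable_cos_affine.
- by move=> xi _; exact: norm_cos_le1.
Qed.

Lemma measurable_on_SFT (F : Sigma k -> R -> R) :
  (forall r, measurable_fun X (F ^~ r)) ->
  (forall x (s : nat -> R) r, X x -> s @ \oo --> r -> (fun n => F x (s n)) @ \oo --> F x r) ->
  measurable_fun setT (fun z : Sigma k * R => ((F ^~ z.2) \_ X) z.1).
Proof.
move=> mF cF; apply: (@jointly_measurable _ _ _ (fun x r => ((F ^~ r) \_ X) x)) => [r|x s r sr].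
  by apply/(measurable_restrictT _ (measurable_SFT M)).
rewrite patchE; under eq_fun do rewrite patchE.
by case: ifPn => [xX|_]; [apply: cF => //; rewrite inE in xX|exact: cvg_cst].
Qed.

Lemma measurable_fourier_stieltjes :
  measurable_fun setT (fun z : Sigma k * R => ((fourier_stieltjes ^~ z.2) \_ X) z.1).
Proof.
apply: measurable_on_SFT => [r|x s r Xx sr].
  apply: (measurable_signed_integral (c := 1)) => //; first exact: measurable_cos_affine.
  by move=> xi; exact: norm_cos_le1.
apply: (@signed_integral_cvg _ _ _ _ _ _ _ _ 1) => //.
- by move=> n; exact: measurable_cos_affine.
- by move=> n xi _; exact: norm_cos_le1.
- move=> xi _; apply: (@cvg_comp _ _ _ (fun n => s n * xi + om) cos _ (nbhs (r * xi + om))).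
    by apply: cvgD; [apply: cvgM => //|]; exact: cvg_cst.
  exact: continuous_cos.
Qed.

Lemma measurable_fourier_stieltjes_flow (f : Sigma k -> R) n : measurable_fun X f ->
  measurable_fun (X `*` setT)
    (fun z : Sigma k * R => fourier_stieltjes (iter n sshift z.1) (z.2 + birkhoff f n z.1)).
Proof.
move=> mf.
have mfn : measurable_fun X (birkhoff f n).
  apply: measurable_sum => i.
  apply: (measurable_comp (F := X)) (mf) _; first exact: measurable_SFT.
    by move=> _ [x Xx <-]; exact: SFT_iter.
  by apply: measurable_funTS; exact: measurable_iter_sshift.
have mfn' : measurable_fun setT (birkhoff f n \_ X).
  by apply/(measurable_restrictT _ (measurable_SFT M)).
pose flow (z : Sigma k * R) : Sigma k * R := (iter n sshift z.1, z.2 + (birkhoff f n \_ X) z.1).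
have mflow : measurable_fun setT flow.
  apply: measurable_fun_pair.
    by apply: (measurableT_comp (measurable_iter_sshift n)); exact: measurable_fst.
  apply: measurable_funD; first exact: measurable_snd.
  by apply: (measurableT_comp mfn'); exact: measurable_fst.
have := measurable_funTS (D := X `*` setT) (measurableT_comp measurable_fourier_stieltjes mflow).
apply: eq_measurable_fun => -[x r]; rewrite inE /= => -[Xx _].
by rewrite !patchE !mem_set//; exact: SFT_iter.
Qed.

End component_measurability.

Section component_transfer.
Context {R : realType} {k : nat} (M : rel 'I_k.+1) (mu : probability (Sigma k) R).
Context (g : Sigma k -> R) (q th A : R).
Notation X := (SFT M).
Notation leb := (@lebesgue_measure R).
Hypothesis NW : normalized_weight M g q th A.
Hypothesis muX : mu X = 1%E.
Hypothesis transfer : forall n (G : Sigma k -> R) (B : R), measurable_fun X G ->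
  (forall x, X x -> `|G x| <= B) ->
  measurable_fun X (iter n (ruelle M g) G) /\
  \int[mu]_(x in X) iter n (ruelle M g) G x = \int[mu]_(x in X) G x.

Lemma fine_muX : fine (mu X) = 1 :> R.
Proof. by rewrite (_ : mu X = 1%E). Qed.

Lemma ruelle_iter_mean_decay (V : R) w kk : 0 <= V -> lipX X th V w ->
  exists2 C : R, 0 <= C & forall n, (0 < n)%N -> forall y, X y ->
    `|iter n (ruelle M g) w y - \int[mu]_(x in X) w x| <= C * n%:R ^- kk.
Proof.
move=> V0 hw; have [n0 [n0_gt0 gap]] := normalized_gap NW.
have th01 : 0 <= th < 1 by have /andP[/ltW ->] := nw_th NW.
have osc n : oscX X (V / 2 ^+ (n %/ n0)) (iter n (ruelle M g) w).
  rewrite {2}(divn_eq n n0) addnC iterD; apply: (normalized_osc NW).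
  suff h j : lipX X th (V / 2 ^+ j) (iter (j * n0) (ruelle M g) w).
    move=> x y Xx Xy; have := h (n %/ n0)%N 0%N x y Xx Xy; rewrite expr0 mulr1.
    by move=> /(_ (fun i (Hi : (i < 0)%N) => False_ind _ (notF Hi))); apply: le_trans; exact: ler_norm.
  elim: j => [|j IH]; first by rewrite expr0 divr1.
  rewrite mulSn iterD exprSr invfM mulrA; apply: gap => //.
  by rewrite divr_ge0// exprn_ge0.
have [C C0 hC] := @power_decay R kk.
exists (V * C * (4 * n0%:R) ^+ kk); first by rewrite !mulr_ge0// exprn_ge0// mulr_ge0.
move=> n n_gt0 y Xy.
have nR : 0 < n%:R :> R by rewrite ltr0n.
have n0R : 0 < n0%:R :> R by rewrite ltr0n.
have [B B0 wB] := lipX_bounded hw.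
have mw : measurable_fun X w := measurable_lipX th01 hw.
have [mv vE] := transfer n mw wB.
set v := iter n (ruelle M g) w in mv vE *.
have mX := measurable_SFT M.
apply: (@le_trans _ _ (V / 2 ^+ (n %/ n0))).
  have vB x : X x -> `|v x| <= B.
    move=> Xx; rewrite -[v x]subr0; apply: (normalized_norm NW) => // z Xz _.
    by rewrite subr0 wB.
  have yE : v y = \int[mu]_(x in X) v y.
    by rewrite Rintegral_cst// fine_muX mulr1.
  rewrite -vE {1}yE -RintegralB//; last 2 first.
  - by apply: (@bounded_integrable _ _ _ mu _ mX _ `|v y|) => //; exact: measurable_cst.
  - exact: (@bounded_integrable _ _ _ mu _ mX _ B).
  rewrite -[leRHS]mulr1 -[X in _ <= _ * X]fine_muX; apply: bounded_Rintegral_norm => //.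
    by apply: measurable_funB => //; exact: measurable_cst.
  move=> x Xx; rewrite ler_norml lerNl opprB; apply/andP; split.
    exact: (osc n x y Xx Xy).
  exact: (osc n y x Xy Xx).
rewrite -!mulrA ler_wpM2l//.
have := hC (4^-1) n n0; rewrite invr_ge0 ler0n lexx => /(_ isT n0_gt0).
have nk : 0 < n%:R ^+ kk :> R by rewrite exprn_gt0.
rewrite [_ * (_ / _)]mulrA ler_pdivlMr// => h.
have nk4 : 0 < (4 * n0%:R) ^+ kk :> R by rewrite exprn_gt0// mulr_gt0.
rewrite -ler_pdivrMr//; apply: le_trans h.
have -> : 4^-1 * n%:R / n0%:R = n%:R / (4 * n0%:R) :> R by rewrite invfM; ring.
rewrite expr_div_n mulrA ler_wpM2r ?invr_ge0 ?(ltW nk4)// ler_wpM2r ?(ltW nk)//.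
by rewrite -exprVn lerXn2r ?nnegrE//; lra.
Qed.

Lemma ruelle_iter_signed_integral (l1 l2 : {finite_measure set R -> \bar R})
  (H : R -> Sigma k -> R) (B : R) n y : X y ->
  (forall x, X x -> measurable_fun setT (H ^~ x)) ->
  (forall xi x, X x -> `|H xi x| <= B) ->
  measurable_fun setT (fun xi => iter n (ruelle M g) (H xi) y) /\
  iter n (ruelle M g) (fun x => signed_integral l1 l2 setT (H ^~ x)) y =
  signed_integral l1 l2 setT (fun xi => iter n (ruelle M g) (H xi) y).
Proof.
move=> Xy mH HB; elim: n y Xy => [|n IH] y Xy /=; first by split; [exact: mH|].
have hS a : M a (y 0%N) -> X (scons a y) by exact: SFT_scons.
have bd a xi : M a (y 0%N) -> `|iter n (ruelle M g) (H xi) (scons a y)| <= B.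
  move=> /hS Xa; rewrite -[iter _ _ _ _]subr0; apply: (normalized_norm NW) => // z Xz _.
  by rewrite subr0 HB.
split.
  apply: measurable_sum_cond => a /hS Xa; apply: measurable_funM; first exact: measurable_cst.
  by have [] := IH _ Xa.
transitivity (\sum_(a | M a (y 0%N)) g (scons a y) *
    signed_integral l1 l2 setT (fun xi => iter n (ruelle M g) (H xi) (scons a y))).
  by apply: eq_bigr => a /hS Xa; have [_ ->] := IH _ Xa.
have E (m : {finite_measure set R -> \bar R}) :
    \sum_(a | M a (y 0%N)) g (scons a y) *
      \int[m]_(xi in setT) iter n (ruelle M g) (H xi) (scons a y) =
    \int[m]_(xi in setT) ruelle M g (iter n (ruelle M g) (H xi)) y.
  have ms a : M a (y 0%N) -> measurable_fun setT (fun xi => iter n (ruelle M g) (H xi) (scons a y)).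
    by move=> /hS Xa; have [] := IH _ Xa.
  rewrite /ruelle (@bounded_Rintegral_sum _ _ _ m setT _ _ _ _ (fun a => `|g (scons a y)| * B))//.
  - apply: eq_bigr => a Ma; rewrite RintegralZl//.
    by apply: (@bounded_integrable _ _ _ m _ measurableT _ B) => [|xi _]; [exact: ms|exact: bd].
  - by move=> a Ma; apply: measurable_funM; [exact: measurable_cst|exact: ms].
  - by move=> a xi Ma _; rewrite normrM ler_wpM2l// bd.
rewrite /signed_integral -!E -sumrB; apply: eq_bigr => a _.
by rewrite mulrBr.
Qed.

End component_transfer.

Section cosine_average.
Context {R : realType}.
Notation leb := (@lebesgue_measure R).
Implicit Types (T xi om : R).

Definition cosine_average T xi om : R :=
  (2 * T)^-1 * \int[leb]_(r in `[- T, T]) cos (r * xi + om).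

Lemma cosine_average0 T om : 0 < T -> cosine_average T 0 om = cos om.
Proof.
move=> T0; have NTT : - T < T by lra.
rewrite /cosine_average; under eq_Rintegral do rewrite mulr0 add0r.
rewrite Rintegral_cst//= lebesgue_measure_itv/= lte_fin NTT/= opprK.
by field; rewrite gt_eqF.
Qed.

Lemma cosine_averageE T xi om : 0 < T -> xi != 0 -> cosine_average T xi om =
  (cos (T * xi + (om - pi / 2)) - cos (- T * xi + (om - pi / 2))) / (2 * T * xi).
Proof.
move=> T0 xi0; pose F r : R := xi^-1 * cos (r * xi + (om - pi / 2)).
have dF (r : R) : is_derive r (1 : R) F (cos (r * xi + om)).
  pose A := xi \*: (@id R) + cst (om - pi / 2).
  have AE z : A z = z * xi + (om - pi / 2) by rewrite /A !fctE /= [_ *: _]mulrC.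
  have d2 : is_derive r 1 A xi.
    have dZ := is_deriveZ xi (is_derive_id r (1 : R)).
    have dA := is_deriveD dZ (is_derive_cst (om - pi / 2) r (1 : R)).
    by apply: (is_derive_eq dA); rewrite addr0 [_ *: _]mulr1.
  have d3 := is_derive1_comp (is_derive_cos (A r)) d2.
  have -> : F = xi^-1 \*: (cos \o A) by apply/funext => z; rewrite /F !fctE /= AE.
  apply: (is_derive_eq (is_deriveZ xi^-1 d3)).
  by rewrite AE addrA sinBpihalf opprK -[LHS]/(_ * _) mulrCA mulVf// mulr1.
have NTT : - T <= T by lra.
rewrite /cosine_average (FTC_diff NTT (@continuous_cos_affine _ xi om) dF) /F.
by field; rewrite xi0 gt_eqF.
Qed.

Lemma cosine_average_le T xi om : `|cosine_average T xi om| <= 1.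
Proof.
have [T0|T0|<-] := ltgtP 0 T; last first.
- by rewrite /cosine_average mulr0 invr0 mul0r normr0.
- by rewrite /cosine_average set_itv_ge ?Rintegral_set0 ?mulr0 ?normr0//= bnd_simp -ltNge; lra.
have [->|xi0] := eqVneq xi 0; first by rewrite cosine_average0// norm_cos_le1.
have xi1 : 0 < `|2 * T * xi| by rewrite normr_gt0 !mulf_neq0// gt_eqF.
rewrite cosine_averageE// normrM normfV ler_pdivrMr// mul1r.
apply: le_trans (cos_lipschitz _ _) _; rewrite le_eqVlt; apply/orP; left; apply/eqP.
by congr `|_|; ring.
Qed.

Lemma cosine_average_cvg (u : nat -> R) xi om : u @ \oo --> +oo ->
  (fun n => cosine_average (u n) xi om) @ \oo --> cos om * \1_[set 0] xi.
Proof.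
move=> uoo; have u1 A : \forall n \near \oo, A < u n by have /cvgryPgt := uoo; exact.
rewrite indicE; have [->|xi0] := eqVneq xi 0.
  rewrite mem_set// mulr1; apply: cvg_near_cst.
  by near=> n; apply: cosine_average0; near: n; exact: u1.
rewrite memNset; last by move=> /= xi_0; move/eqP: xi0; apply.
rewrite mulr0; apply/cvgr0Pnorm_lt => e e0.
near=> n.
have un : 0 < u n by near: n; exact: u1.
have xi1 : 0 < `|2 * u n * xi| by rewrite normr_gt0 !mulf_neq0// gt_eqF.
rewrite cosine_averageE// normrM normfV ltr_pdivrMr//.
apply: le_lt_trans (ler_normB _ _) _.
apply: (@le_lt_trans _ _ 2).
  by have := norm_cos_le1 (u n * xi + (om - pi / 2)); have := norm_cos_le1 (- u n * xi + (om - pi / 2)); lra.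
have exi : 0 < e * `|xi| by rewrite mulr_gt0// normr_gt0.
have : (e * `|xi|)^-1 < u n by near: n; exact: u1.
rewrite -div1r ltr_pdivrMr// !normrM (gtr0_norm un) ger0_norm// => h.
by rewrite (_ : e * _ = 2 * (u n * (e * `|xi|))) ?ltr_pMr//; ring.
Unshelve. all: by end_near. Qed.

End cosine_average.

Lemma signed_measure_le {d : measure_display} {T : measurableType d} {R : realType}
    (m1 m2 : {finite_measure set T -> \bar R}) (D E : set T) (V : R) :
  measurable E -> E `<=` D -> tv_le m1 m2 D V -> `|signed_measure m1 m2 E| <= V.
Proof.
move=> mE ED /(_ 1%N (fun=> E)); rewrite big_ord1; apply=> //.
by move=> i j /= ; rewrite !ltnS !leqn0 => /eqP-> /eqP->.
Qed.

Section mean_value.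
Context {R : realType} {k : nat} (M : rel 'I_k.+1) (mu : probability (Sigma k) R).
Notation X := (SFT M).
Notation leb := (@lebesgue_measure R).
Variables (m1 m2 : Sigma k -> {finite_measure set R -> \bar R}) (V om : R).
Hypothesis mm : forall E, measurable E ->
  measurable_fun X (fun x => signed_measure (m1 x) (m2 x) E).
Hypothesis mV : forall x, X x -> tv_le (m1 x) (m2 x) setT V.

Notation Phi := (fourier_stieltjes m1 m2 om).

Let segE (T : R) : [set r | - T <= r <= T] = `[- T, T]%classic.
Proof. by apply/seteqP; split => r /=; rewrite in_itv. Qed.

Lemma measurable_fourier_stieltjes_on (E : set R) : measurable E ->
  measurable_fun (X `*` E) (fun z => Phi z.1 z.2).
Proof.
move=> mE; have := measurable_funTS (D := X `*` E) (measurable_fourier_stieltjes om mm).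
apply: eq_measurable_fun => -[x r]; rewrite inE /= => -[Xx _].
by rewrite patchE mem_set.
Qed.

Lemma fourier_stieltjes_average x T : X x ->
  (2 * T)^-1 * \int[leb]_(r in `[- T, T]) Phi x r =
  signed_integral (m1 x) (m2 x) setT (fun xi => cosine_average T xi om) /\
  measurable_fun setT (fun xi => cosine_average T xi om).
Proof.
move=> Xx; set E : set R := `[- T, T]%classic.
have iE : leb.-integrable setT (EFin \o (\1_E : R -> R)).
  exact: integrable_indic_itv.
have fE xi : fourier (\1_E : R -> R) xi (om + xi * 0) = \int[leb]_(r in E) cos (r * xi + om).
  rewrite mulr0 addr0 /fourier [RHS]Rintegral_mkcond; apply: eq_Rintegral => r _.
  by rewrite patchE indicE; case: (r \in E); rewrite ?mul1r ?mul0r.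
have [mf i1 e1] := fourier_fubini (m1 x) 0 om iE.
have [_ i2 e2] := fourier_fubini (m2 x) 0 om iE.
have ma : measurable_fun setT (fun xi => cosine_average T xi om).
  apply: (@eq_measurable_fun _ _ _ _ _ (fun xi => (2 * T)^-1 * fourier (\1_E : R -> R) xi (om + xi * 0))).
    by move=> xi _; rewrite fE.
  by apply: measurable_funM => //; exact: measurable_cst.
have iav (m : {finite_measure set R -> \bar R}) :
    m.-integrable setT (EFin \o (fun xi => fourier (\1_E : R -> R) xi (om + xi * 0))).
  have [T0|T0] := eqVneq (2 * T) 0.
    apply: (@bounded_integrable _ _ _ m _ measurableT _ 0) => // xi _.
    have T00 : T = 0 by lra.
    by rewrite fE /E T00 oppr0 set_itv1 Rintegral_set1 normr0.
  apply: (@bounded_integrable _ _ _ m _ measurableT _ `|2 * T|) => // xi _.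
  have := cosine_average_le T xi om; rewrite /cosine_average -fE normrM normfV.
  by rewrite mulrC ler_pdivrMr ?normr_gt0// mul1r.
split => //.
have -> : \int[leb]_(r in E) Phi x r =
    \int[leb]_r (\1_E r * Phi x r).
  rewrite Rintegral_mkcond; apply: eq_Rintegral => r _.
  by rewrite patchE indicE; case: (r \in E); rewrite ?mul1r ?mul0r.
transitivity ((2 * T)^-1 * (\int[m1 x]_xi fourier (\1_E : R -> R) xi (om + xi * 0) -
   \int[m2 x]_xi fourier (\1_E : R -> R) xi (om + xi * 0))).
  rewrite -e1 -e2 -RintegralB//; congr (_ * _); apply: eq_Rintegral => r _.
  by rewrite /fourier_stieltjes /signed_integral addr0 mulrBr.
rewrite mulrBr /signed_integral -!RintegralZl//; [|exact: iav|exact: iav].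
by congr (_ - _); apply: eq_Rintegral => xi _; rewrite fE.
Qed.

Lemma mean_fourier_stieltjes :
  (forall T, (nu_prod mu).-integrable (X `*` [set r | - T <= r <= T])
     (EFin \o (fun z => Phi z.1 z.2))) /\
  (fun T => (2 * T)^-1 *
     \int[nu_prod mu]_(z in X `*` [set r | - T <= r <= T]) Phi z.1 z.2) @ +oo -->
  cos om * \int[mu]_(x in X) signed_measure (m1 x) (m2 x) [set 0].
Proof.
have mX := measurable_SFT M.
have H T : [/\ (nu_prod mu).-integrable (X `*` [set r | - T <= r <= T])
     (EFin \o (fun z => Phi z.1 z.2)),
   measurable_fun X (fun x => signed_integral (m1 x) (m2 x) setT (fun xi => cosine_average T xi om)) &
   (2 * T)^-1 * \int[nu_prod mu]_(z in X `*` [set r | - T <= r <= T]) Phi z.1 z.2 =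
   \int[mu]_(x in X) signed_integral (m1 x) (m2 x) setT (fun xi => cosine_average T xi om)].
  rewrite segE; have mE : measurable (`[- T, T]%classic : set R) by exact: measurable_itv.
  have mP := measurable_fourier_stieltjes_on mE.
  have [|i mI IB ->] := @nu_prod_integral _ _ mu X mX `[- T, T]%classic
      (fun z => Phi z.1 z.2) (`|V| * fine (leb `[- T, T]%classic)) mE mP.
    move=> x Xx; have fT : leb `[- T, T]%classic \is a fin_num.
      by rewrite lebesgue_measure_itv/=; case: ifP.
    rewrite EFinM fineK// -(integral_cst leb mE); apply: ge0_le_integral => //.
    - apply/measurable_EFinP; apply: measurableT_comp => //.
      have : measurable_fun `[- T, T]%classic ((fun z => Phi z.1 z.2) \o pair x).
        apply: (measurable_comp (F := X `*` `[- T, T]%classic)) mP (measurable_funTS (pair1_measurable x)).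
          exact: measurableX.
        by move=> _ [r rE <-].
      by [].
    - by move=> r _; rewrite lee_fin; apply: le_trans (ler_norm V); exact: (fourier_stieltjes_le _ mV).
  split => //.
    have : measurable_fun X (fun x => (2 * T)^-1 * \int[leb]_(r in `[- T, T]) Phi x r).
      by apply: measurable_funM => //; exact: measurable_cst.
    by apply: eq_measurable_fun => x; rewrite inE => Xx; have [-> _] := fourier_stieltjes_average T Xx.
  rewrite -RintegralZl//; last exact: (@bounded_integrable _ _ _ mu _ mX _ _ mI IB).
  by apply: eq_Rintegral => x; rewrite inE => Xx; have [-> _] := fourier_stieltjes_average T Xx.
split; first by move=> T; have [] := H T.
under eq_fun => T do have [_ _ ->] := H T.
apply/cvg_pinftyP => u uoo.
have -> : cos om * \int[mu]_(x in X) signed_measure (m1 x) (m2 x) [set 0] =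
    \int[mu]_(x in X) signed_integral (m1 x) (m2 x) setT (fun xi => cos om * \1_[set 0] xi).
  rewrite -RintegralZl//.
    apply: eq_Rintegral => x _; rewrite /signed_integral !RintegralZl//; last 2 first.
    - exact: integrable_indic.
    - exact: integrable_indic.
    by rewrite !Rintegral_indicI// !setTI mulrBr.
  apply: (@bounded_integrable _ _ _ mu _ mX _ V) => [|x Xx]; first exact: mm.
  exact: signed_measure_le (mV Xx).
apply: (@bounded_Rintegral_cvg _ _ _ mu X mX _ _ `|V|).
- by move=> n; have [] := H (u n).
- move=> n x Xx; rewrite -[`|V|]mul1r; apply: signed_integral_le => //.
  + by have [_] := fourier_stieltjes_average (u n) Xx.
  + by move=> xi _; exact: cosine_average_le.
  + by move=> l G hG tG; apply: le_trans (mV Xx hG tG) (ler_norm V).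
- move=> x Xx; apply: (@signed_integral_cvg _ _ _ _ _ _ _ _ 1) => //.
  + by move=> n; have [_] := fourier_stieltjes_average (u n) Xx.
  + by move=> n xi _; exact: cosine_average_le.
  + by move=> xi _; exact: cosine_average_cvg.
Qed.

End mean_value.

Section domination.
Context {d : measure_display} {T : measurableType d} {R : realType}.
Implicit Types (m : {finite_measure set T -> \bar R}) (D : set T).

(* Neither function is assumed measurable. *)
Lemma ge0_le_integral_nonmeasurable (m : {measure set T -> \bar R}) D (p t : T -> \bar R) :
  (forall x, D x -> (0 <= p x)%E) -> (forall x, D x -> (p x <= t x)%E) ->
  (\int[m]_(x in D) p x <= \int[m]_(x in D) t x)%E.
Proof.
move=> p0 pt; rewrite !ge0_integralE//; last by move=> x Dx; exact: le_trans (p0 x Dx) (pt x Dx).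
apply: le_ereal_sup => _ [h hp <-]; exists h => //= x; apply: le_trans (hp x) _.
by rewrite !patchE; case: ifPn => // xD; apply: pt; rewrite inE in xD.
Qed.

Lemma Rintegral_dominated m D (h t : T -> R) (B C c : R) : measurable D ->
  fine (m D) <= 1 -> measurable_fun D h -> (forall x, D x -> `|h x| <= B) ->
  0 < C -> 0 <= c -> (forall x, D x -> 0 <= t x) ->
  (forall x, D x -> `|h x| <= C * t x + c) ->
  (`|\int[m]_(x in D) h x|%:E <= C%:E * \int[m]_(x in D) (t x)%:E + c%:E)%E.
Proof.
move=> mD mD1 mh hB C0 c0 t0 ht.
pose p x := C^-1 * Num.max (`|h x| - c) 0.
have p0 x : 0 <= p x by rewrite mulr_ge0 ?invr_ge0 ?(ltW C0)// le_max lexx orbT.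
have mp : measurable_fun D p.
  apply: measurable_funM; first exact: measurable_cst.
  apply: measurable_maxr; last exact: measurable_cst.
  by apply: measurable_funB; [exact: measurableT_comp|exact: measurable_cst].
have pt x : D x -> p x <= t x.
  move=> Dx; rewrite /p ler_pdivrMl// ge_max mulr_ge0 ?(ltW C0) ?t0// andbT.
  by rewrite lerBlDr ht.
have pB x : D x -> `|p x| <= C^-1 * `|B|.
  move=> Dx; rewrite ger0_norm// ler_wpM2l ?invr_ge0 ?(ltW C0)// ge_max normr_ge0 andbT.
  by rewrite lerBlDr (le_trans (hB x Dx))// (le_trans (ler_norm B))// lerDl.
have ip := bounded_integrable m mD mp pB.
have ih := bounded_integrable m mD mh hB.
have ic : m.-integrable D (EFin \o (fun=> c)).
  by apply: (@bounded_integrable _ _ _ m _ mD _ `|c|) => //; exact: measurable_cst.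
have iCp := integrableZl mD C ip.
apply: (@le_trans _ _ (C * \int[m]_(x in D) p x + c)%:E).
  rewrite lee_fin; apply: le_trans (le_normr_Rintegral mD ih) _.
  apply: (@le_trans _ _ (\int[m]_(x in D) (C * p x + c))).
    apply: le_Rintegral => //.
    - apply: (@bounded_integrable _ _ _ m _ mD _ B) => [|x Dx]; last by rewrite normr_id hB.
      exact: measurableT_comp.
    - exact: (integrableD mD iCp ic).
    - by move=> x Dx; rewrite /p mulrA divff ?gt_eqF// mul1r -lerBlDr le_max lexx.
  rewrite RintegralD// RintegralZl// lerD2l Rintegral_cst//.
  by rewrite -[leRHS]mulr1 ler_wpM2l.
rewrite EFinD EFinM leeD2r// lee_pmul2l ?lte_fin//.
rewrite /Rintegral fineK; last by have := integrable_fin_num mD ip.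
by apply: ge0_le_integral_nonmeasurable => x Dx; rewrite lee_fin ?p0 ?pt.
Qed.

Lemma tv_le_sub m1 m2 D D' (V : R) : D' `<=` D -> tv_le m1 m2 D V -> tv_le m1 m2 D' V.
Proof.
move=> DD h n F hF; apply: h => j jn; have [mF FD] := hF j jn.
by split => //; exact: subset_trans DD.
Qed.

Lemma signed_integral_set1 (m1 m2 : {finite_measure set T -> \bar R}) (a : T) (h : T -> R) :
  measurable [set a] ->
  signed_integral m1 m2 [set a] h = h a * signed_measure m1 m2 [set a].
Proof.
move=> ma; have E (m : {finite_measure set T -> \bar R}) :
    \int[m]_(x in [set a]) h x = h a * fine (m [set a]).
  by rewrite -Rintegral_cst//; apply: eq_Rintegral => s; rewrite inE => ->.
by rewrite /signed_integral /signed_measure !E mulrBr.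
Qed.

Lemma signed_integral_setU (m1 m2 : {finite_measure set T -> \bar R}) D E (h : T -> R) (B : R) :
  measurable D -> measurable E -> [disjoint D & E]%classic -> measurable_fun setT h ->
  (forall x, `|h x| <= B) ->
  signed_integral m1 m2 (D `|` E) h = signed_integral m1 m2 D h + signed_integral m1 m2 E h.
Proof.
move=> mD mE DE mh hB.
have ih m : m.-integrable (D `|` E) (EFin \o h).
  apply: (@bounded_integrable _ _ _ m _ _ _ B) => //; first exact: measurableU.
  exact: measurable_funTS.
by rewrite /signed_integral (Rintegral_setU mD mE (ih m1) DE) (Rintegral_setU mD mE (ih m2) DE) opprD addrACA.
Qed.

End domination.

Section component.
Context {R : realType} {k : nat} (M : rel 'I_k.+1) (mu : probability (Sigma k) R).
Context (g f : Sigma k -> R) (q th A F : R).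
Notation X := (SFT M).
Notation leb := (@lebesgue_measure R).
Hypothesis NW : normalized_weight M g q th A.
Hypothesis muX : mu X = 1%E.
Hypothesis transfer : forall n (G : Sigma k -> R) (B : R), measurable_fun X G ->
  (forall x, X x -> `|G x| <= B) ->
  measurable_fun X (iter n (ruelle M g) G) /\
  \int[mu]_(x in X) iter n (ruelle M g) G x = \int[mu]_(x in X) G x.
Hypothesis hf : lipX X th F f.
Variable u : Sigma k -> R -> R.
Hypothesis su : forall x, X x -> schwartz_real (u x).
Hypothesis uL : forall l, exists2 L, 0 <= L & forall n x y, X x -> X y -> agree n x y ->
  \int[leb]_r `|derive1n l (u x) r - derive1n l (u y) r| <= L * th ^+ n.

Let th01 : 0 <= th < 1.
Proof. by have /andP[/ltW ->] := nw_th NW. Qed.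

Let mX : measurable X := measurable_SFT M.

Lemma derivative_norm_bounded l : exists2 D, 0 <= D &
  forall x, X x -> \int[leb]_r `|derive1n l (u x) r| <= D.
Proof.
have [L L0 hL] := uL l.
have lip : lipX X th L (fun x => \int[leb]_r `|derive1n l (u x) r|).
  move=> n x y Xx Xy xy; apply: le_trans (hL n x y Xx Xy xy).
  have sx := schwartz_derive1n l (su Xx); have sy := schwartz_derive1n l (su Xy).
  have ix := integrable_norm (schwartz_integrable sx).
  have iy := integrable_norm (schwartz_integrable sy).
  have id := integrable_norm (integrable_subr sx sy).
  rewrite -RintegralB//; apply: le_trans (le_normr_Rintegral measurableT (integrableB measurableT ix iy)) _.
  apply: le_Rintegral => //.
  - exact: integrable_norm (integrableB measurableT ix iy).
  - by move=> r _; exact: ler_dist_dist.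
have [B B0 hB] := lipX_bounded lip; exists B => // x Xx.
by apply: le_trans (hB x Xx); exact: ler_norm.
Qed.

Lemma fourier_family_decay l : exists2 D, 0 <= D & forall xi om,
  (forall x, X x -> `|xi| ^+ l * `|fourier (u x) xi om| <= D) /\
  (forall n x y, X x -> X y -> agree n x y ->
    `|xi| ^+ l * `|fourier (u x) xi om - fourier (u y) xi om| <= D * th ^+ n).
Proof.
have [L L0 hL] := uL l; have [D D0 hD] := derivative_norm_bounded l.
exists (L + D); first exact: addr_ge0.
move=> xi om; split=> [x Xx|n x y Xx Xy xy].
  by apply: le_trans (fourier_decay l xi om (su Xx)) _; apply: le_trans (hD x Xx) _; rewrite lerDr.
apply: le_trans (fourier_diff_decay l xi om (su Xx) (su Xy)) _.
apply: le_trans (hL n x y Xx Xy xy) _.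
by rewrite ler_wpM2r ?lerDl// exprn_ge0//; have /andP[] := th01.
Qed.

Lemma integral_family_lip : exists2 L, 0 <= L & lipX X th L (fun x => \int[leb]_r u x r).
Proof.
have [L L0 hL] := uL 0; exists L => // n x y Xx Xy xy.
apply: le_trans (hL n x y Xx Xy xy).
have ix := schwartz_integrable (su Xx); have iy := schwartz_integrable (su Xy).
rewrite -RintegralB//; exact: le_normr_Rintegral measurableT (integrable_subr (su Xx) (su Xy)).
Qed.

Lemma measurable_schwartz_family : measurable_fun (X `*` setT) (fun z : Sigma k * R => u z.1 z.2).
Proof.
have : measurable_fun setT (fun z : Sigma k * R => ((u ^~ z.2) \_ X) z.1).
  apply: measurable_on_SFT => [r|x s r Xx sr].
    have [L L0 hL] := uL 1; apply: (measurable_lipX th01 (V := L)) => n x y Xx Xy xy.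
    by apply: le_trans (schwartz_diff_le r (su Xx) (su Xy)) _; exact: hL.
  by apply: (cvg_comp _ _ sr); exact: schwartz_continuous (su Xx) r.
move/(measurable_funTS (D := X `*` setT)); apply: eq_measurable_fun => -[x r].
by rewrite inE /= => -[Xx _]; rewrite patchE mem_set.
Qed.

Lemma EFin_integral_norm (v : R -> R) : leb.-integrable setT (EFin \o v) ->
  (\int[leb]_r `|v r|%:E = (\int[leb]_r `|v r|)%:E)%E.
Proof.
move=> iv; rewrite /Rintegral fineK//.
by have := integrable_fin_num measurableT (integrable_norm iv).
Qed.

Lemma integral_schwartz_family :
  (nu_prod mu).-integrable (X `*` setT) (EFin \o (fun z => u z.1 z.2)) /\
  \int[nu_prod mu]_(z in X `*` setT) u z.1 z.2 = \int[mu]_(x in X) \int[leb]_r u x r.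
Proof.
have [D D0 hD] := derivative_norm_bounded 0.
have [] := @nu_prod_integral _ _ mu X mX setT (fun z => u z.1 z.2) D measurableT measurable_schwartz_family.
  move=> x Xx; rewrite (EFin_integral_norm (schwartz_integrable (su Xx))) lee_fin.
  exact: hD.
by [].
Qed.

Variables (m1 m2 : Sigma k -> {finite_measure set R -> \bar R}) (V om : R).
Hypothesis mm : forall E, measurable E ->
  measurable_fun X (fun x => signed_measure (m1 x) (m2 x) E).
Hypothesis mV : forall x, X x -> tv_le (m1 x) (m2 x) setT V.

Let twisted n (y : Sigma k) : R := signed_integral (m1 y) (m2 y) setT
  (fun xi => twist M g f xi n (fun x om => fourier (u x) xi om) y om).

Lemma correlation_integral n :
  [/\ (nu_prod mu).-integrable (X `*` setT) (EFin \o (fun z => 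
        fourier_stieltjes m1 m2 om (iter n sshift z.1) (z.2 + birkhoff f n z.1) * u z.1 z.2)),
     measurable_fun X (twisted n) &
     \int[nu_prod mu]_(z in X `*` setT) 
        (fourier_stieltjes m1 m2 om (iter n sshift z.1) (z.2 + birkhoff f n z.1) * u z.1 z.2) =
     \int[mu]_(y in X) twisted n y].
Proof.
have mf : measurable_fun X f := measurable_lipX th01 hf.
have [D D0 hD] := derivative_norm_bounded 0.
pose Gz (z : Sigma k * R) :=
  fourier_stieltjes m1 m2 om (iter n sshift z.1) (z.2 + birkhoff f n z.1) * u z.1 z.2.
have mG : measurable_fun (X `*` setT) Gz.
  by apply: measurable_funM; [exact: measurable_fourier_stieltjes_flow|exact: measurable_schwartz_family].
have [|iG mF FB FE] := @nu_prod_integral _ _ mu X mX setT Gz (`|V| * D) measurableT mG.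
  move=> x Xx; have iu := schwartz_integrable (su Xx).
  have iV := integrableZl measurableT `|V| (integrable_norm iu).
  apply: (@le_trans _ _ (\int[leb]_r (`|V| * `|u x r|)%:E)%E).
    apply: ge0_le_integral => //.
    - apply/measurable_EFinP; apply: measurableT_comp => //.
      have : measurable_fun setT (Gz \o pair x).
        apply: (measurable_comp (F := X `*` setT)) mG (pair1_measurable x); first exact: measurableX.
        by move=> _ [r _ <-].
      by [].
    - by have /integrableP[] := iV.
    - move=> r _; rewrite lee_fin /Gz /= normrM ler_wpM2r//.
      by apply: le_trans (ler_norm V); exact: (fourier_stieltjes_le _ mV _ (SFT_iter n Xx)).
  rewrite (_ : (\int[leb]_r (`|V| * `|u x r|)%:E)%E = (`|V| * \int[leb]_r `|u x r|)%:E).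
    by rewrite lee_fin ler_wpM2l// hD.
  rewrite EFinM -EFin_integral_norm// -ge0_integralZl//.
  by have /integrableP[] := integrable_norm iu.
have GE x : X x -> \int[leb]_r Gz (x, r) =
    signed_integral (m1 (iter n sshift x)) (m2 (iter n sshift x)) setT
      (fun xi => fourier (u x) xi (om + xi * birkhoff f n x)).
  move=> Xx; have iu := schwartz_integrable (su Xx).
  rewrite /signed_integral.
  have [_ i1 <-] := fourier_fubini (m1 (iter n sshift x)) (birkhoff f n x) om iu.
  have [_ i2 <-] := fourier_fubini (m2 (iter n sshift x)) (birkhoff f n x) om iu.
  rewrite -RintegralB//; apply: eq_Rintegral => r _.
  by rewrite /Gz /= /fourier_stieltjes /signed_integral mulrC mulrBr.
have LE y : X y -> iter n (ruelle M g) (fun x => \int[leb]_r Gz (x, r)) y = twisted n y.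
  move=> Xy; rewrite /twisted.
  rewrite (@ruelle_iter_eq _ _ _ _ _ _ (fun x => signed_integral (m1 y) (m2 y) setT
    ((fun xi x => fourier (u x) xi (om + xi * birkhoff f n x)) ^~ x))) //; last first.
    by move=> x Xx <-; exact: GE.
  have [D' D'0 hD'] := fourier_family_decay 0.
  have [|xi x Xx|_ ->//] := ruelle_iter_signed_integral NW (m1 y) (m2 y) (B := D') n Xy
    (H := fun xi x => fourier (u x) xi (om + xi * birkhoff f n x)).
    by move=> x Xx; have [] := fourier_fubini (m1 y) (birkhoff f n x) om (schwartz_integrable (su Xx)).
  by have [/(_ x Xx)] := hD' xi (om + xi * birkhoff f n x); rewrite expr0 mul1r.
have [mL LI] := transfer n mF FB.
split => //.
  by apply: eq_measurable_fun mL => y; rewrite inE; exact: LE.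
rewrite FE -LI; apply: eq_Rintegral => y; rewrite inE => Xy.
exact: LE.
Qed.

Hypothesis F0 : 0 <= F.
Variables (c0 N : nat).
Hypothesis acc : accessible X f c0 N.
Hypothesis X0 : exists x, X x.
Variables (kk : nat) (eps : R).
Hypothesis eps0 : 0 < eps.

Notation punctured rho := ([set s : R | - rho < s < rho] `\` [set 0]).
Notation W xi := (fun x om => fourier (u x) xi om).

Lemma twist_fourier_le : exists2 D, 0 <= D & forall n y, X y ->
  measurable_fun setT (fun xi => twist M g f xi n (W xi) y om) /\
  forall xi, `|twist M g f xi n (W xi) y om| <= D.
Proof.
have [D D0 hD] := fourier_family_decay 0.
exists D => // n y Xy.
have hDD xi x : X x -> `|W xi x (om + xi * birkhoff f n x)| <= D.
  by move=> Xx; have [/(_ x Xx)] := hD xi (om + xi * birkhoff f n x); rewrite expr0 mul1r.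
split=> [|xi].
  have [x Xx|xi x Xx|//] := ruelle_iter_signed_integral NW (m1 y) (m2 y) (B := D) n Xy
    (H := fun xi x => W xi x (om + xi * birkhoff f n x)); last exact: hDD.
  by have [] := fourier_fubini (m1 y) (birkhoff f n x) om (schwartz_integrable (su Xx)).
rewrite -[twist _ _ _ _ _ _ _ _]subr0; apply: (normalized_norm NW) => // x Xx _.
by rewrite subr0 hDD.
Qed.

Lemma twist_decay : exists2 C, 0 <= C & forall n, (0 < n)%N -> forall y v, X y -> 0 <= v ->
  tv_le (m1 y) (m2 y) (punctured (n%:R `^ (- 2^-1 + eps))) v ->
  `|signed_integral (m1 y) (m2 y) setT (fun xi => twist M g f xi n (W xi) y om) -
    cos om * signed_measure (m1 y) (m2 y) [set 0] * \int[mu]_(x in X) \int[leb]_r u x r| <=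
  C * v + C * n%:R ^- kk.
Proof.
have [L L0 lipw] := integral_family_lip.
have [C1 C10 hC1] := ruelle_iter_mean_decay NW muX transfer kk L0 lipw.
have Wtrig xi : trigonometric M (W xi) by move=> x Xx om'; exact: fourier_trig (su Xx).
have [C2 C20 hC2] := spectral_decay NW hf F0 acc X0 Wtrig fourier_family_decay kk eps0.
have [D D0 hD] := twist_fourier_le.
exists (D + C1 * `|V| + C2 * `|V|); first by rewrite !addr_ge0// mulr_ge0.
move=> n n0 y v Xy v0 hv; set rho := _ `^ _ in hv.
have rho0 : 0 < rho by rewrite powR_gt0// ltr0n.
set I := Rintegral _ _ _.
pose h xi := twist M g f xi n (W xi) y om.
have [mh hB] := hD n y Xy.
pose far := [set s : R | rho <= `|s|].
have mball : measurable [set s : R | - rho < s < rho].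
  by rewrite (_ : mkset _ = `]- rho, rho[%classic)//; apply/seteqP; split => r /=; rewrite in_itv.
have farE : far = ~` [set s : R | - rho < s < rho].
  by apply/seteqP; split => s; rewrite /far /= -ltr_norml leNgt => /negP.
have mfar : measurable far by rewrite farE; exact: measurableC.
have mpunct : measurable (punctured rho) by exact: measurableD.
have -> : [set: R] = [set 0] `|` (punctured rho `|` far).
  apply/seteqP; split => // s _; have [->|s0] := eqVneq s 0; first by left.
  right; rewrite farE; have [hs|hs] := pselect ([set s : R | - rho < s < rho] s); last by right.
  by left; split => //= s_0; move/eqP: s0; apply.
have m0far : measurable (punctured rho `|` far) by exact: measurableU.
rewrite (signed_integral_setU _ _ (B := D)) //; last first.
  apply/disj_setPS => s [/= ->] [[_]|]; first exact.
  by rewrite farE /= oppr_lt0 rho0.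
rewrite (signed_integral_setU _ _ (B := D) mpunct mfar) //; last first.
  by apply/disj_setPS => s [[hs _]]; rewrite farE.
have h0E : h 0 = cos om * iter n (ruelle M g) (fun x => \int[leb]_r u x r) y.
  rewrite -ruelle_iterZ; apply: ruelle_iter_eq => // x Xx _.
  by rewrite mul0r addr0 fourier0//; exact: su.
have -> : signed_integral (m1 y) (m2 y) [set 0] h = h 0 * signed_measure (m1 y) (m2 y) [set 0].
  exact: signed_integral_set1 (measurable_set1 0).
have b1 := signed_measure_le (measurable_set1 0) (@subsetT _ _) (mV Xy).
have b2 : `|signed_integral (m1 y) (m2 y) (punctured rho) h| <= D * v.
  by apply: signed_integral_le hv => // xi _; exact: hB.
have b3 : `|signed_integral (m1 y) (m2 y) far h| <= C2 * n%:R ^- kk * V.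
  apply: signed_integral_le (tv_le_sub (@subsetT _ _) (mV Xy)) => //; first by rewrite mulr_ge0.
  by move=> xi rxi; exact: hC2.
have b4 : `|h 0 - cos om * I| <= C1 * n%:R ^- kk.
  rewrite h0E -mulrBr normrM; apply: le_trans (hC1 n n0 y Xy).
  by rewrite ler_piMl// norm_cos_le1.
have b5 : `|h 0 * signed_measure (m1 y) (m2 y) [set 0] -
    cos om * signed_measure (m1 y) (m2 y) [set 0] * I| <= C1 * n%:R ^- kk * `|V|.
  rewrite mulrAC -mulrBl normrM; apply: ler_pM => //.
  exact: le_trans b1 (ler_norm V).
have b6 : C2 * n%:R ^- kk * V <= C2 * n%:R ^- kk * `|V|.
  by apply: ler_wpM2l (ler_norm V); rewrite mulr_ge0.
rewrite addrAC; apply: le_trans (ler_normD _ _) _; apply: le_trans (lerD b5 (ler_normD _ _)) _.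
apply: le_trans (lerD (lexx _) (lerD b2 (le_trans b3 b6))) _.
rewrite -subr_ge0 (_ : _ - _ = (C1 * `|V| + C2 * `|V|) * v + D * n%:R ^- kk); last by ring.
by rewrite addr_ge0// mulr_ge0// addr_ge0// mulr_ge0.
Qed.

Lemma component_decay : exists2 C, 0 < C & forall n, (0 < n)%N -> forall t : Sigma k -> R,
  (forall x, X x -> 0 <= t x) ->
  (forall x, X x -> tv_le (m1 x) (m2 x) (punctured (n%:R `^ (- 2^-1 + eps))) (t x)) ->
  (`|\int[nu_prod mu]_(z in X `*` setT)
        (fourier_stieltjes m1 m2 om (iter n sshift z.1) (z.2 + birkhoff f n z.1) * u z.1 z.2) -
     cos om * \int[mu]_(x in X) signed_measure (m1 x) (m2 x) [set 0%R] *
     \int[nu_prod mu]_(z in X `*` setT) u z.1 z.2|%:E <=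
   C%:E * (\int[mu]_(x in X) (t x)%:E + (n%:R ^- kk)%:E))%E.
Proof.
have [C C0 hC] := twist_decay.
have C1 : 0 < C + 1 by rewrite ltr_wpDl.
exists (C + 1) => // n n0 t t0 ht.
have [_ mtw ->] := correlation_integral n.
have [_ ->] := integral_schwartz_family.
set I := Rintegral mu X (fun x => \int[leb]_r u x r).
pose sm x := signed_measure (m1 x) (m2 x) [set 0].
have msm : measurable_fun X sm by exact: mm.
have smB x : X x -> `|sm x| <= V.
  by move=> Xx; exact: signed_measure_le (measurable_set1 0) (@subsetT _ _) (mV Xx).
have ism := bounded_integrable mu mX msm smB.
pose tw y := signed_integral (m1 y) (m2 y) setT (fun xi => twist M g f xi n (W xi) y om).
have [D D0 hD] := twist_fourier_le.
have twB y : X y -> `|tw y| <= D * V.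
  move=> Xy; have [mh hB] := hD n y Xy.
  by apply: signed_integral_le (mV Xy).
have itw := bounded_integrable mu mX mtw twB.
have iI := integrableZl mX (cos om * I) ism.
have -> : \int[mu]_(x in X) tw x - cos om * \int[mu]_(x in X) sm x * I =
    \int[mu]_(x in X) (tw x - cos om * I * sm x).
  by rewrite RintegralB// RintegralZl//; ring.
rewrite ge0_muleDr ?lee_fin//; last by apply: integral_ge0 => x Xx; rewrite lee_fin t0.
rewrite -EFinM; apply: (@Rintegral_dominated _ _ _ mu X _ t (D * V + `|cos om * I| * V)) => //.
- by rewrite le_eqVlt; apply/orP; left; apply/eqP; exact: fine_muX.
- apply: measurable_funB => //; apply: measurable_funM => //; exact: measurable_cst.
- move=> x Xx; apply: le_trans (ler_normB _ _) _; rewrite lerD ?twB//.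
  by rewrite normrM ler_wpM2l// smB.
- by rewrite mulr_ge0// ltW.
- move=> x Xx.
  have := hC n n0 x (t x) Xx (t0 x Xx) (ht x Xx).
  rewrite -/(tw x) -/(sm x) -/I (mulrAC (cos om)) => h; apply: le_trans h _.
  by rewrite lerD// ler_wpM2r ?t0// lerDl.
Qed.

End component.

(** * Complex measures and the covariance *)

Section complex_measures.
Context {R : realType}.
Implicit Types (eta : cmeasure R) (E : set R).

Lemma normr_le_sqrt_sum (a b : R) :
  `|a| <= Num.sqrt (a ^+ 2 + b ^+ 2) /\ `|b| <= Num.sqrt (a ^+ 2 + b ^+ 2).
Proof.
by rewrite -!sqrtr_sqr; split; apply: ler_wsqrtr; rewrite ?lerDl ?lerDr sqr_ge0.
Qed.

Lemma sqrt_sum_le (a b : R) : Num.sqrt (a ^+ 2 + b ^+ 2) <= `|a| + `|b|.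
Proof.
rewrite -[leRHS]ger0_norm ?addr_ge0// -sqrtr_sqr; apply: ler_wsqrtr.
rewrite sqrrD !real_normK ?num_real// lerD2r lerDl.
by rewrite mulrn_wge0// mulr_ge0.
Qed.

Lemma cm_tv_ge0 eta E : (0 <= cm_tv eta E)%E.
Proof.
apply: ereal_sup_ubound; exists 0%N, (fun=> set0); split => //; split; last by rewrite big_ord0.
by move=> i j.
Qed.

Lemma cm_tv_le eta E E' : E `<=` E' -> (cm_tv eta E <= cm_tv eta E')%E.
Proof.
move=> EE; apply: le_ereal_sup => _ [n [G [hG [tG ->]]]]; exists n, G; split => // j jn.
by have [? GE] := hG j jn; split => //; exact: subset_trans EE.
Qed.

Lemma cm_tv_tv_le eta E (v : R) : (cm_tv eta E <= v%:E)%E ->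
  tv_le (cm1 eta) (cm2 eta) E v /\ tv_le (cm3 eta) (cm4 eta) E v.
Proof.
move=> ev.
have h n (G : nat -> set R) : (forall j, (j < n)%N -> measurable (G j) /\ G j `<=` E) ->
    trivIset [set j | (j < n)%N] G ->
    \sum_(j < n) Num.sqrt (cm_re eta (G j) ^+ 2 + cm_im eta (G j) ^+ 2) <= v.
  move=> hG tG; rewrite -lee_fin; apply: le_trans ev; apply: ereal_sup_ubound.
  by exists n, G.
split=> n G hG tG; apply: le_trans (h n G hG tG); apply: ler_sum => j _.
  by have [] := normr_le_sqrt_sum (cm_re eta (G j)) (cm_im eta (G j)).
by have [] := normr_le_sqrt_sum (cm_re eta (G j)) (cm_im eta (G j)).
Qed.

End complex_measures.

Section components.
Context {R : realType} {k : nat} (eta : Sigma k -> cmeasure R).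
Notation leb := (@lebesgue_measure R).

Definition fs_re om := fourier_stieltjes (fun x => cm1 (eta x)) (fun x => cm2 (eta x)) om.
Definition fs_im om := fourier_stieltjes (fun x => cm3 (eta x)) (fun x => cm4 (eta x)) om.

Let cos_sin (m : {finite_measure set R -> \bar R}) (r : R) :
  \int[m]_(xi in setT) cos (r * xi + - (pi / 2)) = \int[m]_(xi in setT) sin (r * xi).
Proof. by apply: eq_Rintegral => xi _; rewrite cosBpihalf. Qed.

Let cos_cos (m : {finite_measure set R -> \bar R}) (r : R) :
  \int[m]_(xi in setT) cos (r * xi + 0) = \int[m]_(xi in setT) cos (r * xi).
Proof. by apply: eq_Rintegral => xi _; rewrite addr0. Qed.

Lemma FS_reE x r : FS_re (eta x) r = fs_re 0 x r + fs_im (- (pi / 2)) x r.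
Proof.
by rewrite /FS_re /fs_re /fs_im /fourier_stieltjes /signed_integral !cos_sin !cos_cos addrA.
Qed.

Lemma FS_imE x r : FS_im (eta x) r = fs_im 0 x r - fs_re (- (pi / 2)) x r.
Proof.
rewrite /FS_im /fs_re /fs_im /fourier_stieltjes /signed_integral !cos_sin !cos_cos.
by rewrite opprB addrA addrAC.
Qed.

Lemma L_plus_component (th th' : R) (X : set (Sigma k)) (p q : Sigma k -> R -> R) :
  0 < th < 1 -> th <= th' < 1 -> L_plus th X p q ->
  (forall x, X x -> schwartz_real (p x)) /\
  forall l, exists2 L, 0 <= L & forall n x y, X x -> X y -> agree n x y ->
    \int[leb]_r `|derive1n l (p x) r - derive1n l (p y) r| <= L * th' ^+ n.
Proof.
move=> th01 /andP[le1 lt1] [sch lip]; have [th0 th1] := andP th01.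
split=> [x Xx|l]; first by have [] := sch x Xx.
have [L hL] := lip l; exists `|L| => // n x y Xx Xy xy.
have [sx _] := sch x Xx; have [sy _] := sch y Xy.
have i := integrable_subr (schwartz_derive1n l sx) (schwartz_derive1n l sy).
rewrite -lee_fin -(EFin_integral_norm i).
apply: le_trans (le_trans (hL x y Xx Xy) _).
  apply: ge0_le_integral_nonmeasurable => r _; rewrite lee_fin//.
  by have [] := normr_le_sqrt_sum (derive1n l (p x) r - derive1n l (p y) r)
    (derive1n l (q x) r - derive1n l (q y) r).
rewrite lee_fin; apply: le_trans (ler_wpM2r (dtheta_ge0 x y th01) (ler_norm L)) _.
rewrite ler_wpM2l//; apply: le_trans (dtheta_agree th01 xy) _.
by rewrite lerXn2r ?nnegrE ?(ltW th0)//; exact: le_trans (ltW th0) le1.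
Qed.

Lemma L_plusC (th : R) (X : set (Sigma k)) (p q : Sigma k -> R -> R) :
  L_plus th X p q -> L_plus th X q p.
Proof.
move=> [sch lip]; split=> [x /sch[]|l]; first by split.
have [L hL] := lip l; exists L => x y Xx Xy.
by under eq_integral do rewrite addrC; exact: hL.
Qed.

End components.

Section nu_prod_linearity.
Context {R : realType} {k : nat} (mu : probability (Sigma k) R) (X : set (Sigma k)) (E : set R).
Hypotheses (mX : measurable X) (mE : measurable E).
Notation integrable_on a := ((nu_prod mu).-integrable (X `*` E) (EFin \o a)).
Implicit Types a b : Sigma k * R -> R.

Lemma nu_prod_integrableD a b : integrable_on a -> integrable_on b ->
  integrable_on (fun z => a z + b z).
Proof.
by move=> ia ib; apply: (integrableD _ ia ib); exact: measurableX.
Qed.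

Lemma nu_prod_integrableB a b : integrable_on a -> integrable_on b ->
  integrable_on (fun z => a z - b z).
Proof.
by move=> ia ib; apply: (integrableB _ ia ib); exact: measurableX.
Qed.

Lemma nu_prod_integralD a b : integrable_on a -> integrable_on b ->
  \int[nu_prod mu]_(z in X `*` E) (a z + b z) =
  \int[nu_prod mu]_(z in X `*` E) a z + \int[nu_prod mu]_(z in X `*` E) b z.
Proof. by move=> ia ib; apply: RintegralD => //; exact: measurableX. Qed.

Lemma nu_prod_integralB a b : integrable_on a -> integrable_on b ->
  \int[nu_prod mu]_(z in X `*` E) (a z - b z) =
  \int[nu_prod mu]_(z in X `*` E) a z - \int[nu_prod mu]_(z in X `*` E) b z.
Proof. by move=> ia ib; apply: RintegralB => //; exact: measurableX. Qed.

End nu_prod_linearity.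

Theorem theorem4p5 (R : realType) (k : nat) (M : rel 'I_k.+1)
  (mu : probability (Sigma k) R) (th : R) (f : Sigma k -> R)
  (psi_re psi_im : Sigma k -> R -> R) (eta : Sigma k -> cmeasure R)
  (kk : nat) (eps : R) :
  topologically_mixing (SFT M) ->
  gibbs_measure (SFT M) mu ->
  0 < th < 1 ->
  lip_theta th (SFT M) f ->
  \int[mu]_(x in SFT M) f x = 0 ->
  collapsed_accessible th (SFT M) f ->
  L_plus th (SFT M) psi_re psi_im ->
  G_plus (SFT M) eta ->
  0 < eps ->
  exists C : R, 0 < C /\
    forall n : nat, (0 < n)%N ->
      ((cov_abs mu (SFT M) eta f n psi_re psi_im)%:E
       <= C%:E * (LF mu (SFT M) eta (n%:R `^ (- (2^-1) + eps)) + (n%:R ^- kk)%:E))%E.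
Proof.
move=> mix gib th01 lipf _ cacc psiL [[TV hTV] meta] eps0.
have muX : mu (SFT M) = 1%E by have [] := gib.
have mX : measurable (SFT M) := measurable_SFT M.
have X0 : exists x, SFT M x.
  apply: contrapT => nX.
  have : mu (SFT M) = 0%E.
    by rewrite (_ : SFT M = set0) ?measure0//; apply/seteqP; split => // x Xx; apply: nX; exists x.
  by rewrite muX => -[] /eqP; rewrite oner_eq0.
have [th' [g [q [A [thth' NW transfer]]]]] := gibbs_transfer mix gib th01.
have [F F0 hf] := lip_theta_lipX th01 thth' lipf.
have [c0 [N acc]] := collapsed_accessible_agree th01 cacc.
have [sp Lp] := L_plus_component th01 thth' psiL.
have [sq Lq] := L_plus_component th01 thth' (L_plusC psiL).
pose m1 x := cm1 (eta x); pose m2 x := cm2 (eta x).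
pose m3 x := cm3 (eta x); pose m4 x := cm4 (eta x).
have mm12 E : measurable E -> measurable_fun (SFT M) (fun x => signed_measure (m1 x) (m2 x) E).
  by move=> /meta[].
have mm34 E : measurable E -> measurable_fun (SFT M) (fun x => signed_measure (m3 x) (m4 x) E).
  by move=> /meta[].
have V12 x : SFT M x -> tv_le (m1 x) (m2 x) setT TV by move=> /hTV/cm_tv_tv_le[].
have V34 x : SFT M x -> tv_le (m3 x) (m4 x) setT TV by move=> /hTV/cm_tv_tv_le[].
pose punct n : set R := [set s | - (n%:R `^ (- 2^-1 + eps)) < s < n%:R `^ (- 2^-1 + eps)] `\` [set 0].
pose t n x := fine (cm_tv (eta x) (punct n)).
have tE n x : SFT M x -> cm_tv (eta x) (punct n) = (t n x)%:E.
  move=> Xx; rewrite fineK// ge0_fin_numE ?cm_tv_ge0//.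
  exact: le_lt_trans (le_trans (cm_tv_le _ (@subsetT _ _)) (hTV x Xx)) (ltry _).
have t0 n x : SFT M x -> 0 <= t n x by move=> Xx; rewrite -lee_fin -tE// cm_tv_ge0.
have t12 n x : SFT M x -> tv_le (m1 x) (m2 x) (punct n) (t n x).
  by move=> Xx; have [] : tv_le (m1 x) (m2 x) (punct n) (t n x) /\ tv_le (m3 x) (m4 x) (punct n) (t n x)
    by apply: cm_tv_tv_le; rewrite tE.
have t34 n x : SFT M x -> tv_le (m3 x) (m4 x) (punct n) (t n x).
  by move=> Xx; have [] : tv_le (m1 x) (m2 x) (punct n) (t n x) /\ tv_le (m3 x) (m4 x) (punct n) (t n x)
    by apply: cm_tv_tv_le; rewrite tE.
have LFE n : LF mu (SFT M) eta (n%:R `^ (- 2^-1 + eps)) = (\int[mu]_(x in SFT M) (t n x)%:E)%E.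
  by apply: eq_integral => x; rewrite inE => Xx; rewrite -tE.
pose om1 : R := - (pi / 2).
pose J12 om n u := \int[nu_prod mu]_(z in SFT M `*` setT)
  (fs_re eta om (iter n sshift z.1) (z.2 + birkhoff f n z.1) * u z.1 z.2).
pose J34 om n u := \int[nu_prod mu]_(z in SFT M `*` setT)
  (fs_im eta om (iter n sshift z.1) (z.2 + birkhoff f n z.1) * u z.1 z.2).
pose c12 (om : R) := cos om * \int[mu]_(x in SFT M) signed_measure (m1 x) (m2 x) [set 0].
pose c34 (om : R) := cos om * \int[mu]_(x in SFT M) signed_measure (m3 x) (m4 x) [set 0].
pose Iu (u : Sigma k -> R -> R) := \int[nu_prod mu]_(z in SFT M `*` setT) u z.1 z.2.
have [i12 l12] := mean_fourier_stieltjes mu 0 mm12 V12.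
have [i12' l12'] := mean_fourier_stieltjes mu om1 mm12 V12.
have [i34 l34] := mean_fourier_stieltjes mu 0 mm34 V34.
have [i34' l34'] := mean_fourier_stieltjes mu om1 mm34 V34.
have mE (T : R) : measurable [set r : R | - T <= r <= T].
  have -> : [set r : R | - T <= r <= T] = `[- T, T]%classic.
    by apply/seteqP; split => r /=; rewrite in_itv.
  exact: measurable_itv.
have avre : nu_av_re mu (SFT M) eta = c12 0 + c34 om1.
  apply: cvg_lim => //; apply: cvg_trans (cvgD l12 l34').
  apply: near_eq_cvg; near=> T => /=; rewrite -mulrDr; congr (_ * _).
  apply: (etrans (esym (nu_prod_integralD mX (mE T) (i12 T) (i34' T)))); apply: eq_Rintegral => z _.
  by rewrite /Phi_re FS_reE.
have avim : nu_av_im mu (SFT M) eta = c34 0 - c12 om1.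
  apply: cvg_lim => //; apply: cvg_trans (cvgB l34 l12').
  apply: near_eq_cvg; near=> T => /=; rewrite -mulrBr; congr (_ * _).
  apply: (etrans (esym (nu_prod_integralB mX (mE T) (i34 T) (i12' T)))); apply: eq_Rintegral => z _.
  by rewrite /Phi_im FS_imE.
have mT : measurable [set: R] by exact: measurableT.
have covre n : cov_re mu (SFT M) eta f n psi_re psi_im =
    (J12 0 n psi_re - c12 0 * Iu psi_re) + (J34 om1 n psi_re - c34 om1 * Iu psi_re) +
    ((J34 0 n psi_im - c34 0 * Iu psi_im) - (J12 om1 n psi_im - c12 om1 * Iu psi_im)).
  have [j1 _ _] := correlation_integral NW transfer hf sp Lp 0 mm12 V12 n.
  have [j2 _ _] := correlation_integral NW transfer hf sp Lp om1 mm34 V34 n.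
  have [j3 _ _] := correlation_integral NW transfer hf sq Lq 0 mm34 V34 n.
  have [j4 _ _] := correlation_integral NW transfer hf sq Lq om1 mm12 V12 n.
  rewrite /cov_re avre avim.
  transitivity ((J12 0 n psi_re + J34 om1 n psi_re + (J34 0 n psi_im - J12 om1 n psi_im)) -
    ((c12 0 + c34 om1) * Iu psi_re + (c34 0 - c12 om1) * Iu psi_im)); last by ring.
  congr (_ - _).
  have e := nu_prod_integralD mX mT (nu_prod_integrableD mX mT j1 j2) (nu_prod_integrableB mX mT j3 j4).
  have e1 := nu_prod_integralD mX mT j1 j2; have e2 := nu_prod_integralB mX mT j3 j4.
  apply: etrans (etrans e (f_equal2 (fun a b => a + b) e1 e2)).
  by apply: eq_Rintegral => z _; rewrite /Phi_re /Phi_im /Fn /= FS_reE FS_imE /fs_re /fs_im /m1 /m2 /m3 /m4; ring.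
have covim n : cov_im mu (SFT M) eta f n psi_re psi_im =
    (J34 0 n psi_re - c34 0 * Iu psi_re) - (J12 om1 n psi_re - c12 om1 * Iu psi_re) -
    ((J12 0 n psi_im - c12 0 * Iu psi_im) + (J34 om1 n psi_im - c34 om1 * Iu psi_im)).
  have [j1 _ _] := correlation_integral NW transfer hf sp Lp 0 mm34 V34 n.
  have [j2 _ _] := correlation_integral NW transfer hf sp Lp om1 mm12 V12 n.
  have [j3 _ _] := correlation_integral NW transfer hf sq Lq 0 mm12 V12 n.
  have [j4 _ _] := correlation_integral NW transfer hf sq Lq om1 mm34 V34 n.
  rewrite /cov_im avre avim.
  transitivity ((J34 0 n psi_re - J12 om1 n psi_re - (J12 0 n psi_im + J34 om1 n psi_im)) -
    ((c34 0 - c12 om1) * Iu psi_re - (c12 0 + c34 om1) * Iu psi_im)); last by ring.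
  congr (_ - _).
  have e := nu_prod_integralB mX mT (nu_prod_integrableB mX mT j1 j2) (nu_prod_integrableD mX mT j3 j4).
  have e1 := nu_prod_integralB mX mT j1 j2; have e2 := nu_prod_integralD mX mT j3 j4.
  apply: etrans (etrans e (f_equal2 (fun a b => a - b) e1 e2)).
  by apply: eq_Rintegral => z _; rewrite /Phi_re /Phi_im /Fn /= FS_reE FS_imE /fs_re /fs_im /m1 /m2 /m3 /m4; ring.
have dec u om : (forall x, SFT M x -> schwartz_real (u x)) ->
    (forall l, exists2 L, 0 <= L & forall n x y, SFT M x -> SFT M y -> agree n x y ->
      \int[lebesgue_measure]_r `|derive1n l (u x) r - derive1n l (u y) r| <= L * th' ^+ n) ->
    exists2 C, 0 < C & forall n, (0 < n)%N ->
      (`|J12 om n u - c12 om * Iu u|%:E <=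
         C%:E * (\int[mu]_(x in SFT M) (t n x)%:E + (n%:R ^- kk)%:E))%E /\
      (`|J34 om n u - c34 om * Iu u|%:E <=
         C%:E * (\int[mu]_(x in SFT M) (t n x)%:E + (n%:R ^- kk)%:E))%E.
  move=> su Lu.
  have [Ca Ca0 ha] := component_decay NW muX transfer hf su Lu om mm12 V12 F0 acc X0 kk eps0.
  have [Cb Cb0 hb] := component_decay NW muX transfer hf su Lu om mm34 V34 F0 acc X0 kk eps0.
  exists (Ca + Cb) => [|n n0]; first exact: addr_gt0.
  have T0 : (0 <= \int[mu]_(x in SFT M) (t n x)%:E + (n%:R ^- kk)%:E)%E.
    apply: adde_ge0; last by rewrite lee_fin invr_ge0 exprn_ge0.
    by apply: integral_ge0 => x Xx; rewrite lee_fin t0.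
  split.
    apply: le_trans (ha n n0 (t n) (t0 n) (t12 n)) _; apply: lee_wpmul2r => //.
    by rewrite lee_fin lerDl ltW.
  apply: le_trans (hb n n0 (t n) (t0 n) (t34 n)) _; apply: lee_wpmul2r => //.
  by rewrite lee_fin lerDr ltW.
have [C1 C10 h1] := dec psi_re 0 sp Lp; have [C2 C20 h2] := dec psi_re om1 sp Lp.
have [C3 C30 h3] := dec psi_im 0 sq Lq; have [C4 C40 h4] := dec psi_im om1 sq Lq.
exists (2 * (C1 + C2 + C3 + C4)); split; first by rewrite mulr_gt0// !addr_gt0.
move=> n n0; rewrite LFE.
have := (h1 n n0, h2 n n0, h3 n n0, h4 n n0).
have T0 : (0 <= \int[mu]_(x in SFT M) (t n x)%:E)%E.
  by apply: integral_ge0 => x Xx; rewrite lee_fin t0.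
case: (integral _ _ _) T0 => [r||//] r0; last first.
  by move=> _; rewrite addye// gt0_muley ?leey// lte_fin mulr_gt0// !addr_gt0.
rewrite -EFinD -!EFinM !lee_fin => -[[[[a1 b1] [a2 b2]] [a3 b3]] [a4 b4]].
apply: le_trans (sqrt_sum_le _ _) _; rewrite covre covim.
apply: le_trans (lerD (ler_normD _ _) (ler_normB _ _)) _.
apply: le_trans (lerD (lerD (ler_normD _ _) (ler_normB _ _)) (lerD (ler_normB _ _) (ler_normD _ _))) _.
by nra.
Unshelve. all: by end_near. Qed.
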